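(* Let $(\mathcal{M},g)$ be a compact, connected, oriented Riemannian manifold with induced distance $d$. Let $X$ be a random element of $\mathcal{M}$ with density $f_X$ with respect to the volume measure $\nu$, such that $(f_X\nu)\otimes(f_X\nu)$-almost every pair $(x,y)\in\mathcal{M}\times\mathcal{M}$ is joined by a unique minimizing geodesic. Assume that the family of sets $\mathcal{A}=\{A_p:p\in\mathcal{M}\}$, where $$A_p=\left\{(x,y)\in\mathcal{M}\times\mathcal{M}:\ \tfrac{xy}{2}\in\bar B\left(p,\tfrac{d(x,y)}{2}\right)\right\},$$ has finite Vapnik–Chervonenkis dimension. Let $BD$ be the depth function of $X$ and, for an i.i.d. sequence $X_1,X_2,\dots$ distributed as $X$, let $\widehat{BD}_n$ be the empirical depth function based on $X_1,\dots,X_n$. Then $$\sup_{p\in\mathcal{M}}\left|\widehat{BD}_n(p)-BD(p)\right|\to 0\quad\text{almost surely as } n\to+\infty .$$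
   Context: For points $x,y\in\mathcal{M}$ joined by a unique minimizing geodesic, $\frac{xy}{2}$ denotes the midpoint of that geodesic, and $B_{xy}$ denotes the closed geodesic ball with center $\frac{xy}{2}$ and radius $d(x,y)/2$. By assumption this is defined almost surely for pairs of independent copies of $X$. $\bar B(p,r)$ is the closed ball $\{z\in\mathcal{M}: d(z,p)\le r\}$. Depth: for $p\in\mathcal{M}$, $BD(p):=P(p\in B_{X_1X_2})$, where $X_1,X_2$ are independent with the same distribution as $X$. Empirical depth: for an i.i.d. sample $X_1,\dots,X_n$ ($n\ge 2$) distributed as $X$, $\widehat{BD}_n(p):=\binom{n}{2}^{-1}\sum_{1\le i_1<i_2\le n}\mathbf{1}_{B_{X_{i_1}X_{i_2}}}(p)$. *)

(* Defs.v *)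
From HB Require Import structures.
From mathcomp Require Export all_boot all_order all_algebra.
From mathcomp Require Export all_classical all_reals all_analysis.
Export Order.TTheory GRing.Theory Num.Theory.
Export numFieldNormedType.Exports.

Set Implicit Arguments.
Unset Strict Implicit.
Unset Printing Implicit Defensive.

#[global] Open Scope classical_set_scope.
#[global] Open Scope ring_scope.

Section euclidean.
Context {R : realType}.

Fixpoint pderiv n (s : seq 'I_n) (f : 'rV[R]_n -> R) : 'rV[R]_n -> R :=
  if s is k :: s' then fun u => 'D_(delta_mx 0 k) (pderiv s' f) u else f.

(* C^oo on an open set: all iterated partial derivatives exist and are
   continuous. *)
Definition smooth_on n (U : set 'rV[R]_n) (f : 'rV[R]_n -> R) :=
  forall (s : seq 'I_n) (u : 'rV[R]_n), U u ->
    {for u, continuous (pderiv s f)} /\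
    forall k : 'I_n, derivable (pderiv s f) u (delta_mx 0 k).

(* Integral over R^n of a nonnegative Borel function: the integral against the
   n-fold product of the one-dimensional Lebesgue measure, in iterated form. *)
Fixpoint lebesgue_integral_rV n : ('rV[R]_n -> \bar R) -> \bar R :=
  if n is m.+1 then fun F : 'rV[R]_(1 + m) -> \bar R =>
    (\int[lebesgue_measure]_x
       lebesgue_integral_rV (fun v : 'rV[R]_m => F (row_mx (const_mx x) v)))%E
  else fun F => F 0.

End euclidean.

(* An oriented smooth n-manifold, given by a positively oriented smooth atlas,
   with a Riemannian metric. The chart [phi i] is used only on [dom i], and its
   inverse [psi i] only on the image of [dom i]. The metric is given by its Gram
   matrices [gram i u] in the coordinates of the chart i. Tangent vectors are
   row vectors, so a vector v in the chart i reads v *m jacobian _ u in the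
   chart j. *)
Record oriented_riemannian (R : realType) (n : nat) (M : topologicalType) :=
  OrientedRiemannian {
  chart : Type;
  dom : chart -> set M;
  phi : chart -> M -> 'rV[R]_n;
  psi : chart -> 'rV[R]_n -> M;
  chart_at : M -> chart;
  gram : chart -> 'rV[R]_n -> 'M[R]_n;
  manifold_hausdorff : hausdorff_space M;
  manifold_second_countable : @second_countable M;
  chart_atP : forall x, dom (chart_at x) x;
  dom_open : forall i, open (dom i);
  img_open : forall i, open (phi i @` dom i);
  phi_continuous : forall i x, dom i x -> {for x, continuous (phi i)};
  psi_continuous : forall i u, (phi i @` dom i) u -> {for u, continuous (psi i)};
  phiK : forall i x, dom i x -> psi i (phi i x) = x;
  transition_smooth : forall i j (k : 'I_n),
    smooth_on (phi i @` (dom i `&` dom j)) (fun u => phi j (psi i u) 0 k);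
  transition_oriented : forall i j u, (phi i @` (dom i `&` dom j)) u ->
    0 < \det (jacobian (phi j \o psi i) u);
  gram_smooth : forall i (k l : 'I_n),
    smooth_on (phi i @` dom i) (fun u => gram i u k l);
  gram_sym : forall i u, (phi i @` dom i) u -> (gram i u)^T = gram i u;
  gram_pos : forall i u (v : 'rV[R]_n), (phi i @` dom i) u -> v != 0 ->
    0 < (v *m gram i u *m v^T) 0 0;
  gram_transition : forall i j u, (phi i @` (dom i `&` dom j)) u ->
    gram i u = jacobian (phi j \o psi i) u *m gram j (phi j (psi i u))
                 *m (jacobian (phi j \o psi i) u)^T
}.

Section riemannian.
Context {R : realType} {n : nat} {M : topologicalType}.
Variable G : oriented_riemannian R n M.
Implicit Types (c : R -> M) (x y p : M).

Definition coord c (i : chart G) (k : 'I_n) : R -> R :=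
  fun t => phi i (c t) 0 k.

Definition velocity c (i : chart G) (t : R) : 'rV[R]_n :=
  \row_k derive1 (coord c i k) t.

(* The value does not depend on the chart around [c t] that is used. *)
Definition speed c (t : R) : R :=
  let i := chart_at G (c t) in
  Num.sqrt ((velocity c i t *m gram i (phi i (c t)) *m (velocity c i t)^T) 0 0).

Definition arc_length c : R :=
  \int[lebesgue_measure]_(t in `[0, 1]) speed c t.

Definition C1_on (I : set R) c := forall t, I t ->
  {for t, continuous c} /\
  forall i k, dom i (c t) ->
    derivable (coord c i k) t 1 /\ {for t, continuous (derive1 (coord c i k))}.

(* [c] restricted to [0, 1] is a C^1 curve, up to the end points. *)
Definition C1_arc c := exists I : set R, [/\ open I, `[0, 1] `<=` I & C1_on I c].

(* There is a piecewise C^1 curve of length l from x to y; the curve is given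
   as a chain of C^1 arcs, each parametrized by [0, 1]. *)
Inductive joined_by_length : M -> M -> R -> Prop :=
| joined_nil x : joined_by_length x x 0
| joined_cons c y l : C1_arc c -> joined_by_length (c 1) y l ->
    joined_by_length (c 0) y (arc_length c + l).

Definition dist x y : R := inf [set l | joined_by_length x y l].

Definition closed_ball_dist p (r : R) : set M := [set z | dist z p <= r].

Definition christoffel (i : chart G) (u : 'rV[R]_n) (k a b : 'I_n) : R :=
  2^-1 * \sum_(l < n) invmx (gram i u) k l *
    (pderiv [:: a] (fun w => gram i w b l) u +
     pderiv [:: b] (fun w => gram i w a l) u -
     pderiv [:: l] (fun w => gram i w a b) u).

Definition geodesic_at c (t : R) := forall (i : chart G) (k : 'I_n),
  dom i (c t) ->
  [/\ derivable (coord c i k) t 1,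
      derivable (derive1 (coord c i k)) t 1 &
      derive1 (derive1 (coord c i k)) t +
      \sum_(a < n) \sum_(b < n) christoffel i (phi i (c t)) k a b *
        derive1 (coord c i a) t * derive1 (coord c i b) t = 0].

(* Affinely parametrized by [0, 1]. The values of [c] outside [0, 1] are
   irrelevant, so the geodesic equation is required on the open interval and
   continuity on the closed one. *)
Definition geodesic c :=
  {within `[0, 1], continuous c} /\ forall t, 0 < t < 1 -> geodesic_at c t.

Definition minimizing_geodesic x y c :=
  [/\ geodesic c, c 0 = x, c 1 = y & arc_length c = dist x y].

Definition is_unique_minimizing_geodesic x y c :=
  minimizing_geodesic x y c /\
  forall c', minimizing_geodesic x y c' -> {in `[0, 1], c' =1 c}.

Definition uniquely_joined x y := exists c, is_unique_minimizing_geodesic x y c.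

Definition is_midpoint x y (m : M) :=
  exists2 c, is_unique_minimizing_geodesic x y c & m = c 2^-1.

(* Empty for pairs that are not joined by a unique minimizing geodesic. *)
Definition geodesic_ball x y : set M :=
  [set z | exists2 m, is_midpoint x y m & closed_ball_dist m (dist x y / 2) z].

Definition depth_set p : set (M * M) :=
  [set z | exists2 m, is_midpoint z.1 z.2 m &
                      closed_ball_dist p (dist z.1 z.2 / 2) m].

End riemannian.

Definition borel (M : ptopologicalType) := g_sigma_algebraType (@open M).

Section measure.
Context {R : realType} {n : nat} {M : ptopologicalType}.
Variable G : oriented_riemannian R n M.

Definition is_volume (nu : {measure set (borel M) -> \bar R}) :=
  forall (i : chart G) (A : set (borel M)), measurable A -> A `<=` dom i ->
    nu A = lebesgue_integral_rV (fun u =>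
      (\1_(phi i @` A) u * Num.sqrt (\det (gram i u)))%:E).

Definition depth (mu : probability (borel M) R) (p : M) : R :=
  fine ((mu \x mu)%E [set z | geodesic_ball G z.1 z.2 p]).

(* The sample is x 0, ..., x (m - 1). *)
Definition empirical_depth (x : nat -> M) (m : nat) (p : M) : R :=
  ('C(m, 2)%:R)^-1 *
  \sum_(i < m) \sum_(j < m | (i < j)%N) \1_(geodesic_ball G (x i) (x j)) p.

End measure.

Definition shatters T (F : set (set T)) (C : set T) :=
  forall B, B `<=` C -> exists2 A, F A & A `&` C = B.

Definition finite_VC_dimension T (F : set (set T)) :=
  exists k : nat, forall C : set T,
    finite_set C -> shatters F C -> (C #<= `I_k)%card.

Definition mutually_independent (R : realType) d d' (T : measurableType d)
    (T' : measurableType d') (P : probability T R) (X : nat -> {mfun T >-> T'}) :=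
  forall (s : seq nat) (A : nat -> set T'),
    uniq s -> (forall i, measurable (A i)) ->
    P (\bigcap_(i in [set` s]) (X i @^-1` A i)) =
    (\prod_(i <- s) P (X i @^-1` A i))%E.

(* Main.v *)
(** The statement is a uniform law of large numbers for the relation "p lies in
    the ball of the pair (x, y)". The pairs a < b < m split, according to the
    value of a + b modulo m, into m families of disjoint pairs, along each of
    which the depth is an average of i.i.d. indicators. For one such family,
    Chebyshev's inequality allows one to replace the expectation by the average
    over an independent copy of the sample; exchanging the two samples pair by
    pair then introduces random signs, and the finite VC dimension leaves only
    polynomially many sign problems, each with a subgaussian tail. The resulting
    bounds, polynomial times exp(-c m), are summable, and Borel-Cantelli
    concludes.

    The geometry serves to make all these events measurable. By the geodesic
    equation, a pointwise limit (along an ultrafilter) of minimizing geodesics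
    is a minimizing geodesic, so by compactness the set of (x, y, q) such that q
    sits at time t on a minimizing geodesic from x to y is closed. Hence
    uniqueness of the geodesic is a Borel condition on (x, y), under which the
    ball relation is closed, and the pairs whose ball meets a given closed set
    form a Borel set. By compactness again, the event that some p lies in
    prescribed balls and outside of others is Borel in the sample. *)

From HB Require Import structures.
Require Import Defs.
From mathcomp Require Import ring lra zify.

Set Implicit Arguments.
Unset Strict Implicit.
Unset Printing Implicit Defensive.

(** * Calculus *)

(** The deviation event, an uncountable union over [p], is never shown to be measurable. It is
    enclosed in the set of samples for which the section of the symmetrized event has probability at
    least 1/2, and that set is measurable as soon as the symmetrized event is. Pointwise limits of
    curves suffice because minimizing geodesics satisfy, in one chart and on a common time interval,
    Taylor inequalities whose constants depend only on the metric and on a bound for the speed. Each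
    inequality compares values at two times, so it survives the limit, first for positions, then for
    velocities. Length is in general not continuous under pointwise convergence; here conservation
    of speed turns it into the speed at time 1/2, which converges. Ultrafilters take the place of
    extracted subsequences: positions and velocities, being bounded, all converge along the same
    one. *)

Lemma near_eq_continuous (T U : topologicalType) (f g : T -> U) t :
  {near t, f =1 g} -> {for t, continuous f} -> {for t, continuous g}.
Proof.
move=> E fc; have tE := nbhs_singleton E; suff : g @ t --> g t by [].
rewrite -tE; apply: cvg_trans (fc : f @ t --> f t); apply: near_eq_cvg.
exact: E.
Qed.

(** An ultrafilter converges to each of its cluster points, since it contains every set or its
    complement. *)
Lemma ultra_cvg_compact (S : Type) (T : topologicalType) (F : set_system S)
    (h : S -> T) (K : set T) : UltraFilter F -> compact K ->
  (\forall c \near F, K (h c)) -> exists2 p, K p & h @ F --> p.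
Proof.
move=> FU Kc FK; have [p [Kp pF]] := Kc (h @ F) _ FK.
exists p => // B nB; have [//|FB] := in_ultra_setVsetC (h @^-1` B) FU.
by have [x [/= NB Bx]] := pF (~` B) B FB nB.
Qed.

Section real_line.
Context {R : realType}.

Lemma near_oo (a b t : R) : a < t < b -> \forall q \near t, a < q < b.
Proof.
move=> tab; have : nbhs t `]a, b[%classic.
  by apply: open_nbhs_nbhs; split; [exact: interval_open|rewrite /= in_itv].
by apply: filterS => q; rewrite /= in_itv.
Qed.

(** The free slope [c] lets one estimate serve both as a Lipschitz bound ([c = 0]) and as a
    first-order Taylor bound. *)
Lemma MVT_le (g : R -> R) (a b c e : R) : a <= b ->
  (forall s, a < s < b -> derivable g s 1 /\ `|derive1 g s - c| <= e) ->
  {within `[a, b], continuous g} ->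
  `|g b - g a - c * (b - a)| <= e * (b - a).
Proof.
move=> ab gd gc; have [->|neab] := eqVneq a b.
  by rewrite !subrr !mulr0 subrr normr0.
have {}ab : a < b by rewrite lt_neqAle neab.
have gd1 x : x \in `]a, b[ -> is_derive x 1 g (derive1 g x).
  by rewrite in_itv/= => /gd[gx _]; rewrite derive1E; exact: derivableP.
have [y yab ->] := MVT ab gd1 gc.
rewrite -mulrBl normrM (@gtr0_norm _ (b - a)) ?subr_gt0//.
by rewrite ler_pM2r ?subr_gt0//; move: yab; rewrite in_itv/= => /gd[].
Qed.

Lemma MVT_between (g : R -> R) (a b c e : R) :
  (forall s, Num.min a b < s < Num.max a b ->
     derivable g s 1 /\ `|derive1 g s - c| <= e) ->
  {within `[Num.min a b, Num.max a b], continuous g} ->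
  `|g b - g a - c * (b - a)| <= e * `|b - a|.
Proof.
wlog ab : a b / a <= b.
  move=> H; have [/H//|ba] := orP (le_total a b).
  rewrite minC maxC => /(H _ _ ba)/[apply].
  rewrite -normrN (distrC a); set x := (X in `|X|) => H1.
  by rewrite (_ : _ - _ = x)// /x; ring.
rewrite min_l// max_r// => gd; rewrite (@ger0_norm _ (b - a)) ?subr_ge0//.
exact: MVT_le.
Qed.

Lemma MVT_le_sym (g : R -> R) (a b c e : R) :
  (forall s, Num.min a b <= s <= Num.max a b ->
     derivable g s 1 /\ `|derive1 g s - c| <= e) ->
  `|g b - g a - c * (b - a)| <= e * `|b - a|.
Proof.
move=> gd; apply: MVT_between => [s /andP[sa sb]|]; first by apply: gd; rewrite !ltW.
apply: derivable_within_continuous => x; rewrite in_itv/= => xab.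
by have [] := gd x xab.
Qed.

Lemma within01_nbhs (T : topologicalType) (c : R -> T) (t : R) (B : set T) :
  {within `[0, 1], continuous c} -> 0 <= t <= 1 -> nbhs (c t) B ->
  exists2 d : R, 0 < d & forall s, 0 <= s <= 1 -> `|s - t| < d -> B (c s).
Proof.
move=> /subspace_continuousP cc t01 nB.
have /cc/(_ _ nB) : `[0, 1]%classic t by rewrite /= in_itv.
move=> /nbhs_ballP[d d0 dB]; exists d => // s s01 sd; apply: dB.
  by rewrite -ball_normE/= distrC.
by rewrite /= in_itv.
Qed.

(** The difference quotient is multiplied out: in this form the hypothesis can be obtained as a
    limit of inequalities along a filter. *)
Lemma is_derive_le (g : R -> R) (s l : R) :
  (forall e : R, 0 < e -> \forall q \near s, `|g q - g s - l * (q - s)| <= e * `|q - s|) ->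
  is_derive s 1 g l.
Proof.
move=> H; have E : (fun h : R => h^-1 *: ((g \o shift s) (h *: (1 : R)) - g s)) @ 0^' --> l.
  apply/cvgrPdist_le => e e0; have /nbhs_ballP[d d0 dH] := H e e0.
  near=> h; have h0 : h != 0 by near: h; exact: nbhs_dnbhs_neq.
  rewrite /= -[h *: (1 : R)]/(h * 1) mulr1 -[_ *: _]/(_ * _).
  have hb : ball s d (h + s).
    rewrite -ball_normE/= opprD addrCA subrr addr0 normrN.
    by near: h; exact: dnbhs0_lt.
  have := dH _ hb; rewrite /= addrK => le.
  have -> : l - h^-1 * (g (h + s) - g s) = - ((g (h + s) - g s - l * h) / h).
    by field.
  by rewrite normrN normrM normfV ler_pdivrMr// normr_gt0.
split; first exact: cvgP E.
by apply: cvg_lim E; exact: norm_hausdorff.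
Unshelve. all: by end_near. Qed.

Lemma cvg_bigsum {T I : Type} (F : set_system T) {FF : Filter F} (r : seq I)
    (P : pred I) (f : I -> T -> R) (l : I -> R) :
  (forall i, P i -> f i x @[x --> F] --> l i) ->
  \sum_(i <- r | P i) f i x @[x --> F] --> \sum_(i <- r | P i) l i.
Proof. by apply: cvg_big; exact: add_continuous. Qed.

Lemma cvg_bigprod {T I : Type} (F : set_system T) {FF : Filter F} (r : seq I)
    (P : pred I) (f : I -> T -> R) (l : I -> R) :
  (forall i, P i -> f i x @[x --> F] --> l i) ->
  \prod_(i <- r | P i) f i x @[x --> F] --> \prod_(i <- r | P i) l i.
Proof. by apply: cvg_big; exact: mul_continuous. Qed.

End real_line.

(** * Functions of several variables with continuous partial derivatives *)

Section differentiability.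
Context {R : realType} {n : nat}.
Implicit Types (f : 'rV[R]_n -> R) (u v w : 'rV[R]_n).

Lemma coord_le_norm (v : 'rV[R]_n) i j : `|v i j| <= `|v|.
Proof.
rewrite [leRHS]/Num.Def.normr/= mx_normrE.
by apply: (le_trans _ (le_bigmax _ _ (i, j))).
Qed.

Lemma norm_le_coord (v : 'rV[R]_n) (e : R) : 0 <= e ->
  (forall j, `|v 0 j| <= e) -> `|v| <= e.
Proof.
move=> e0 ve; rewrite [leLHS]/Num.Def.normr/= mx_normrE bigmax_le//= => -[i j] _.
by rewrite ord1 ve.
Qed.

Definition linear_form (a : 'I_n -> R) v : R := \sum_k v 0 k * a k.

Fact linear_form_is_linear a : linear (linear_form a).
Proof.
move=> k u v; rewrite /linear_form scaler_sumr -big_split/=.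
apply: eq_bigr => i _; rewrite !mxE mulrDl; congr (_ + _).
by rewrite -[RHS]/(k * (u 0 i * a i)) mulrA.
Qed.

HB.instance Definition _ a :=
  GRing.isLinear.Build _ _ _ _ (linear_form a) (linear_form_is_linear a).

Lemma linear_form_continuous a : continuous (linear_form a).
Proof.
move=> u; apply: (@cvg_bigsum _ _ _ (nbhs u)) => k _; apply: cvgM; last exact: cvg_cst.
exact: coord_continuous.
Qed.

Definition trunc_rV (j : nat) v : 'rV[R]_n :=
  \row_(i < n) (if (i < j)%N then v 0 i else 0).

Lemma trunc_rVS (j : 'I_n) v :
  trunc_rV j.+1 v = v 0 j *: delta_mx 0 j + trunc_rV j v.
Proof.
apply/rowP => i; rewrite !mxE eqxx/=; have [->|ij] := eqVneq i j.
  by rewrite ltnS leqnn ltnn mulr1 addr0.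
rewrite mulr0 add0r ltnS leq_eqVlt; case: eqP => //= /ord_inj eij.
by rewrite eij eqxx in ij.
Qed.

Lemma line_quotient f v w (s : R) :
  (fun h : R => h^-1 *: (f ((h *: (1 : R) + s) *: v + w) - f (s *: v + w))) =
  (fun h : R => h^-1 *: (f (h *: v + (s *: v + w)) - f (s *: v + w))).
Proof.
by apply/funext => h; rewrite -[h *: (1 : R)]/(h * 1) mulr1 scalerDl addrA.
Qed.

Lemma derivable_line f v w (s : R) : derivable f (s *: v + w) v ->
  derivable (fun t : R => f (t *: v + w)) s 1.
Proof. by rewrite /derivable /= line_quotient. Qed.

Lemma derive1_line f v w (s : R) :
  derive1 (fun t : R => f (t *: v + w)) s = 'D_v f (s *: v + w).
Proof. by rewrite derive1E /derive /= line_quotient. Qed.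

(* [f (v + u) - f u] telescopes along the truncations of [v], and each increment is
   controlled by the mean value theorem in one coordinate. *)
Lemma partial_diff f u :
  (\forall w \near u, forall k, derivable f w (delta_mx 0 k)) ->
  (forall k, {for u, continuous (fun w => 'D_(delta_mx 0 k) f w)}) ->
  differentiable f u /\
  'd f u = linear_form (fun k => 'D_(delta_mx 0 k) f u) :> (_ -> _).
Proof.
move=> fd fc; set a := fun k => 'D_(delta_mx 0 k) f u.
pose L : {linear 'rV[R]_n -> R} := linear_form a.
have H : f \o shift u = cst (f u) + (L : 'rV[R]_n -> R) +o_ (0 : 'rV[R]_n) id.
  apply/(eqaddoP (nbhs (0 : 'rV[R]_n)) _ (cst (f u) + (L : 'rV[R]_n -> R)) id).
  move=> e e0.
  (* The [n] increments are each at most [d * |v|]; dividing by [n.+1] also covers [n = 0]. *)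
  set d := e / n.+1%:R.
  have d0 : 0 < d by rewrite divr_gt0.
  have : \forall w \near u, forall k, derivable f w (delta_mx 0 k) /\
      `|'D_(delta_mx 0 k) f w - a k| <= d.
    near=> w => k; split; first by move: k; near: w.
    rewrite distrC; move: k; near: w; apply: filter_forall => k.
    by have /cvgrPdist_le := fc k; apply.
  move=> /nbhs_ballP[r r0 rP].
  have rP' w k : `|w - u| < r -> derivable f w (delta_mx 0 k) /\
      `|'D_(delta_mx 0 k) f w - a k| <= d.
    by move=> wu; apply: rP; rewrite -ball_normE/= distrC.
  near=> v => /=.
  have vr : `|v| < r.
    near: v; apply/nbhs_ballP; exists r => //= y.
    by rewrite -ball_normE/= sub0r normrN.
  have fvE : f (v + u) - f u =
      \sum_(j < n) (f (trunc_rV j.+1 v + u) - f (trunc_rV j v + u)).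
    have -> : v = trunc_rV n v by apply/rowP => i; rewrite mxE ltn_ord.
    have -> : f u = f (trunc_rV 0 v + u).
      by congr f; rewrite -[LHS]add0r; congr (_ + _); apply/rowP => i; rewrite !mxE.
    have tt (j : nat) : trunc_rV j (trunc_rV n v) = trunc_rV j v.
      by apply/rowP => i; rewrite !mxE ltn_ord.
    under eq_bigr do rewrite !tt.
    rewrite -(big_mkord xpredT (fun j => f (trunc_rV j.+1 v + u) - f (trunc_rV j v + u))).
    by rewrite telescope_sumr.
  rewrite [X in `|X|](_ : _ = (f (v + u) - f u) - linear_form a v); last first.
    by rewrite !fctE/= opprD addrA.
  rewrite fvE /linear_form -sumrB (le_trans (ler_norm_sum _ _ _))//.
  apply: (@le_trans _ _ (\sum_(j < n) d * `|v|)); last first.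
    rewrite sumr_const card_ord -mulr_natl mulrA ler_wpM2r//.
    by rewrite /d mulrCA ler_piMr ?(ltW e0)// ler_pdivrMr// mul1r ler_nat.
  apply: ler_sum => j _; rewrite trunc_rVS.
  set g := fun t : R => f (t *: delta_mx 0 j + (trunc_rV j v + u)).
  have := @MVT_le_sym _ g 0 (v 0 j) (a j) d.
  rewrite /g scale0r add0r subr0 addrA [a j * _]mulrC => /(_ _)/le_trans; apply.
    move=> s sv; have {}sv : `|s| <= `|v 0 j|.
      move: sv; rewrite ge_min le_max.
      have v1 := ler_norm (v 0 j); have v2 := ler_norm (- v 0 j).
      have v3 := normr_ge0 (v 0 j); rewrite normrN in v2.
      by case/andP=> /orP[] s1 /orP[] s2; rewrite ler_norml; lra.
    have [|dj dl] := rP' (s *: delta_mx 0 j + (trunc_rV j v + u)) j.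
      rewrite addrA addrK (le_lt_trans _ vr)//.
      apply: norm_le_coord => // i; rewrite !mxE eqxx/=.
      have [->|ij] := eqVneq i j.
        by rewrite ltnn addr0 mulr1 (le_trans sv)// coord_le_norm.
      rewrite mulr0 add0r; case: ifP => _; last by rewrite normr0.
      exact: coord_le_norm.
    by split; [exact: derivable_line|rewrite derive1_line].
  by rewrite ler_wpM2l ?coord_le_norm// ltW.
have Lc : continuous L by exact: linear_form_continuous.
have da : 'd f u = L :> (_ -> _) by exact: diff_unique.
by split => //; apply/diff_locallyP; rewrite da.
Unshelve. all: by end_near. Qed.
End differentiability.

Section smooth_functions.
Context {R : realType}.

Lemma smooth_on_continuous n (U : set 'rV[R]_n) f u (s : seq 'I_n) :
  smooth_on U f -> U u -> {for u, continuous (pderiv s f)}.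
Proof. by move=> /(_ s u) Uf /Uf[]. Qed.

Lemma smooth_on_diff n (U : set 'rV[R]_n) f u : open U -> smooth_on U f -> U u ->
  differentiable f u /\
  'd f u = linear_form (fun k => pderiv [:: k] f u) :> (_ -> _).
Proof.
move=> oU Uf Uu; apply: partial_diff => [|k].
  have := open_nbhs_nbhs (conj oU Uu); apply: filterS => w Uw k.
  by have [_ /(_ k)] := Uf [::] w Uw.
by have [] := Uf [:: k] u Uu.
Qed.

Lemma differentiable_coords (V : normedModType R) n (f : V -> 'rV[R]_n) u :
  (forall k, differentiable (fun v => f v 0 k) u) -> differentiable f u.
Proof.
move=> fd; have -> : f = \sum_(k < n) (fun v => f v 0 k *: delta_mx 0 k).
  apply/funext => v; rewrite fct_sumE; apply/rowP => j; rewrite summxE.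
  rewrite (bigD1 j)//= big1 => [|i ij]; first by rewrite !mxE !eqxx mulr1 addr0.
  by rewrite !mxE eq_sym (negbTE ij) andbF mulr0.
by apply: differentiable_sum => k; exact: differentiableZl.
Qed.

Lemma derivable_rVP n (f : R -> 'rV[R]_n) (t : R) :
  derivable f t 1 <-> forall k, derivable (fun s => f s 0 k) t 1.
Proof.
split=> [/derivable_mxP + k|fd]; first exact.
by apply/derivable_mxP => i j; rewrite ord1.
Qed.

Lemma derive1_rV n (f : R -> 'rV[R]_n) (t : R) : derivable f t 1 ->
  derive1 f t = \row_k derive1 (fun s => f s 0 k) t.
Proof.
move=> fd; rewrite derive1E derive_mx//; apply/rowP => k.
by rewrite !mxE derive1E.
Qed.

Lemma derivable_comp_curve (V W : normedModType R) (f : V -> W) (c : R -> V) (t : R) :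
  differentiable f (c t) -> derivable c t 1 ->
  derivable (f \o c) t 1 /\ derive1 (f \o c) t = 'd f (c t) (derive1 c t).
Proof.
move=> fd cd; have cd' := (derivable1_diffP _ _).1 cd.
split; first by apply/derivable1_diffP; exact: differentiable_comp.
have fcd : differentiable (f \o c) t by exact: differentiable_comp.
by rewrite (derive1E' fcd) (derive1E' cd') (diff_comp cd' fd).
Qed.

End smooth_functions.

(** * Charts and the metric tensor *)

Section riemannian_lemmas.
Context {R : realType} {n : nat} {M : topologicalType}.
Variable G : oriented_riemannian R n M.
Implicit Types (c : R -> M) (x y p : M) (i j : chart G).

Definition img i : set 'rV[R]_n := phi i @` dom i.

Lemma psiP i u : img i u -> dom i (psi i u) /\ phi i (psi i u) = u.
Proof. by move=> [x ix <-]; rewrite phiK. Qed.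

Lemma img_phi i x : dom i x -> img i (phi i x).
Proof. by exists x. Qed.

Definition overlap i j : set 'rV[R]_n := phi i @` (dom i `&` dom j).

Lemma overlap_open i j : open (overlap i j).
Proof.
rewrite openE => _ [x [ix jx] <-]; rewrite /interior.
have : nbhs (phi i x) (img i).
  by apply: open_nbhs_nbhs; split; [exact: img_open|exact: img_phi].
have : nbhs (phi i x) (psi i @^-1` dom j).
  apply: (psi_continuous (img_phi ix)).
  by apply: open_nbhs_nbhs; split; [exact: dom_open|rewrite phiK].
apply: filterS2 => u ju /psiP[du uE]; exists (psi i u) => //.
Qed.

Lemma transition_diff i j u : overlap i j u ->
  differentiable (phi j \o psi i) u.
Proof.
move=> iju; apply: differentiable_coords => k.
exact: (smooth_on_diff (overlap_open (i:=i) (j:=j)) (transition_smooth k) iju).1.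
Qed.

Lemma near_dom c i t : dom i (c t) -> {for t, continuous c} ->
  \forall s \near t, dom i (c s).
Proof.
by move=> it ct; apply: ct; apply: open_nbhs_nbhs; split => //; exact: dom_open.
Qed.

Lemma velocityE c i t : derivable (phi i \o c) t 1 ->
  velocity c i t = derive1 (phi i \o c) t.
Proof. by move=> cd; rewrite derive1_rV. Qed.

Lemma change_chart c i j t : {for t, continuous c} ->
  dom i (c t) -> dom j (c t) -> derivable (phi i \o c) t 1 ->
  derivable (phi j \o c) t 1 /\
  velocity c j t = velocity c i t *m jacobian (phi j \o psi i) (phi i (c t)).
Proof.
move=> ct it jt cd.
have td : differentiable (phi j \o psi i) (phi i (c t)).
  by apply: transition_diff; exists (c t).
have [fd fE] := derivable_comp_curve td cd.
have E : {near t, (phi j \o psi i) \o (phi i \o c) =1 phi j \o c}.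
  by near=> s; rewrite /= phiK//; near: s; exact: near_dom.
have jd := near_eq_derivable E fd.
split=> //; rewrite !velocityE// derive1E -(near_eq_derive _ E) -derive1E fE.
by rewrite -deriveEjacobian// deriveE.
Unshelve. all: by end_near. Qed.

Definition gram_form i (u v : 'rV[R]_n) : R := (v *m gram i u *m v^T) 0 0.

Lemma gram_formE i u v :
  gram_form i u v = \sum_k \sum_l v 0 k * v 0 l * gram i u k l.
Proof.
rewrite /gram_form mxE; under eq_bigr do rewrite !mxE mulr_suml.
rewrite exchange_big; apply: eq_bigr => k _; apply: eq_bigr => l _; ring.
Qed.

Lemma gram_form_chart i j x v : dom i x -> dom j x ->
  gram_form i (phi i x) v =
  gram_form j (phi j x) (v *m jacobian (phi j \o psi i) (phi i x)).
Proof.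
move=> ix jx; rewrite /gram_form (@gram_transition _ _ _ _ i j); last by exists x.
by rewrite phiK// trmx_mul !mulmxA.
Qed.

(** [speed] reads the curve in the chart chosen at [c t], which changes with [t]; continuity and
    differentiation in [t] require one fixed chart. *)
Lemma speedE c i t : {for t, continuous c} -> dom i (c t) ->
  derivable (phi i \o c) t 1 ->
  speed G c t = Num.sqrt (gram_form i (phi i (c t)) (velocity c i t)).
Proof.
move=> ct it cd; rewrite /speed -/(gram_form _ _ _).
have jt := chart_atP G (c t).
have [_ ->] := change_chart ct it jt cd.
by rewrite -gram_form_chart.
Qed.

Lemma gram_form_ge0 i u v : img i u -> 0 <= gram_form i u v.
Proof.
move=> iu; have [->|v0] := eqVneq v 0.
  by rewrite /gram_form !mul0mx mxE.
by apply: ltW; apply: gram_pos.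
Qed.

Lemma gram_form_cvg T (F : set_system T) {FF : Filter F} i (x v : T -> 'rV[R]_n)
    u w : img i u -> x @ F --> u -> v @ F --> w ->
  gram_form i (x t) (v t) @[t --> F] --> gram_form i u w.
Proof.
move=> iu xu vw; under eq_cvg do rewrite gram_formE.
rewrite gram_formE; apply: cvg_bigsum => k _; apply: cvg_bigsum => l _.
have cvg_coord a : v t 0 a @[t --> F] --> w 0 a.
  exact: (cvg_comp _ _ vw (@coord_continuous _ _ _ 0 a w)).
apply: cvgM; first exact: cvgM.
apply: (@cvg_comp _ _ _ x (fun w => gram i w k l) _ (nbhs u) _ xu).
exact: (smooth_on_continuous (s := [::]) (@gram_smooth _ _ _ G i k l) iu).
Qed.

(** By homogeneity it is enough to bound the form below on the unit sphere, where it attains a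
    positive minimum by compactness. The sphere is empty when [n = 0], and then any [a] will do. *)
Lemma gram_form_lb0 i u : img i u ->
  exists2 a : R, 0 < a & forall v, a * `|v| ^+ 2 <= gram_form i u v.
Proof.
move=> iu; set S := [set v : 'rV[R]_n | `|v| = 1].
have hom (k : R) v : gram_form i u (k *: v) = k ^+ 2 * gram_form i u v.
  rewrite !gram_formE mulr_sumr; apply: eq_bigr => a _; rewrite mulr_sumr.
  by apply: eq_bigr => b _; rewrite !mxE; ring.
suff [a a0 aS] : exists2 a : R, 0 < a & forall v, S v -> a <= gram_form i u v.
  exists a => // v; have [->|v0] := eqVneq v 0.
    by rewrite normr0 expr0n mulr0 gram_form_ge0.
  have nv : 0 < `|v| by rewrite normr_gt0.
  have -> : v = `|v| *: (`|v|^-1 *: v) by rewrite scalerA divff ?gt_eqF// scale1r.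
  rewrite hom normrZ normr_id mulrC exprMn -mulrA ler_wpM2l ?sqr_ge0//.
  have Sv : S (`|v|^-1 *: v).
    by rewrite /S/= normrZ normfV normr_id mulVf// gt_eqF.
  by have := aS _ Sv; move: Sv; rewrite /S/= => ->; rewrite expr1n mul1r.
have [/set0P[v0 Sv0]|S0] := pselect (S != set0); last first.
  by exists 1 => // v Sv; exfalso; apply: S0; apply/set0P; exists v.
have [|||v Sv vmin] := @EVT_min_rV R n (gram_form i u) S.
- by exists v0.
- apply: bounded_closed_compact.
    by exists 1; split => // r r1 v; rewrite /S/= => ->; exact: ltW.
  have -> : S = (fun v : 'rV[R]_n => `|v|) @^-1` [set x | x = 1] by [].
  by apply: preimage_closed; [move=> ? _; exact: norm_continuous|exact: closed_eq].
- apply: continuous_subspaceT => v; apply: (@gram_form_cvg _ (nbhs v)) => //.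
  exact: cvg_cst.
exists (gram_form i u v) => //.
  apply: gram_pos => //; rewrite inE/S/= in Sv.
  by rewrite -normr_gt0 Sv.
by move=> w Sw; apply: vmin; rewrite inE.
Qed.

Lemma gram_form_bounds i u0 : img i u0 ->
  exists a b r : R, [/\ 0 < a, 0 < b & 0 < r] /\
    forall u, `|u - u0| <= r -> img i u /\ forall v,
      a * `|v| ^+ 2 <= gram_form i u v <= b * `|v| ^+ 2.
Proof.
move=> iu; have [a a0 aP] := gram_form_lb0 iu.
(* The form has [n ^ 2] terms and each moves by at most [d * |v| ^+ 2], so the total change stays
   below [a / 2 * |v| ^+ 2]; the added 1 keeps the divisor positive when [n = 0]. *)
set N : R := n%:R ^+ 2 + 1.
have N0 : 0 < N by rewrite ltr_wpDl ?sqr_ge0.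
set d := a / 2 / N.
have d0 : 0 < d by rewrite !divr_gt0.
set B := \sum_k \sum_l `|gram i u0 k l|.
have B0 : 0 <= B by apply: sumr_ge0 => k _; apply: sumr_ge0.
have : \forall u \near u0, img i u /\
    forall kl : 'I_n * 'I_n, `|gram i u kl.1 kl.2 - gram i u0 kl.1 kl.2| <= d.
  near=> u; split.
    by near: u; apply: open_nbhs_nbhs; split => //; exact: img_open.
  move=> kl; rewrite distrC; move: kl; near: u; apply: filter_forall => -[k l].
  have := smooth_on_continuous (s := [::]) (@gram_smooth _ _ _ G i k l) iu.
  by move=> /cvgrPdist_le; apply.
move=> /nbhs_ballP[r r0 rP].
exists (a / 2), (B + a / 2), (r / 2); split.
  by split; rewrite ?divr_gt0// ltr_wpDl// divr_gt0.
move=> u ur; have [|iu' gu] := rP u.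
  by rewrite -ball_normE/= distrC (le_lt_trans ur)// ltr_pdivrMr// ltr_pMr// ltr1n.
split => // v.
have D : `|gram_form i u v - gram_form i u0 v| <= a / 2 * `|v| ^+ 2.
  rewrite !gram_formE -sumrB (le_trans (ler_norm_sum _ _ _))//.
  apply: (@le_trans _ _ (\sum_(k < n) \sum_(l < n) `|v| ^+ 2 * d)).
    apply: ler_sum => k _; rewrite -sumrB (le_trans (ler_norm_sum _ _ _))//.
    apply: ler_sum => l _; rewrite -mulrBr normrM ler_pM//; last exact: (gu (k, l)).
    by rewrite normrM expr2 ler_pM// coord_le_norm.
  rewrite !sumr_const !card_ord -mulrnA -[leLHS]mulr_natr natrM -expr2.
  have -> : `|v| ^+ 2 * d * n%:R ^+ 2 = a / 2 * (n%:R ^+ 2 / N) * `|v| ^+ 2.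
    by rewrite /d; ring.
  rewrite ler_wpM2r ?sqr_ge0// -[leRHS]mulr1 ler_wpM2l ?divr_ge0 ?(ltW a0)//.
  by rewrite ler_pdivrMr// mul1r /N lerDl.
have E : gram_form i u0 v <= B * `|v| ^+ 2.
  rewrite gram_formE /B mulr_suml; apply: ler_sum => k _.
  rewrite mulr_suml; apply: ler_sum => l _; rewrite (le_trans (ler_norm _))//.
  rewrite normrM mulrC ler_wpM2l// normrM expr2 ler_pM// coord_le_norm//.
have := aP v; move: D E; rewrite ler_norml mulrDl => /andP[D1 D2] E A.
by apply/andP; split; lra.
Unshelve. all: by end_near. Qed.

End riemannian_lemmas.

Lemma is_derive_line (R : realType) (V : normedModType R) (v u : V) (t : R) :
  is_derive t 1 (fun s : R => s *: v + u) v.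
Proof.
have E : (fun h : R => h^-1 *: (((fun s : R => s *: v + u) \o shift t) (h *: (1 : R))
    - (t *: v + u))) @ 0^' --> v.
  apply: cvg_near_cst; near=> h.
  have h0 : h != 0 by near: h; exact: nbhs_dnbhs_neq.
  rewrite /= -[h *: (1 : R)]/(h * 1) mulr1 opprD addrACA subrr addr0 scalerDl addrK.
  by rewrite scalerA mulVf// scale1r.
split; first exact: cvgP E.
by apply: cvg_lim E; exact: norm_hausdorff.
Unshelve. all: by end_near. Qed.

(** * The Riemannian distance *)

Section distance.
Context {R : realType} {n : nat} {M : topologicalType}.
Variable G : oriented_riemannian R n M.
Implicit Types (c : R -> M) (x y z p : M) (i j : chart G).

Lemma C1_on_derivable (I : set R) c i t : C1_on G I c -> I t -> dom i (c t) ->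
  derivable (phi i \o c) t 1.
Proof.
move=> cI It it; have [_ cd] := cI t It; apply/derivable_rVP => k.
exact: (cd i k it).1.
Qed.

Lemma near_C1_on (I : set R) c i t : open I -> C1_on G I c -> I t ->
  dom i (c t) -> \forall s \near t, I s /\ dom i (c s).
Proof.
move=> oI cI It it; have [ct _] := cI t It; near=> s; split; near: s.
  exact: open_nbhs_nbhs.
exact: near_dom.
Unshelve. all: by end_near. Qed.

Lemma speed_continuous (I : set R) c t : open I -> C1_on G I c -> I t ->
  {for t, continuous (speed G c)}.
Proof.
move=> oI cI It; have it := chart_atP G (c t); set i := chart_at G (c t) in it.
have [ct cd] := cI t It.
have E : {near t, (fun s => Num.sqrt (gram_form i (phi i (c s)) (velocity c i s)))
    =1 speed G c}.
  near=> s; have [Is is_] : I s /\ dom i (c s).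
    by near: s; exact: near_C1_on.
  rewrite (speedE _ is_)//; first by have [] := cI s Is.
  exact: (C1_on_derivable cI Is is_).
apply: (near_eq_continuous E).
apply: (continuous_cvg _ (@sqrt_continuous _ _)).
apply: gram_form_cvg; first exact: img_phi.
  exact: (cvg_comp _ _ ct (phi_continuous it)).
have -> : velocity c i = (fun s => \row_k derive1 (coord c i k) s) by [].
apply/cvgrPdist_le => e e0; near=> s.
apply: norm_le_coord => [|k]; first exact: ltW.
rewrite !mxE; move: k; near: s; apply: filter_forall => k.
by have [_ /cvgrPdist_le] := cd i k it; apply.
Unshelve. all: by end_near. Qed.

Lemma speed_within_continuous (I : set R) c : open I -> `[0, 1] `<=` I ->
  C1_on G I c -> {within `[0, 1], continuous (speed G c)}.
Proof.
move=> oI I01 cI; apply: continuous_in_subspaceT => t; rewrite inE => t01.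
exact: (speed_continuous oI cI (I01 _ t01)).
Qed.

Lemma speed_ge0 c t : 0 <= speed G c t.
Proof. exact: sqrtr_ge0. Qed.

Lemma arc_length_ge0 c : 0 <= arc_length G c.
Proof. by apply: Rintegral_ge0 => t _; exact: speed_ge0. Qed.

Lemma joined_ge0 x y l : joined_by_length G x y l -> 0 <= l.
Proof.
by elim=> // c z k _ _ k0; rewrite addr_ge0// arc_length_ge0.
Qed.

Lemma joined_trans x y z l l' : joined_by_length G x y l ->
  joined_by_length G y z l' -> joined_by_length G x z (l + l').
Proof.
move=> xy; elim: xy z l' => {x y l} [x z l'|c y l cC _ IH z l' yz].
  by rewrite add0r.
by rewrite -addrA; apply: joined_cons => //; exact: IH.
Qed.

Lemma reverse_C1 c : C1_arc G c ->
  C1_arc G (fun t => c (1 - t)) /\ arc_length G (fun t => c (1 - t)) = arc_length G c.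
Proof.
move=> [I [oI I01 cI]]; set d := fun t => c (1 - t).
have onem_cont : continuous (fun t : R => 1 - t).
  by move=> t; apply: cvgB; [exact: cvg_cst|exact: cvg_id].
have onem_der (t : R) : is_derive t 1 (fun t : R => 1 - t : R) (-1).
  have -> : (fun t : R => 1 - t : R) = cst 1 - id by [].
  by apply: is_derive_eq; rewrite sub0r.
set J := (fun t : R => 1 - t) @^-1` I.
have oJ : open J by apply: open_comp => // t _; exact: onem_cont.
have J01 : `[0, 1] `<=` J.
  by move=> t; rewrite /J/= in_itv/= => t01; apply: I01; rewrite /= in_itv/=; lra.
have dd i k t : J t -> dom i (d t) ->
    derivable (coord d i k) t 1 /\
    derive1 (coord d i k) t = - derive1 (coord c i k) (1 - t).
  move=> Jt it; have [_ cd] := cI _ Jt; have [ck _] := cd i k it.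
  have fd : differentiable (coord c i k) (1 - t) by exact/derivable1_diffP.
  have [od oE] := onem_der t.
  have [fod foE] := @derivable_comp_curve _ _ _ (coord c i k) (fun t => 1 - t) t fd od.
  split=> //; rewrite [LHS]foE derive1E oE linearN/=.
  by rewrite -derive1E'.
have dC : C1_on G J d.
  move=> t Jt; have [ct cd] := cI _ Jt.
  have dt : {for t, continuous d} by exact: continuous_comp (onem_cont t) ct.
  split; [exact: dt|move=> i k it; split; [exact: (dd i k t Jt it).1|]].
  have [_ cdc] := cd i k it.
  have E : {near t, (fun s => - derive1 (coord c i k) (1 - s)) =1 derive1 (coord d i k)}.
    near=> s; have [] := dd i k s => //.
      by near: s; exact: open_nbhs_nbhs.
    by near: s; exact: near_dom.
  apply: (near_eq_continuous E).
  by apply: cvgN; exact: continuous_comp (onem_cont t) cdc.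
split; first by exists J.
have E t : `[0, 1]%classic t -> speed G d t = speed G c (1 - t).
  move=> t01; have Jt := J01 _ t01; rewrite /speed.
  have -> : velocity d (chart_at G (d t)) t = - velocity c (chart_at G (d t)) (1 - t).
    by apply/rowP => k; rewrite !mxE; have [] := dd _ k t Jt (chart_atP G (d t)).
  by rewrite linearN mulNmx !mulmxN mulNmx opprK.
have h01 : 0 <= (1 : R) <= 1 by rewrite ler01/=.
have := Rintegration_by_substitution_onem h01 (speed_within_continuous oI I01 cI).
rewrite unstable.onem1 => H; rewrite /arc_length H.
by apply: eq_Rintegral => t; rewrite inE => /E.
Unshelve. all: by end_near. Qed.

Lemma joined_sym x y l : joined_by_length G x y l -> joined_by_length G y x l.
Proof.
elim=> {x y l} [x|c y l cC _ IH]; first exact: joined_nil.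
rewrite addrC; apply: (joined_trans IH); have [dC dl] := reverse_C1 cC.
have := joined_cons dC (joined_nil _ _).
by rewrite dl addr0 subr0 subrr; apply.
Qed.

Lemma has_lbound_joined x y : has_lbound [set l | joined_by_length G x y l].
Proof. by exists 0 => l /joined_ge0. Qed.

Lemma dist_le x y l : joined_by_length G x y l -> dist G x y <= l.
Proof. by move=> xy; apply: ge_inf => //; exact: has_lbound_joined. Qed.

Lemma distC x y : dist G x y = dist G y x.
Proof.
by congr inf; apply/seteqP; split=> l /=; exact: joined_sym.
Qed.

(** The curve is the straight segment in coordinates: its velocity is constantly [w - u], so the
    upper bound on the metric bounds its speed. *)
Lemma segment_joined i (u w : 'rV[R]_n) (b : R) : 0 <= b ->
  (forall s : R, 0 <= s <= 1 -> img i (s *: (w - u) + u) /\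
     forall v, gram_form i (s *: (w - u) + u) v <= b * `|v| ^+ 2) ->
  exists2 l, joined_by_length G (psi i u) (psi i w) l & l <= Num.sqrt b * `|w - u|.
Proof.
move=> b0 H; set v := w - u; set line := fun s : R => s *: v + u.
set c := fun s => psi i (line s).
have line_cont : continuous line.
  move=> s; apply: cvgD; last exact: cvg_cst.
  by apply: cvgZl; exact: cvg_id.
set I := line @^-1` img i.
have oI : open I.
  by apply: open_comp => [t _|]; [exact: line_cont|exact: img_open].
have I01 : `[0, 1] `<=` I by move=> s; rewrite /= in_itv/= => /H[].
have ci s : I s -> dom i (c s) /\ phi i (c s) = line s by exact: psiP.
have c_cont s : I s -> {for s, continuous c}.
  move=> Is; apply: (continuous_comp (line_cont s)); exact: psi_continuous.
have over j s : I s -> dom j (c s) -> overlap i j (line s).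
  by move=> /ci[is_ <-] js; exists (c s).
have cC : C1_on G I c.
  move=> t It; split; first exact: c_cont.
  move=> j k jt; set f := fun u => phi j (psi i u) 0 k.
  have fs : smooth_on (overlap i j) f by exact: transition_smooth.
  have fd s : I s -> dom j (c s) ->
      derivable f (line s) v /\ 'd f (line s) = linear_form (fun k => pderiv [:: k] f (line s)) :> (_ -> _).
    move=> Is js; have [fd fE] := smooth_on_diff (overlap_open (i:=i) (j:=j)) fs (over j s Is js).
    by split=> //; exact: diff_derivable.
  have -> : coord c j k = (fun s => f (s *: v + u)) by [].
  split; first by apply: derivable_line; have [] := fd t It jt.
  (* In another chart [j] the segment is seen through the transition map, whose partial derivatives
     are continuous; the chain rule expresses the derivative through them. *)
  have E : {near t, (fun s => linear_form (fun k => pderiv [:: k] f (line s)) v) =1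
      derive1 (fun s => f (s *: v + u))}.
    near=> s; have [] := fd s.
    + by near: s; exact: open_nbhs_nbhs.
    + by near: s; apply: near_dom => //; exact: c_cont.
    move=> _ <-; rewrite derive1_line deriveE//.
    apply: (smooth_on_diff (overlap_open (i:=i) (j:=j)) fs _).1; apply: over.
    + by near: s; exact: open_nbhs_nbhs.
    + by near: s; apply: near_dom => //; exact: c_cont.
  apply: (near_eq_continuous E).
  apply: (@cvg_bigsum _ _ _ (nbhs t)) => a _; apply: cvgM; first exact: cvg_cst.
  apply: (@cvg_comp _ _ _ line (pderiv [:: a] f) _ (nbhs (line t)) _ (line_cont t)).
  exact: (smooth_on_continuous (s := [:: a]) fs (over j t It jt)).
have spE t : I t -> speed G c t = Num.sqrt (gram_form i (line t) v).
  move=> It; have [it iE] := ci t It.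
  have E : {near t, line =1 phi i \o c}.
    near=> s; have [] := ci s => //.
    by near: s; exact: open_nbhs_nbhs.
  have ld : is_derive t 1 line v by exact: is_derive_line.
  rewrite (speedE _ it) ?iE//; last 2 first.
    exact: c_cont.
    by have [] := near_eq_is_derive E ld.
  rewrite velocityE; last by have [] := near_eq_is_derive E ld.
  by rewrite derive1E (@derive_val _ _ _ _ _ _ _ (near_eq_is_derive E ld)).
exists (arc_length G c + 0).
  have := joined_cons (G := G) (c := c); rewrite /c /line scale0r add0r scale1r subrK.
  by apply; [exists I|exact: joined_nil].
rewrite addr0 /arc_length.
have int_cst (r : R) : lebesgue_measure.-integrable `[0, 1]%classic (EFin \o cst r).
  apply: continuous_compact_integrable; first exact: segment_compact.
  by apply: continuous_subspaceT => ?; exact: cvg_cst.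
apply: le_trans (le_Rintegral (f2 := cst (Num.sqrt b * `|v|)) _ _ (int_cst _) _) _ => //.
- apply: continuous_compact_integrable; first exact: segment_compact.
  exact: speed_within_continuous oI I01 cC.
- move=> t t01; rewrite spE; last exact: I01.
  have -> : cst (Num.sqrt b * `|v|) t = Num.sqrt (b * `|v| ^+ 2).
    by rewrite sqrtrM// sqrtr_sqr normr_id.
  rewrite ler_wsqrtr//.
  by move: t01; rewrite /= in_itv/= => /H[_]; apply.
rewrite Rintegral_cst//= lebesgue_measure_itv/= lte01 oppr0 adde0/= mulr1//.
Unshelve. all: by end_near. Qed.

End distance.

Section distance_topology.
Context {R : realType} {n : nat} {M : topologicalType}.
Variable G : oriented_riemannian R n M.
Hypothesis M_connected : connected [set: M].
Implicit Types (x y z p : M) (i j : chart G).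

Lemma ball_segment (u0 u w : 'rV[R]_n) (r s : R) : 0 <= s <= 1 ->
  `|u - u0| <= r -> `|w - u0| <= r -> `|s *: (w - u) + u - u0| <= r.
Proof.
move=> /andP[s0 s1] ur wr.
have -> : s *: (w - u) + u - u0 = s *: (w - u0) + (1 - s) *: (u - u0).
  by apply/rowP => k; rewrite !mxE; ring.
rewrite (le_trans (ler_normD _ _))// !normrZ (ger0_norm s0) ger0_norm ?subr_ge0//.
have := ler_wpM2l s0 wr; have := ler_wpM2l (_ : 0 <= 1 - s) ur.
rewrite subr_ge0 => /(_ s1); lra.
Qed.

(** Coordinate balls are convex, so segments between points of [W] stay where the metric is bounded
    above. *)
Lemma local_joined x0 : exists2 K : R, 0 <= K &
  let i := chart_at G x0 in exists2 W, nbhs x0 W & forall y z, W y -> W z ->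
  exists2 l, joined_by_length G y z l & l <= K * `|phi i z - phi i y|.
Proof.
have ix := chart_atP G x0; set i := chart_at G x0 in ix *.
have [a [b [r [[a0 b0 r0] H]]]] := gram_form_bounds (img_phi ix).
exists (Num.sqrt b); first exact: sqrtr_ge0.
exists [set y | dom i y /\ `|phi i y - phi i x0| <= r].
  near=> y; split.
    by near: y; apply: open_nbhs_nbhs; split => //; exact: dom_open.
  rewrite distrC; near: y.
  by have /cvgrPdist_le := phi_continuous ix; apply.
move=> y z [iy yr] [iz zr].
have [s s01|l] := @segment_joined _ _ _ G i (phi i y) (phi i z) b (ltW b0).
  have [iu Hv] := H _ (ball_segment s01 yr zr).
  by split=> // v; have /andP[] := Hv v.
by rewrite !phiK//; exists l.
Unshelve. all: by end_near. Qed.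

Lemma near_joined x0 : \forall y \near x0, exists l, joined_by_length G x0 y l.
Proof.
have [K _ [W nW HW]] := local_joined x0.
have Wx := nbhs_singleton nW; apply: filterS nW => y Wy; have [l xyl _] := HW x0 y Wx Wy.
by exists l.
Qed.

(** The points that can be reached from [x] form an open and closed set. As [dist] is a real
    infimum, it carries information only once this set of lengths is known to be nonempty. *)
Lemma all_joined x y : exists l, joined_by_length G x y l.
Proof.
set B := [set y | exists l, joined_by_length G x y l].
suff : B = setT by move=> /seteqP[_ /(_ y)]; apply.
apply: M_connected.
- by exists x; exists 0; exact: joined_nil.
- exists B; last by rewrite setTI.
  rewrite openE => z [l xzl]; rewrite /interior.
  apply: filterS (near_joined z) => w [l' zwl'].
  by exists (l + l'); exact: joined_trans xzl zwl'.
- exists B; last by rewrite setTI.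
  move=> z /(_ _ (near_joined z))[w [[l xwl] [l' zwl']]].
  by exists (l + l'); apply: joined_trans xwl (joined_sym zwl').
Qed.

Lemma dist_ge0 x y : 0 <= dist G x y.
Proof.
apply: lb_le_inf; first by have [l] := all_joined x y; exists l.
by move=> l /joined_ge0.
Qed.

Lemma has_inf_joined x y : has_inf [set l | joined_by_length G x y l].
Proof.
split; last exact: has_lbound_joined.
by have [l] := all_joined x y; exists l.
Qed.

Lemma dist_triangle x y z : dist G x z <= dist G x y + dist G y z.
Proof.
apply/ler_addgt0Pr => e e0.
have e2 : 0 < e / 2 by rewrite divr_gt0.
have [l xyl le] := inf_adherent e2 (has_inf_joined x y).
have [l' yzl' l'e] := inf_adherent e2 (has_inf_joined y z).
rewrite (le_trans (dist_le (joined_trans xyl yzl')))//.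
rewrite -/(dist G x y) in le; rewrite -/(dist G y z) in l'e; lra.
Qed.

Lemma dist_near x0 (e : R) : 0 < e -> \forall y \near x0, dist G x0 y <= e.
Proof.
move=> e0; have [K K0 [W nW HW]] := local_joined x0.
have ix := chart_atP G x0; set i := chart_at G x0 in ix HW.
have K1 : 0 < K + 1 by rewrite ltr_wpDl.
near=> y; have Wy : W y by near: y.
have [l xyl lK] := HW x0 y (nbhs_singleton nW) Wy.
rewrite (le_trans (dist_le xyl))// (le_trans lK)//.
have : `|phi i x0 - phi i y| <= e / (K + 1).
  near: y; have /cvgrPdist_le := phi_continuous ix; apply.
  by rewrite divr_gt0.
rewrite distrC ler_pdivlMr// => /(le_trans _); apply.
by rewrite mulrC ler_wpM2l// lerDl.
Unshelve. all: by end_near. Qed.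

Lemma dist_continuous : continuous (fun z : M * M => dist G z.1 z.2).
Proof.
move=> [x y]; apply/cvgrPdist_le => e e0; have e2 : 0 < e / 2 by rewrite divr_gt0.
have : nbhs (x, y) [set z : M * M | dist G x z.1 <= e / 2 /\ dist G y z.2 <= e / 2].
  by exists ([set a | dist G x a <= e / 2], [set b | dist G y b <= e / 2]);
    [split; exact: dist_near|].
apply: filterS => z [xz yz] /=.
have t1 := dist_triangle x z.1 y; have t2 := dist_triangle z.1 z.2 y.
have t3 := dist_triangle z.1 x z.2; have t4 := dist_triangle x y z.2.
rewrite (distC G z.2) in t2; rewrite (distC G z.1 x) in t3.
rewrite ler_norml; apply/andP; split; lra.
Qed.

End distance_topology.

(** * Conservation of speed along geodesics *)

Section matrix_limits.
Context {R : realType} {T : Type} (F : set_system T) {FF : Filter F}.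

Lemma det_cvg n (A : T -> 'M[R]_n) (B : 'M[R]_n) :
  (forall k l, A t k l @[t --> F] --> B k l) -> \det (A t) @[t --> F] --> \det B.
Proof.
move=> AB; rewrite /determinant; apply: cvg_bigsum => s _.
by apply: cvgM; [exact: cvg_cst|exact: cvg_bigprod].
Qed.

Lemma invmx_cvg n (A : T -> 'M[R]_n) (B : 'M[R]_n) k l :
  (forall k l, A t k l @[t --> F] --> B k l) -> B \in unitmx ->
  (\forall t \near F, A t \in unitmx) ->
  invmx (A t) k l @[t --> F] --> invmx B k l.
Proof.
(* Cramer's rule reduces the inverse to determinants, which are polynomial in the entries. *)
move=> AB Bu Au; have E C : C \in unitmx ->
    invmx C k l = (\det C)^-1 * cofactor C l k :> R.
  by move=> Cu; rewrite /invmx Cu !mxE.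
rewrite E//; apply: (@cvg_trans _ ((fun t => (\det (A t))^-1 * cofactor (A t) l k) @ F)).
  apply: near_eq_cvg; apply: filterS Au => t tu; by rewrite E.
apply: cvgM.
  by apply: cvgV; [rewrite -unitfE -unitmxE|exact: det_cvg].
apply: cvgM; first exact: cvg_cst.
by apply: det_cvg => a b; rewrite !mxE; under eq_cvg do rewrite !mxE; exact: AB.
Qed.

End matrix_limits.

Section geodesic_speed.
Context {R : realType} {n : nat} {M : topologicalType}.
Variable G : oriented_riemannian R n M.
Implicit Types (c : R -> M) (x y z p : M) (i j : chart G) (u v : 'rV[R]_n).

Lemma gram_unit i u : img i u -> gram i u \in unitmx.
Proof.
move=> iu; rewrite -row_free_unit -kermx_eq0; apply/rowV0P => v.
rewrite sub_kermx => /eqP vA; apply/eqP; apply: contraT => v0.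
by have := gram_pos iu v0; rewrite vA mul0mx mxE ltxx.
Qed.

Lemma christoffel_continuous i u k a b : img i u ->
  {for u, continuous (fun u => christoffel i u k a b)}.
Proof.
move=> iu; apply: (@cvgM _ _ (nbhs u)); first exact: cvg_cst.
apply: (@cvg_bigsum _ _ _ (nbhs u)) => l _; apply: (@cvgM _ _ (nbhs u)).
  apply: (@invmx_cvg _ _ (nbhs u)).
  - move=> k' l'.
    exact: (smooth_on_continuous (s := [::]) (@gram_smooth _ _ _ G i k' l') iu).
  - exact: gram_unit.
  - near=> w; apply: gram_unit; near: w.
    by apply: open_nbhs_nbhs; split => //; exact: img_open.
have gc d e m := smooth_on_continuous (s := [:: d]) (@gram_smooth _ _ _ G i e m) iu.
apply: (@cvgB _ _ _ (nbhs u)); last exact: gc.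
by apply: (@cvgD _ _ _ (nbhs u)); exact: gc.
Unshelve. all: by end_near. Qed.

Definition geodesic_acc i u v (k : 'I_n) : R :=
  - \sum_a \sum_b christoffel i u k a b * v 0 a * v 0 b.

Lemma geodesic_acc_cvg T (F : set_system T) {FF : Filter F} i (x v : T -> 'rV[R]_n)
    u w k : img i u -> x @ F --> u -> v @ F --> w ->
  geodesic_acc i (x t) (v t) k @[t --> F] --> geodesic_acc i u w k.
Proof.
move=> iu xu vw; apply: cvgN; apply: cvg_bigsum => a _; apply: cvg_bigsum => b _.
have cvg_coord d : v t 0 d @[t --> F] --> w 0 d.
  exact: (cvg_comp _ _ vw (@coord_continuous _ _ _ 0 d w)).
apply: cvgM => //; apply: cvgM => //.
apply: (@cvg_comp _ _ _ x (fun w => christoffel i w k a b) _ (nbhs u) _ xu).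
exact: christoffel_continuous.
Qed.

(** Lowering the index: multiplication by the Gram matrix cancels the inverse matrix contained in
    the Christoffel symbols. *)
Lemma gram_acc i u v l : img i u ->
  \sum_k gram i u k l * geodesic_acc i u v k =
  - 2^-1 * \sum_a \sum_b (pderiv [:: a] (fun w => gram i w b l) u +
     pderiv [:: b] (fun w => gram i w a l) u -
     pderiv [:: l] (fun w => gram i w a b) u) * v 0 a * v 0 b.
Proof.
move=> iu; set X := fun a b m => (pderiv [:: a] (fun w => gram i w b m) u +
     pderiv [:: b] (fun w => gram i w a m) u -
     pderiv [:: m] (fun w => gram i w a b) u).
have gE k : gram i u k l = gram i u l k.
  by have /matrixP/(_ k l) := gram_sym iu; rewrite mxE.
rewrite mulNr mulr_sumr; transitivity (- \sum_a \sum_b \sum_k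
    gram i u l k * (christoffel i u k a b * v 0 a * v 0 b)).
  rewrite /geodesic_acc; under eq_bigr do rewrite gE mulrN mulr_sumr.
  rewrite sumrN; congr (- _); rewrite exchange_big; apply: eq_bigr => a _.
  under eq_bigr do rewrite mulr_sumr.
  by rewrite exchange_big.
congr (- _); apply: eq_bigr => a _; rewrite mulr_sumr; apply: eq_bigr => b _.
have -> : 2^-1 * (X a b l * v 0 a * v 0 b) = 2^-1 * v 0 a * v 0 b * X a b l by ring.
have <- : \sum_m (gram i u *m invmx (gram i u)) l m * X a b m = X a b l.
  rewrite mulmxV ?gram_unit// (bigD1 l)//= big1 => [|m ml].
    by rewrite mxE eqxx mul1r addr0.
  by rewrite mxE eq_sym (negbTE ml) mul0r.
rewrite mulr_sumr; transitivity (\sum_k \sum_m 2^-1 * v 0 a * v 0 b *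
    (gram i u l k * invmx (gram i u) k m * X a b m)).
  apply: eq_bigr => k _; rewrite /christoffel -/(X a b) !mulr_sumr.
  rewrite !mulr_suml mulr_sumr; apply: eq_bigr => m _; rewrite /X; ring.
rewrite exchange_big; apply: eq_bigr => m _; rewrite mxE mulr_suml mulr_sumr.
by [].
Qed.

(** The left-hand side is what the product rule gives for the derivative of the squared speed along
    a geodesic, so this is the infinitesimal form of conservation of speed. *)
Lemma gram_form_conserved i u v : img i u ->
  \sum_k \sum_l ((geodesic_acc i u v k * v 0 l + v 0 k * geodesic_acc i u v l)
     * gram i u k l + v 0 k * v 0 l *
       \sum_a v 0 a * pderiv [:: a] (fun w => gram i w k l) u) = 0.
Proof.
move=> iu; set P := fun a k l => pderiv [:: a] (fun w => gram i w k l) u.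
set T := \sum_k \sum_l \sum_a v 0 k * v 0 l * v 0 a * P a k l.
have gE k l : gram i u k l = gram i u l k.
  by have /matrixP/(_ k l) := gram_sym iu; rewrite mxE.
set S := \sum_l v 0 l * \sum_k gram i u k l * geodesic_acc i u v k.
transitivity (S + S + T).
  rewrite {1}/S; under [X in X + _ + _]eq_bigr do rewrite mulr_sumr.
  rewrite [X in X + _ + _]exchange_big/=.
  under [X in _ + X + _]eq_bigr do rewrite mulr_sumr.
  rewrite /T -!big_split; apply: eq_bigr => k _ /=.
  rewrite -!big_split; apply: eq_bigr => l _ /=.
  rewrite mulr_sumr (gE l k); congr (_ + _).
    have rE (A B x y g : R) : (A * y + x * B) * g = y * (g * A) + x * (g * B) by ring.
    exact: rE.
  by apply: eq_bigr => a _; rewrite /P !mulrA.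
(* Contracted three times with [v], each of the three derivative terms of a Christoffel symbol
   becomes [T] after renaming indices; they add up to [T + T - T]. *)
have SE : S = - 2^-1 * T.
  transitivity (- 2^-1 * \sum_l \sum_a \sum_b
      (P a b l + P b a l - P l a b) * v 0 a * v 0 b * v 0 l).
    rewrite /S mulr_sumr; apply: eq_bigr => l _; rewrite gram_acc//.
    rewrite mulrCA; congr (_ * _); rewrite mulr_sumr; apply: eq_bigr => a _.
    by rewrite mulr_sumr; apply: eq_bigr => b _; rewrite mulrC.
  congr (_ * _).
  transitivity (\sum_l \sum_a \sum_b P a b l * v 0 a * v 0 b * v 0 l +
     \sum_l \sum_a \sum_b P b a l * v 0 a * v 0 b * v 0 l -
     \sum_l \sum_a \sum_b P l a b * v 0 a * v 0 b * v 0 l).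
    rewrite -big_split -sumrB; apply: eq_bigr => l _ /=.
    rewrite -big_split -sumrB; apply: eq_bigr => a _ /=.
    by rewrite -big_split -sumrB; apply: eq_bigr => b _ /=; ring.
  have -> : \sum_l \sum_a \sum_b P l a b * v 0 a * v 0 b * v 0 l = T.
    rewrite exchange_big; apply: eq_bigr => a _; rewrite exchange_big.
    by apply: eq_bigr => b _; apply: eq_bigr => l _; ring.
  have -> : \sum_l \sum_a \sum_b P b a l * v 0 a * v 0 b * v 0 l = T.
    rewrite exchange_big; apply: eq_bigr => a _; apply: eq_bigr => l _.
    by apply: eq_bigr => b _; ring.
  have -> : \sum_l \sum_a \sum_b P a b l * v 0 a * v 0 b * v 0 l = T.
    rewrite /T [RHS]exchange_big; apply: eq_bigr => l _; rewrite exchange_big.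
    by apply: eq_bigr => b _; apply: eq_bigr => a _; ring.
  by rewrite addrK.
by rewrite SE; field.
Qed.

Lemma geodesic_atE c i t : geodesic_at G c t -> dom i (c t) ->
  derivable (phi i \o c) t 1 /\ forall k,
  is_derive t 1 (derive1 (coord c i k)) (geodesic_acc i (phi i (c t)) (velocity c i t) k).
Proof.
move=> ct it; split; first by apply/derivable_rVP => k; have [] := ct i k it.
move=> k; have [_ dk dE] := ct i k it; apply: DeriveDef => //.
rewrite -derive1E; apply/eqP; rewrite /geodesic_acc -subr_eq0 opprK -[X in _ == X]dE.
by apply/eqP; congr (_ + _); apply: eq_bigr => a _; apply: eq_bigr => b _; rewrite !mxE.
Qed.

Lemma is_derive_bigsum m (h : 'I_m -> R -> R) (d : 'I_m -> R) (t : R) :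
  (forall k, is_derive t 1 (h k) (d k)) ->
  is_derive t 1 (fun s => \sum_k h k s) (\sum_k d k).
Proof.
move=> hd; have -> : (fun s => \sum_k h k s) = \sum_k h k.
  by apply/funext => s; rewrite fct_sumE.
exact: is_derive_sum.
Qed.

Lemma gram_form_geodesic c i t : geodesic_at G c t -> dom i (c t) ->
  is_derive t 1 (fun s => gram_form i (phi i (c s)) (velocity c i s)) 0.
Proof.
move=> ct it; have [pd ad] := geodesic_atE ct it.
set u := phi i (c t) in ad *; set v := velocity c i t in ad *.
have iu : img i u by exact: img_phi.
set x := fun k => derive1 (coord c i k); set g := fun k l s => gram i (phi i (c s)) k l.
have gd k l : is_derive t 1 (g k l) (\sum_a v 0 a * pderiv [:: a] (fun w => gram i w k l) u).
  have [fd fE] := smooth_on_diff (@img_open _ _ _ G i) (@gram_smooth _ _ _ G i k l) iu.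
  have [cd cE] := derivable_comp_curve fd pd.
  apply: DeriveDef => //; rewrite -derive1E cE fE -velocityE//.
have -> : (fun s => gram_form i (phi i (c s)) (velocity c i s)) =
    (fun s => \sum_k \sum_l (x k * x l * g k l) s).
  apply/funext => s; rewrite gram_formE; apply: eq_bigr => k _; apply: eq_bigr => l _.
  by rewrite !mxE.
apply: is_derive_eq; last exact: (gram_form_conserved v iu).
apply: (@is_derive_bigsum n (fun k s => \sum_l (x k * x l * g k l) s)) => k.
apply: (@is_derive_bigsum n (fun l s => (x k * x l * g k l) s)) => l.
apply: is_derive_eq (is_deriveM (is_deriveM (ad k) (ad l)) (gd k l)) _.
have vE a : v 0 a = x a t by rewrite mxE.
rewrite !vE -/(g k l t) /= -![_ *: _]/(_ * _).
rewrite [X in X * \sum_(_ < _) _](_ : _ = x k t * x l t)//.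
rewrite addrC; congr (_ + _).
have rE (A B y z w : R) : w * (y * B + z * A) = (A * z + y * B) * w by ring.
exact: rE.
Qed.

Lemma geodesic_continuous c t : geodesic G c -> 0 < t < 1 -> {for t, continuous c}.
Proof.
move=> [cc _] t01; have : {within `]0, 1[, continuous c}.
  by apply: continuous_subspaceW cc; exact: subset_itv_oo_cc.
rewrite continuous_open_subspace; last exact: interval_open.
by apply; rewrite inE/= in_itv.
Qed.

Lemma geodesic_speedE c i t : geodesic G c -> 0 < t < 1 -> dom i (c t) ->
  speed G c t = Num.sqrt (gram_form i (phi i (c t)) (velocity c i t)).
Proof.
move=> cg t01 it; have [_ /(_ t t01)ct] := cg.
apply: speedE => //; first exact: geodesic_continuous.
by have [] := geodesic_atE ct it.
Qed.

Lemma geodesic_constant_speed c s t : geodesic G c -> 0 < s < 1 -> 0 < t < 1 ->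
  speed G c s = speed G c t.
Proof.
move=> cg s01 t01; wlog st : s t s01 t01 / s <= t.
  by move=> H; have [/H->//|/H->//] := orP (le_total s t).
have sq (a b : R) : 0 <= a -> 0 <= b -> a ^+ 2 - b ^+ 2 = 0 -> b = a.
  by move=> a0 b0 /subr0_eq/(congr1 Num.sqrt); rewrite !sqrtr_sqr !ger0_norm.
apply: (sq _ _ (speed_ge0 G c t) (speed_ge0 G c s)).
(* The square is differentiated, because the root need not be differentiable where the speed
   vanishes. *)
have qd (r : R) : 0 < r < 1 -> is_derive r 1 (fun r => speed G c r ^+ 2) 0.
  move=> r01; have ir := chart_atP G (c r); set i := chart_at G (c r) in ir.
  have [_ /(_ r r01)cr] := cg.
  apply: near_eq_is_derive (gram_form_geodesic cr ir).
  near=> q; have q01 : 0 < q < 1 by near: q; exact: near_oo.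
  rewrite (@geodesic_speedE _ i)//.
    rewrite sqr_sqrtr// gram_form_ge0//; apply: img_phi; near: q.
    by apply: near_dom => //; exact: geodesic_continuous.
  by near: q; apply: near_dom => //; exact: geodesic_continuous.
have := @MVT_le R (fun r => speed G c r ^+ 2) s t 0 0 st.
rewrite !mul0r subr0 => H; apply/eqP; rewrite -normr_le0; apply: H.
  move=> r rst; have r01 : 0 < r < 1 by lra.
  have [rd rE] := qd r r01; split=> //.
  by rewrite derive1E rE subrr normr0.
apply: derivable_within_continuous => r; rewrite in_itv/= => rst.
by have [] := qd r _ => //; lra.
Unshelve. all: by end_near. Qed.

(** The speed is constant on the open interval, and the end points, where [geodesic] asks for
    continuity only, are negligible for the integral. *)
Lemma geodesic_arc_length c s : geodesic G c -> 0 < s < 1 ->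
  arc_length G c = speed G c s.
Proof.
move=> cg s01; rewrite /arc_length; have E t : 0 < t < 1 -> speed G c t = speed G c s.
  by move=> t01; exact: geodesic_constant_speed.
move: (speed G c) (speed G c s) E => f k E.
have mk : measurable_fun (`](0 : R), 1[%classic : set R) (cst k : R -> R) by exact: measurable_cst.
have {}E : {in `](0 : R), 1[, f =1 cst k} by move=> t; rewrite in_itv/= => /E.
have -> : \int[lebesgue_measure]_(t in `[0, 1]) f t =
    \int[lebesgue_measure]_(t in `[0, 1]) cst k t.
  congr fine; apply: eq_integral_itv_bounded => //.
  by apply: eq_measurable_fun mk => t; rewrite inE => /E.
rewrite Rintegral_cst//=.
by rewrite lebesgue_measure_itv/= lte01 oppr0 adde0/= mulr1.
Qed.

End geodesic_speed.

(** * Limits of minimizing geodesics *)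

Lemma norm_ball_compact (R : realType) n (u : 'rV[R]_n) (r : R) :
  compact [set v : 'rV[R]_n | `|v - u| <= r].
Proof.
apply: bounded_closed_compact.
  exists (`|u| + r); split=> [|q uq v /= vr]; first exact: num_real.
  rewrite -(subrK u v) (le_trans (ler_normD _ _))// addrC.
  by rewrite (le_trans _ (ltW uq))// lerD2l.
have -> : [set v : 'rV[R]_n | `|v - u| <= r] =
    (fun v : 'rV[R]_n => `|v - u|) @^-1` [set x | x <= r] by [].
apply: preimage_closed; last exact: closed_le.
move=> v _; apply: (@cvg_norm _ _ _ (nbhs v)); apply: (@cvgB _ _ _ (nbhs v)).
  exact: cvg_id.
exact: cvg_cst.
Qed.

(* A geodesic of speed at most [D] is controlled as long as it stays in a box of one
   chart where the metric is bounded below by [a] and the Christoffel symbols are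
   bounded by [C]: [L] bounds its coordinate velocity and [A] its acceleration. *)
Section geodesic_box.
Context {R : realType} {n : nat} {M : topologicalType}.
Variable G : oriented_riemannian R n M.
Variables (i : chart G) (u0 : 'rV[R]_n) (r a C D : R).
Hypotheses (r0 : 0 < r) (a0 : 0 < a) (C0 : 0 <= C) (D0 : 0 <= D).
Hypothesis boxP : forall u, `|u - u0| <= r ->
  [/\ img i u, forall v, a * `|v| ^+ 2 <= gram_form i u v &
      forall k k1 k2, `|christoffel i u k k1 k2| <= C].
Variable c : R -> M.
Hypothesis cg : geodesic G c.
Hypothesis cD : forall t, 0 < t < 1 -> speed G c t <= D.

Let L := D / Num.sqrt a.
Let A := n%:R ^+ 2 * C * L ^+ 2.

Let L0 : 0 <= L.
Proof. by rewrite /L divr_ge0// sqrtr_ge0. Qed.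

Definition inbox t := dom i (c t) /\ `|phi i (c t) - u0| <= r.

Lemma velocity_le t : 0 < t < 1 -> inbox t -> `|velocity c i t| <= L.
Proof.
move=> t01 [it tr]; have [iu av _] := boxP tr.
rewrite /L ler_pdivlMr ?sqrtr_gt0//.
have := cD t01; rewrite (geodesic_speedE cg t01 it); apply: le_trans.
have -> : `|velocity c i t| * Num.sqrt a = Num.sqrt (a * `|velocity c i t| ^+ 2).
  by rewrite sqrtrM ?(ltW a0)// sqrtr_sqr normr_id mulrC.
by rewrite ler_wsqrtr.
Qed.

Lemma segment_in (s t x : R) : 0 <= s <= 1 -> 0 <= t <= 1 ->
  Num.min s t <= x <= Num.max s t -> 0 <= x <= 1.
Proof.
move=> /andP[? ?] /andP[? ?]; have [st|st] := leP s t => xst.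
  by move: xst => /andP[? ?]; apply/andP; split; lra.
by move: xst => /andP[? ?]; apply/andP; split; lra.
Qed.

Lemma segment_in_oo (s t x : R) : 0 <= s <= 1 -> 0 <= t <= 1 ->
  Num.min s t < x < Num.max s t -> 0 < x < 1.
Proof.
move=> /andP[? ?] /andP[? ?]; have [st|st] := leP s t => xst.
  by move: xst => /andP[? ?]; apply/andP; split; lra.
by move: xst => /andP[? ?]; apply/andP; split; lra.
Qed.

Lemma coord_within_continuous (s t : R) k : 0 <= s <= 1 -> 0 <= t <= 1 ->
  (forall x, Num.min s t <= x <= Num.max s t -> dom i (c x)) ->
  {within `[Num.min s t, Num.max s t], continuous (coord c i k)}.
Proof.
move=> s01 t01 ci; apply/subspace_continuousP => x; rewrite /= in_itv/= => xst.
have x01 := segment_in s01 t01 xst; have [/subspace_continuousP cc _] := cg.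
have cx : c @ within `[Num.min s t, Num.max s t] (nbhs x) --> c x.
  move=> B nB; have xI : `[0, 1]%classic x by rewrite /= in_itv.
  have H : nbhs x [set y | `[0, 1]%classic y -> B (c y)] := cc x xI B nB.
  suff : nbhs x [set y | `[Num.min s t, Num.max s t]%classic y -> B (c y)] by [].
  apply: filterS H => y Py; rewrite /= in_itv/= => /(segment_in s01 t01) y01.
  by apply: Py; rewrite /= in_itv.
have px := cvg_comp _ _ cx (phi_continuous (ci x xst)).
exact: (cvg_comp _ _ px (@coord_continuous _ _ _ 0 k _)).
Qed.

Lemma coord_derivable t k : 0 < t < 1 -> dom i (c t) ->
  derivable (coord c i k) t 1.
Proof.
by move=> t01 it; have [_ /(_ t t01)/(_ i k it)[]] := cg.
Qed.

Lemma coord_lipschitz s t : 0 <= s <= 1 -> 0 <= t <= 1 ->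
  (forall x, Num.min s t <= x <= Num.max s t -> inbox x) ->
  `|phi i (c t) - phi i (c s)| <= L * `|t - s|.
Proof.
move=> s01 t01 st; apply: norm_le_coord => [|k].
  by rewrite mulr_ge0.
have := @MVT_between _ (coord c i k) s t 0 L.
rewrite mul0r subr0 !mxE; apply.
  move=> x xst; have x01 := segment_in_oo s01 t01 xst.
  have xin : inbox x by apply: st; case/andP: xst => ? ?; rewrite !ltW.
  split; first by apply: coord_derivable => //; have [] := xin.
  rewrite subr0 (le_trans _ (velocity_le x01 xin))//.
  by have := coord_le_norm (velocity c i x) 0 k; rewrite mxE.
by apply: coord_within_continuous => // x /st[].
Qed.

(** A first exit argument. Moving from [t0] towards [s1], let [h] be the infimum of the parameters
    at which the curve is outside of the open box [W]. Before [h] the Lipschitz bound confines the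
    coordinates to a ball of radius [rho < r]; by continuity this persists at [h], although the
    openness of [W] puts the point at [h] outside. *)
Lemma geodesic_stay t0 s1 : 0 <= t0 <= 1 -> 0 <= s1 <= 1 -> dom i (c t0) ->
  `|phi i (c t0) - u0| <= r / 2 -> L * `|s1 - t0| < r / 2 -> inbox s1.
Proof.
move=> t01 s01 it0 t0r Ls.
set W := [set x | dom i x /\ `|phi i x - u0| < r].
suff : W (c s1) by move=> [? ?]; split => //; exact: ltW.
have nW x : W x -> nbhs x W.
  move=> [ix xr]; near=> y; split.
    by near: y; apply: open_nbhs_nbhs; split => //; exact: dom_open.
  near: y; have := phi_continuous ix.
  have /open_nbhs_nbhs : open_nbhs (phi i x) [set u | `|u - u0| < r].
    split=> //.
    have -> : [set u : 'rV[R]_n | `|u - u0| < r] = ball u0 r.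
      by apply/seteqP; split=> u; rewrite -ball_normE/= distrC.
    exact: ball_open.
  by move=> /[swap]; apply.
apply: contrapT => Ws1.
pose g th := t0 + th * (s1 - t0).
have g01 th : 0 <= th <= 1 -> 0 <= g th <= 1.
  move=> /andP[th0 th1]; rewrite /g; case/andP: t01 => ? ?; case/andP: s01 => ? ?.
  by apply/andP; split; nra.
set S := [set th : R | 0 <= th <= 1 /\ ~ W (c (g th))].
have S1 : S 1 by split; [rewrite ler01/=|rewrite /g mul1r addrC subrK].
have hS : has_inf S by split; [exists 1|exists 0 => x [/andP[]]].
set h := inf S.
have h0 : 0 <= h by apply: lb_le_inf; [exists 1|move=> x [/andP[]]].
have h1 : h <= 1 by apply: ge_inf S1; exact: hS.2.
have below th : 0 <= th < h -> W (c (g th)).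
  move=> /andP[th0 th1]; apply: contrapT => nWth.
  have : S th by split=> //; rewrite th0 (le_trans (ltW th1)).
  by move=> /(ge_inf hS.2); rewrite leNgt th1.
have [cc _] := cg; have h01 : 0 <= h <= 1 by rewrite h0.
set q := `|s1 - t0| + 1.
have q0 : 0 < q by rewrite ltr_wpDl.
have gq th th' : `|g th - g th'| <= `|th - th'| * q.
  rewrite /g opprD addrACA subrr add0r -mulrBl normrM ler_wpM2l//.
  by rewrite /q lerDl.
have nWh : ~ W (c (g h)).
  move=> /nW/(within01_nbhs cc (g01 h h01))[d d0 dW].
  have dq : 0 < d / q by rewrite divr_gt0.
  have [th [th01 nWth] thh] := inf_adherent dq hS.
  have hth : h <= th by apply: ge_inf; [exact: hS.2|split].
  apply: nWth; apply: dW; first exact: g01.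
  rewrite (le_lt_trans (gq _ _))// ger0_norm ?subr_ge0// -ltr_pdivlMr//.
  by rewrite ltrBlDl.
have {}h0 : 0 < h.
  rewrite lt_neqAle h0 andbT eq_sym; apply/eqP => h_eq0; apply: nWh.
  rewrite h_eq0 /g mul0r addr0; split=> //.
  by rewrite (le_lt_trans t0r)// ltr_pdivrMr// ltr_pMr// ltr1n.
set rho := r / 2 + L * `|s1 - t0|.
have rhor : rho < r by rewrite /rho [ltRHS](splitr r) ltrD2l.
(* At [h] the curve is not yet known to lie in the domain of the chart, so the limit is taken in
   [M]: [K] is the image of a compact ball, hence closed since [M] is Hausdorff. *)
set K := psi i @` [set u | `|u - u0| <= rho].
have Kclosed : closed K.
  apply: compact_closed; first exact: manifold_hausdorff G.
  apply: continuous_compact; last exact: norm_ball_compact.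
  apply: continuous_in_subspaceT => u; rewrite inE/= => ur.
  apply: psi_continuous; have [|//] := @boxP u.
  by rewrite (le_trans ur)// ltW.
have inK th : 0 <= th < h -> K (c (g th)).
  move=> thh; have [ith _] := below th thh; exists (phi i (c (g th))); last first.
    by rewrite phiK.
  have th01 : 0 <= th <= 1.
    by case/andP: thh => -> thh /=; rewrite (le_trans (ltW thh)).
  rewrite /=; have -> : phi i (c (g th)) - u0 =
     (phi i (c (g th)) - phi i (c t0)) + (phi i (c t0) - u0) by rewrite addrA subrK.
  rewrite (le_trans (ler_normD _ _))// /rho addrC lerD//.
  rewrite (le_trans (coord_lipschitz t01 (g01 _ th01) _))//.
    (* Each time between [t0] and [g th] is [g y] for some [0 <= y <= th], thus precedes the exit.
       If [s1 = t0] the path is constant and [y = 0] works. *)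
    move=> x xg; have [y yh <-] : exists2 y, 0 <= y <= th & g y = x.
      case/andP: thh => th0 _; have [s1t|s1t] := eqVneq s1 t0.
        exists 0; first by rewrite lexx.
        move: xg; rewrite /g s1t subrr !mulr0 addr0 minxx maxxx => xt.
        by apply/eqP; rewrite eq_le.
      have s1t0 : s1 - t0 != 0 by rewrite subr_eq0.
      exists ((x - t0) / (s1 - t0)); last by rewrite /g divfK// addrC subrK.
      move: xg; rewrite /g; case: (ltrgt0P (s1 - t0)) s1t0 => // sp _.
        have ? : t0 <= t0 + th * (s1 - t0) by rewrite lerDl mulr_ge0// ltW.
        rewrite min_l// max_r// => /andP[x1 x2].
        apply/andP; split; first by rewrite divr_ge0 ?subr_ge0// -subr_ge0 ltW.
        by rewrite ler_pdivrMr// lerBlDl.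
      have ? : t0 + th * (s1 - t0) <= t0.
        by rewrite -[leRHS]addr0 lerD2l mulr_ge0_le0// ltW.
      rewrite min_r// max_l// => /andP[x1 x2].
      apply/andP; split; last by rewrite ler_ndivrMr// lerBrDl.
      by rewrite -mulrNN mulr_ge0// oppr_ge0 ?subr_le0// invr_le0 ltW.
    have /below[iy yr] : 0 <= y < h.
      by case/andP: yh => -> yth; case/andP: thh => _; apply: le_lt_trans.
    by split=> //; exact: ltW.
  rewrite ler_wpM2l// /g addrC addKr normrM ler_piMl//.
  by case/andP: th01 => ? ?; rewrite ger0_norm.
have [u ur uE] : K (c (g h)).
  apply: contrapT => nK.
  have /(within01_nbhs cc (g01 h h01))[d d0 dK] : nbhs (c (g h)) (~` K).
    by apply: open_nbhs_nbhs; split => //; exact: closed_openC.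
  have dq : 0 < d / q by rewrite divr_gt0.
  set th := Num.max 0 (h - d / q / 2).
  have thh : 0 <= th < h.
    rewrite /th le_max lexx/= gt_max h0/= gtrBl divr_gt0//.
  apply: (dK (g th)); [apply: g01| |exact: inK].
    by case/andP: thh => -> thh /=; rewrite (le_trans (ltW thh)).
  rewrite (le_lt_trans (gq _ _))// -ltr_pdivlMr// distrC ger0_norm ?subr_ge0; last first.
    by case/andP: thh => _ /ltW.
  have : h - d / q / 2 <= th by rewrite /th le_max lexx orbT.
  have : d / q / 2 < d / q by rewrite ltr_pdivrMr// ltr_pMr// ltr1n.
  lra.
apply: nWh; rewrite -uE; have [|iu _ _] := @boxP u; first by rewrite (le_trans ur)// ltW.
have [idu uu] := psiP iu; split=> //=; rewrite uu; exact: le_lt_trans ur rhor.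
Unshelve. all: by end_near. Qed.

Lemma geodesic_acc_le t k : 0 < t < 1 -> inbox t ->
  `|geodesic_acc i (phi i (c t)) (velocity c i t) k| <= A.
Proof.
move=> t01 tin; have [_ _ Cb] := boxP tin.2.
rewrite /geodesic_acc normrN (le_trans (ler_norm_sum _ _ _))//.
apply: (@le_trans _ _ (\sum_(j < n) \sum_(l < n) C * L ^+ 2)).
  apply: ler_sum => j _; rewrite (le_trans (ler_norm_sum _ _ _))//.
  apply: ler_sum => l _; have vL := velocity_le t01 tin.
  have cl j' := le_trans (coord_le_norm (velocity c i t) 0 j') vL.
  move: (cl j) (cl l) (Cb k j l).
  move: (christoffel i _ k j l) (velocity c i t 0 j) (velocity c i t 0 l) => x y z yL zL xC.
  by rewrite !normrM expr2 mulrA; apply: ler_pM => //; apply: ler_pM.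
rewrite !sumr_const !card_ord -mulrnA -[leLHS]mulr_natr natrM -expr2 /A.
by rewrite mulrC mulrA.
Qed.

Lemma velocity_taylor s t k b e : 0 < s < 1 -> 0 < t < 1 ->
  (forall x, Num.min s t <= x <= Num.max s t -> inbox x /\
    `|geodesic_acc i (phi i (c x)) (velocity c i x) k - b| <= e) ->
  `|derive1 (coord c i k) t - derive1 (coord c i k) s - b * (t - s)| <= e * `|t - s|.
Proof.
move=> s01 t01 st; apply: MVT_le_sym => x xst; have [xin xb] := st x xst.
have x01 : 0 < x < 1.
  move: xst s01 t01; have [ab|ab] := leP s t => /andP[? ?] /andP[? ?] /andP[? ?];
    by apply/andP; split; lra.
have [_ /(_ x x01)xg] := cg; have [_ /(_ k)[xd xE]] := geodesic_atE xg xin.1.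
by split=> //; rewrite derive1E xE.
Qed.

Lemma velocity_lipschitz s t k : 0 < s < 1 -> 0 < t < 1 ->
  (forall x, Num.min s t <= x <= Num.max s t -> inbox x) ->
  `|derive1 (coord c i k) t - derive1 (coord c i k) s| <= A * `|t - s|.
Proof.
move=> s01 t01 st; have := @velocity_taylor s t k 0 A s01 t01.
rewrite mul0r subr0; apply=> x xst; split; first exact: st.
have x01 : 0 < x < 1.
  move: xst s01 t01; have [ab|ab] := leP s t => /andP[? ?] /andP[? ?] /andP[? ?];
    by apply/andP; split; lra.
by rewrite subr0; apply: geodesic_acc_le => //; exact: st.
Qed.

(** The curve enters the error only through the constant [A]; this uniformity is what allows a
    passage to the limit. *)
Lemma coord_taylor s t k : 0 < s < 1 -> 0 < t < 1 ->
  (forall x, Num.min s t <= x <= Num.max s t -> inbox x) ->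
  `|coord c i k t - coord c i k s - derive1 (coord c i k) s * (t - s)|
    <= A * `|t - s| * `|t - s|.
Proof.
move=> s01 t01 st; apply: MVT_le_sym => x xst.
have x01 : 0 < x < 1.
  move: xst s01 t01; have [ab|ab] := leP s t => /andP[? ?] /andP[? ?] /andP[? ?];
    by apply/andP; split; lra.
split; first by apply: coord_derivable => //; have [] := st x xst.
have A0 : 0 <= A by rewrite /A !mulr_ge0 ?sqr_ge0.
apply: (@le_trans _ _ (A * `|x - s|)).
  apply: velocity_lipschitz => // y yxs; apply: st; move: xst yxs.
  have [ab|ab] := leP s t; have [xs|xs] := leP s x => /andP[? ?] /andP[? ?];
    by apply/andP; split; lra.
rewrite ler_wpM2l//; move: xst; have [ab|ab] := leP s t => /andP[? ?].
  by rewrite !ger0_norm ?subr_ge0//; lra.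
by rewrite !ler0_norm ?subr_le0//; lra.
Qed.

End geodesic_box.

Lemma near_le_lim (R : realType) T (F : set_system T) {FF : ProperFilter F}
    (h : T -> R) (l b : R) :
  h @ F --> l -> (\forall x \near F, h x <= b) -> l <= b.
Proof. by move=> hl hb; apply: (closed_cvg (fun y => y <= b) (@closed_le _ b) hb). Qed.

Lemma between_dist (R : realType) (s q t0 x d : R) : `|s - t0| < d -> `|q - t0| < d ->
  Num.min s q <= x <= Num.max s q -> `|x - t0| < d.
Proof.
rewrite !ltr_distl => /andP[? ?] /andP[? ?].
by have [ab|ab] := leP s q => /andP[? ?]; apply/andP; split; lra.
Qed.

Lemma between_dist_le (R : realType) (s q x : R) :
  Num.min s q <= x <= Num.max s q -> `|x - s| <= `|q - s|.
Proof.
have [ab|ab] := leP s q => /andP[? ?].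
  by rewrite !ger0_norm ?subr_ge0//; lra.
by rewrite !ler0_norm ?subr_le0//; lra.
Qed.

Lemma between_trans (R : realType) (s q x y : R) :
  Num.min s q <= x <= Num.max s q -> Num.min s x <= y <= Num.max s x ->
  Num.min s q <= y <= Num.max s q.
Proof.
by have [ab|ab] := leP s q; have [ab'|ab'] := leP s x
  => /andP[? ?] /andP[? ?]; apply/andP; split; lra.
Qed.

Lemma oo_cc (R : realType) (s : R) : 0 < s < 1 -> 0 <= s <= 1.
Proof. by move=> /andP[? ?]; rewrite !ltW. Qed.

Lemma between_oo (R : realType) (s q x : R) : 0 < s < 1 -> 0 < q < 1 ->
  Num.min s q <= x <= Num.max s q -> 0 < x < 1.
Proof.
move=> /andP[? ?] /andP[? ?].
by have [ab|ab] := leP s q => /andP[? ?]; apply/andP; split; lra.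
Qed.

Section geodesic_limit.
Context {R : realType} {n : nat} {M : topologicalType}.
Variable G : oriented_riemannian R n M.
Hypothesis M_connected : connected [set: M].
Variables (F : set_system (R -> M)) (c : R -> M).
Hypothesis FU : UltraFilter F.
Hypothesis F_minimizing : \forall g \near F, minimizing_geodesic G (g 0) (g 1) g.
Hypothesis F_cvg : forall s, 0 <= s <= 1 -> (fun g : R -> M => g s) @ F --> c s.

Let FF : ProperFilter F := ultra_proper.
#[local] Existing Instance FF.

(** The speed of each [g] is the distance between its end points, which converges along [F] by
    continuity of [dist]; the added 1 makes [D] an eventual bound. *)
Let D := dist G (c 0) (c 1) + 1.

Let D0 : 0 <= D.
Proof. by rewrite addr_ge0// dist_ge0. Qed.

Lemma box_exists (i : chart G) u0 : img i u0 -> exists r a C : R,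
  [/\ 0 < r, 0 < a & 0 <= C] /\ forall u, `|u - u0| <= r ->
  [/\ img i u, forall v, a * `|v| ^+ 2 <= gram_form i u v &
      forall k k1 k2, `|christoffel i u k k1 k2| <= C].
Proof.
move=> iu; have [a [b [r [[a0 _ r0] H]]]] := gram_form_bounds iu.
set C := 1 + \sum_(q : 'I_n * 'I_n * 'I_n) `|christoffel i u0 q.1.1 q.1.2 q.2|.
have : \forall u \near u0, forall q : 'I_n * 'I_n * 'I_n,
    `|christoffel i u0 q.1.1 q.1.2 q.2 - christoffel i u q.1.1 q.1.2 q.2| <= 1.
  apply: (@filter_forall _ _ (fun (q : 'I_n * 'I_n * 'I_n) u =>
    `|christoffel i u0 q.1.1 q.1.2 q.2 - christoffel i u q.1.1 q.1.2 q.2| <= 1) (nbhs u0) _) => q.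
  by have /cvgrPdist_le := @christoffel_continuous _ _ _ _ i u0 q.1.1 q.1.2 q.2 iu; apply.
move=> /nbhs_ballP[r' r'0 rP].
exists (Num.min r (r' / 2)), a, C; split.
  split=> //; first by rewrite lt_min r0 divr_gt0.
  by rewrite addr_ge0// sumr_ge0.
move=> u; rewrite le_min => /andP[ur ur'].
have [iu' Hv] := H u ur; split=> // [v|k k1 k2]; first by have /andP[] := Hv v.
have /rP/(_ (k, k1, k2))/= : ball u0 r' u.
  by rewrite -ball_normE/= distrC (le_lt_trans ur')// ltr_pdivrMr// ltr_pMr// ltr1n.
set x := christoffel i u0 k k1 k2; set y := christoffel i u k k1 k2 => xy.
have xC : `|x| <= \sum_(q : 'I_n * 'I_n * 'I_n) `|christoffel i u0 q.1.1 q.1.2 q.2|.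
  by rewrite (bigD1 (k, k1, k2))//= lerDl sumr_ge0.
have -> : y = x - (x - y) by ring.
by rewrite (le_trans (ler_normB _ _))// /C addrC lerD.
Qed.

Lemma near_speed_le : \forall g \near F, geodesic G g /\
  forall t, 0 < t < 1 -> speed G g t = dist G (g 0) (g 1) /\ speed G g t <= D.
Proof.
have dc : dist G (g 0) (g 1) @[g --> F] --> dist G (c 0) (c 1).
  have c01 : (g 0, g 1) @[g --> F] --> (c 0, c 1).
    by apply: cvg_pair; apply: F_cvg; rewrite ?lexx ?ler01.
  exact: (cvg_comp _ _ c01 (@dist_continuous _ _ _ G M_connected (c 0, c 1))).
have dD : \forall g \near F, dist G (g 0) (g 1) <= D.
  by apply: (cvgr_le _ dc); rewrite /D ltrDl.
near=> g; have [gg _ _ gl] : minimizing_geodesic G (g 0) (g 1) g by near: g.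
split=> // t t01; rewrite -(geodesic_arc_length gg t01) gl; split=> //.
by near: g.
Unshelve. all: by end_near. Qed.

Section local.
Variables (t0 : R) (i : chart G).
Hypotheses (t01 : 0 <= t0 <= 1) (it0 : dom i (c t0)).
Let u0 := phi i (c t0).

Lemma local_box : exists r a C d : R, [/\ 0 < r, 0 < a, 0 <= C & 0 < d] /\
  (forall u, `|u - u0| <= r -> [/\ img i u, forall v, a * `|v| ^+ 2 <= gram_form i u v &
      forall k k1 k2, `|christoffel i u k k1 k2| <= C]) /\
  \forall g \near F, [/\ geodesic G g,
    forall t, 0 < t < 1 -> speed G g t = dist G (g 0) (g 1) /\ speed G g t <= D &
    forall s, 0 <= s <= 1 -> `|s - t0| < d -> inbox i u0 r g s].
Proof.
have [r [a [C [[r0 a0 C0] B]]]] := box_exists (img_phi it0).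
set L := D / Num.sqrt a; have L0 : 0 <= L by rewrite divr_ge0 ?sqrtr_ge0.
(* With speed in coordinates at most [L], a time shorter than this keeps the displacement below
   [r / 2]; the starting points are eventually within [r / 2] of [u0]. *)
exists r, a, C, (r / 2 / (L + 1)); split.
  by split; rewrite ?divr_gt0// ltr_wpDl.
have gt0 : \forall g \near F, `|u0 - phi i (g t0)| <= r / 2.
  have := cvg_comp _ _ (F_cvg t01) (phi_continuous it0).
  by move=> /cvgrPdist_le; apply; rewrite divr_gt0.
split=> //; near=> g.
have [gg gs] : geodesic G g /\ forall t, 0 < t < 1 ->
    speed G g t = dist G (g 0) (g 1) /\ speed G g t <= D.
  by near: g; exact: near_speed_le.
split=> // s s01 st.
have gD t : 0 < t < 1 -> speed G g t <= D by move=> /gs[].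
have igt : dom i (g t0).
  near: g; apply: (F_cvg t01); apply: open_nbhs_nbhs; split => //; exact: dom_open.
apply: (geodesic_stay r0 a0 D0 B gg gD t01) => //.
  by rewrite distrC; near: g; exact: gt0.
move: st; rewrite ltr_pdivlMr ?ltr_wpDl// mulrC; apply: le_lt_trans.
by rewrite ler_wpM2r// lerDl.
Unshelve. all: by end_near. Qed.

Variables (r a C d : R).
Hypotheses (r0 : 0 < r) (a0 : 0 < a) (C0 : 0 <= C) (d0 : 0 < d).
Hypothesis boxP : forall u, `|u - u0| <= r ->
  [/\ img i u, forall v, a * `|v| ^+ 2 <= gram_form i u v &
      forall k k1 k2, `|christoffel i u k k1 k2| <= C].
Hypothesis near_box : \forall g \near F, [/\ geodesic G g,
    forall t, 0 < t < 1 -> speed G g t = dist G (g 0) (g 1) /\ speed G g t <= D &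
    forall s, 0 <= s <= 1 -> `|s - t0| < d -> inbox i u0 r g s].

Let L := D / Num.sqrt a.
Let A := n%:R ^+ 2 * C * L ^+ 2.

Let L0 : 0 <= L.
Proof. by rewrite divr_ge0 ?sqrtr_ge0. Qed.

Let A0 : 0 <= A.
Proof. by rewrite /A !mulr_ge0 ?sqr_ge0. Qed.

(** Membership of [c s] in the chart domain is part of the claim. The coordinates converge to some
    [w] in a compact ball inside the image of the chart, and uniqueness of limits in [M] identifies
    [c s] with [psi i w]. *)
Lemma limit_phi s : 0 <= s <= 1 -> `|s - t0| < d ->
  dom i (c s) /\ phi i (g s) @[g --> F] --> phi i (c s).
Proof.
move=> s01 st.
have [w wr gw] : exists2 w, [set w : 'rV[R]_n | `|w - u0| <= r] w &
    phi i (g s) @[g --> F] --> w.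
  apply: ultra_cvg_compact; first exact: norm_ball_compact.
  by apply: filterS near_box => g [_ _ /(_ s s01 st)[]].
have [iw _ _] := boxP wr.
have sc : (fun g : R -> M => g s) @ F --> psi i w.
  apply: cvg_trans (cvg_comp _ _ gw (psi_continuous iw)).
  apply: near_eq_cvg; apply: filterS near_box => g [_ _ /(_ s s01 st)[ig _]].
  by rewrite /= phiK.
have -> : c s = psi i w by apply: cvg_unique (F_cvg s01) sc; exact: manifold_hausdorff G.
by have [? ->] := psiP iw.
Qed.

Lemma limit_coord s k : 0 <= s <= 1 -> `|s - t0| < d ->
  coord g i k s @[g --> F] --> coord c i k s.
Proof.
move=> s01 st; have [_ sc] := limit_phi s01 st.
exact: (cvg_comp _ _ sc (@coord_continuous _ _ _ 0 k _)).
Qed.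

Lemma limit_lipschitz s : 0 <= s <= 1 -> `|s - t0| < d ->
  `|phi i (c s) - u0| <= L * `|s - t0|.
Proof.
move=> s01 st; have t0t0 : `|t0 - t0| < d by rewrite subrr normr0.
have [_ sc] := limit_phi s01 st; have [_ tc] := limit_phi t01 t0t0.
apply: (near_le_lim (cvg_norm (cvgB sc tc))).
apply: filterS near_box => g [gg gs gin].
apply: (coord_lipschitz a0 D0 boxP gg (fun t tt => (gs t tt).2) t01 s01) => x xst.
apply: gin; first exact: segment_in xst.
exact: between_dist xst.
Qed.

Lemma limit_continuous_at : c @ within `[0, 1] (nbhs t0) --> c t0.
Proof.
move=> B nB.
have : nbhs u0 (psi i @^-1` B).
  apply: (psi_continuous (img_phi it0)).
  by rewrite /u0 phiK.
move=> /nbhs_ballP[e e0 eB].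
suff : nbhs t0 [set y | `[0, 1]%classic y -> B (c y)] by [].
near=> s; rewrite /= in_itv/= => s01.
have st : `|s - t0| < d.
  by near: s; apply/nbhs_ballP; exists d => // y; rewrite -ball_normE/= distrC.
have [is_ _] := limit_phi s01 st; rewrite -(phiK is_); apply: eB.
rewrite -ball_normE/= distrC (le_lt_trans (limit_lipschitz s01 st))//.
have : `|s - t0| < e / (L + 1).
  near: s; apply/nbhs_ballP; exists (e / (L + 1)).
    by rewrite /= divr_gt0// ltr_wpDl.
  by move=> y; rewrite -ball_normE/= distrC.
rewrite ltr_pdivlMr ?ltr_wpDl// mulrC; apply: le_lt_trans.
by rewrite ler_wpM2r// lerDl.
Unshelve. all: by end_near. Qed.

(* The coordinate velocities are bounded, so they converge along the ultrafilter, and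
   Taylor estimates uniform in the geodesic identify the limit with the derivative. *)
Let V s k := lim (derive1 (coord g i k) s @[g --> F]).

Lemma limit_velocity s k : 0 < s < 1 -> `|s - t0| < d ->
  derive1 (coord g i k) s @[g --> F] --> V s k.
Proof.
move=> s01 st; have s01' := oo_cc s01.
have [p _ gp] : exists2 p, `[- L, L]%classic p &
    derive1 (coord g i k) s @[g --> F] --> p.
  apply: ultra_cvg_compact; first exact: segment_compact.
  apply: filterS near_box => g [gg gs gin].
  have := velocity_le a0 boxP gg (fun t tt => (gs t tt).2) s01 (gin s s01' st).
  move=> /(le_trans (coord_le_norm _ 0 k)); rewrite mxE.
  by rewrite /= in_itv/= ler_norml.
exact: cvgP gp.
Qed.

Lemma limit_derive s k : 0 < s < 1 -> `|s - t0| < d ->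
  is_derive s 1 (coord c i k) (V s k).
Proof.
move=> s01 st; apply: is_derive_le => e e0; near=> q.
have q01 : 0 < q < 1 by near: q; exact: near_oo.
have qt : `|q - t0| < d.
  rewrite ltr_distl; near: q; apply: near_oo; move: st; rewrite ltr_distl//.
have Aq : A * `|q - s| <= e.
  have : `|q - s| <= e / (A + 1).
    rewrite distrC; near: q.
    have /cvgrPdist_le : id @ s --> s by exact: cvg_id.
    by apply; rewrite divr_gt0// ltr_wpDl.
  rewrite ler_pdivlMr ?ltr_wpDl// mulrC; apply: le_trans.
  by rewrite ler_wpM2r// lerDl.
have s01' := oo_cc s01.
have q01' := oo_cc q01.
have cq := limit_coord (k:=k) q01' qt; have cs := limit_coord (k:=k) s01' st.
have vs := limit_velocity (k:=k) s01 st.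
apply: (near_le_lim (cvg_norm (cvgB (cvgB cq cs) (cvgM vs (cvg_cst (q - s)))))).
apply: filterS near_box => g [gg gs gin].
have := coord_taylor a0 C0 D0 boxP gg (fun t tt => (gs t tt).2) (s := s) (t := q) k s01 q01.
move=> /(_ _)/le_trans; apply.
  move=> x xst; apply: gin; last exact: between_dist xst.
  exact: segment_in xst.
by rewrite ler_wpM2r.
Unshelve. all: by end_near. Qed.

(** By continuity of [geodesic_acc] at the limit state, on a short common time interval the curves
    near [F] have acceleration within [e] of [b]. The mean value theorem turns this into a bound on
    increments of velocity, and such a bound passes to the limit. *)
Lemma limit_derive2 k : 0 < t0 < 1 ->
  is_derive t0 1 (derive1 (coord c i k)) (geodesic_acc i u0 (\row_l V t0 l) k).
Proof.
move=> t01'; set v0 := \row_l V t0 l; set b := geodesic_acc i u0 v0 k.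
have tt : `|t0 - t0| < d by rewrite subrr normr0.
have E : {near t0, V ^~ k =1 derive1 (coord c i k)}.
  near=> s; have [||sd sE] := @limit_derive s k.
  - by near: s; exact: near_oo.
  - by near: s; apply/nbhs_ballP; exists d => // y; rewrite -ball_normE/= distrC.
  by rewrite derive1E sE.
apply: near_eq_is_derive E _; apply: is_derive_le => e e0.
have : \forall z \near (u0, v0), `|b - geodesic_acc i z.1 z.2 k| <= e.
  have : geodesic_acc i z.1 z.2 k @[z --> (u0, v0)] --> b.
    apply: (@geodesic_acc_cvg _ _ _ _ _ (nbhs (u0, v0))).
    - exact: img_phi.
    - exact: cvg_fst.
    - exact: cvg_snd.
  by move=> /cvgrPdist_le; apply.
move=> /nbhs_ballP[h h0 hP].
have {}hP u v : `|u - u0| < h -> `|v - v0| < h -> `|geodesic_acc i u v k - b| <= e.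
  move=> uh vh; rewrite distrC; apply: (hP (u, v)).
  by split; rewrite -ball_normE/= distrC.
(* The budget for staying within [h] of the limit state: [h / 2] for convergence along [F] at time
   [t0], and [h / 4] for the motion from [t0] to [x]. *)
have h2 : 0 < h / 2 by rewrite divr_gt0.
have h4 : 0 < h / 4 by rewrite divr_gt0.
have qle (B : R) : 0 <= B -> \forall q \near t0, B * `|q - t0| <= h / 4.
  move=> B0; apply/nbhs_ballP; exists (h / 4 / (B + 1)).
    by rewrite /= divr_gt0// ltr_wpDl.
  move=> y; rewrite -ball_normE/= distrC ltr_pdivlMr ?ltr_wpDl// mulrC => /ltW.
  by apply: le_trans; rewrite ler_wpM2r// lerDl.
near=> q.
have q01 : 0 < q < 1 by near: q; exact: near_oo.
have qt : `|q - t0| < d.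
  by near: q; apply/nbhs_ballP; exists d => // y; rewrite -ball_normE/= distrC.
have Lq : L * `|q - t0| <= h / 4 by near: q; exact: qle.
have Aq : A * `|q - t0| <= h / 4 by near: q; exact: qle.
have vq := limit_velocity (k:=k) q01 qt; have vt := limit_velocity (k:=k) t01' tt.
apply: (near_le_lim (cvg_norm (cvgB (cvgB vq vt) (cvg_cst (b * (q - t0)))))).
have [_ pt] := limit_phi t01 tt.
have near_pt : \forall g \near F, `|u0 - phi i (g t0)| <= h / 2.
  by have /cvgrPdist_le := pt; apply.
have near_vt : \forall g \near F, forall l, `|V t0 l - derive1 (coord g i l) t0| <= h / 2.
  apply: filter_forall => l.
  by have /cvgrPdist_le := limit_velocity (k:=l) t01' tt; apply.
near=> g; have [gg gs gin] : [/\ geodesic G g,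
    forall t, 0 < t < 1 -> speed G g t = dist G (g 0) (g 1) /\ speed G g t <= D &
    forall s, 0 <= s <= 1 -> `|s - t0| < d -> inbox i u0 r g s] by near: g.
have gD := fun t tt => (gs t tt).2.
apply: (velocity_taylor gg) => // x xst.
have xin y : Num.min t0 x <= y <= Num.max t0 x -> inbox i u0 r g y.
  move=> yx; have yq : Num.min t0 q <= y <= Num.max t0 q.
    exact: between_trans xst yx.
  apply: gin; last exact: between_dist yq.
  exact: oo_cc (between_oo t01' q01 yq).
have x01 := between_oo t01' q01 xst.
have x01' := oo_cc x01.
have xq := between_dist_le xst.
have xI : inbox i u0 r g x.
  by apply: xin; rewrite ge_min le_max lexx !orbT.
split; [exact: xI|apply: hP].
  have := coord_lipschitz a0 D0 boxP gg gD t01 x01' xin.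
  have : L * `|x - t0| <= h / 4 by rewrite (le_trans _ Lq)// ler_wpM2l.
  have : `|phi i (g t0) - u0| <= h / 2 by rewrite distrC; near: g.
  have := ler_normD (phi i (g x) - phi i (g t0)) (phi i (g t0) - u0).
  by rewrite addrA subrK -/L; lra.
apply: (@le_lt_trans _ _ (3 / 4 * h)); last by lra.
apply: norm_le_coord => [|l]; first by lra.
have := velocity_lipschitz a0 boxP gg gD (s := t0) (t := x) l t01' x01 xin.
have : A * `|x - t0| <= h / 4 by rewrite (le_trans _ Aq)// ler_wpM2l.
have : `|derive1 (coord g i l) t0 - V t0 l| <= h / 2.
  by rewrite distrC; move: l; near: g.
have := ler_normD (derive1 (coord g i l) x - derive1 (coord g i l) t0)
  (derive1 (coord g i l) t0 - V t0 l).
by rewrite addrA subrK !mxE -/L -/A; lra.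
Unshelve. all: by end_near. Qed.

Lemma limit_geodesic_eq k : 0 < t0 < 1 ->
  [/\ derivable (coord c i k) t0 1, derivable (derive1 (coord c i k)) t0 1 &
      derive1 (derive1 (coord c i k)) t0 +
      \sum_(l < n) \sum_(b < n) christoffel i u0 k l b *
        derive1 (coord c i l) t0 * derive1 (coord c i b) t0 = 0].
Proof.
move=> t01'; have tt : `|t0 - t0| < d by rewrite subrr normr0.
have VE l : derive1 (coord c i l) t0 = V t0 l.
  by have [ld lE] := @limit_derive t0 l t01' tt; rewrite derive1E lE.
have [kd _] := @limit_derive t0 k t01' tt; have [k2 kE] := limit_derive2 k t01'.
split=> //; rewrite [derive1 (derive1 _) _]derive1E kE /geodesic_acc addrC.
apply/eqP; rewrite subr_eq0; apply/eqP.
by apply: eq_bigr => l _; apply: eq_bigr => b _; rewrite !mxE !VE.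
Qed.

Lemma limit_gram_form : 0 < t0 < 1 ->
  gram_form i (phi i (g t0)) (velocity g i t0) @[g --> F] -->
  gram_form i u0 (velocity c i t0).
Proof.
move=> t01'; have tt : `|t0 - t0| < d by rewrite subrr normr0.
apply: gram_form_cvg; first exact: img_phi.
  by have [] := limit_phi t01 tt.
apply/cvgrPdist_le => e e0; near=> g; apply: norm_le_coord => [|l]; first exact: ltW.
have [_ lE] := @limit_derive t0 l t01' tt.
rewrite !mxE [in X in X - _]derive1E lE; move: l {lE}; near: g; apply: filter_forall => l.
by have /cvgrPdist_le := @limit_velocity t0 l t01' tt; apply.
Unshelve. all: by end_near. Qed.

End local.

Lemma limit_geodesic : geodesic G c.
Proof.
split=> [|t t01].
  apply/subspace_continuousP => t; rewrite /= in_itv/= => t01.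
  have it := chart_atP G (c t).
  have [r [a [C [d [[r0 a0 C0 d0] [B nB]]]]]] := local_box t01 it.
  exact: (limit_continuous_at t01 it a0 d0 B nB).
move=> i k it; have t01' := oo_cc t01.
have [r [a [C [d [[r0 a0 C0 d0] [B nB]]]]]] := local_box t01' it.
exact: (limit_geodesic_eq t01' it a0 C0 d0 B nB).
Qed.

(** Length and distance agree along [F]. The length is the speed at time 1/2, which converges
    because position and velocity do, and the distance of the end points converges by continuity, so
    the two limits agree. *)
Lemma limit_minimizing : minimizing_geodesic G (c 0) (c 1) c.
Proof.
have cg := limit_geodesic; split=> //.
set t : R := 2^-1; have t01 : 0 < t < 1 by rewrite /t; apply/andP; split; lra.
have t01' := oo_cc t01.
have it := chart_atP G (c t); set i := chart_at G (c t) in it.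
have [r [a [C [d [[r0 a0 C0 d0] [B nB]]]]]] := local_box t01' it.
rewrite (geodesic_arc_length cg t01) (geodesic_speedE cg t01 it).
have l1 := limit_gram_form t01' it a0 C0 d0 B nB t01.
have l2 : Num.sqrt (gram_form i (phi i (g t)) (velocity g i t)) @[g --> F] -->
    Num.sqrt (gram_form i (phi i (c t)) (velocity c i t)).
  by apply: (continuous_cvg _ (@sqrt_continuous _ _)); exact: l1.
have dc : dist G (g 0) (g 1) @[g --> F] --> dist G (c 0) (c 1).
  have c01 : (g 0, g 1) @[g --> F] --> (c 0, c 1).
    by apply: cvg_pair; apply: F_cvg; rewrite ?lexx ?ler01.
  exact: (cvg_comp _ _ c01 (@dist_continuous _ _ _ G M_connected (c 0, c 1))).
refine (@cvg_unique R (@norm_hausdorff _ _) _ _ _ _ l2 _).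
apply: cvg_trans dc; apply: near_eq_cvg; apply: filterS nB => g [gg gs gin].
have [gE _] := gs t t01; rewrite -gE (geodesic_speedE gg t01 (i := i))//.
have tt : `|t - t| < d by rewrite subrr normr0.
by have [] := gin t t01' tt.
Qed.

End geodesic_limit.

(** * Measurability of the ball relation *)

(** The tube lemma, through the near-covering form of compactness. *)
Lemma closed_proj (X Y : topologicalType) (A : set (X * Y)) (C : set Y) :
  compact C -> closed A -> closed [set x | exists2 y, C y & A (x, y)].
Proof.
move=> /compact_near_coveringP Cc Ac; rewrite -[X in closed X]setCK.
apply: open_closedC; rewrite openE => x nAx; rewrite /interior.
have H y : C y -> \forall y' \near y & x' \near nbhs x, ~ A (x', y').
  move=> Cy; have : nbhs (x, y) (~` A).
    apply: open_nbhs_nbhs; split; first exact: closed_openC.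
    by move=> Axy; apply: nAx; exists y.
  move=> [[P Q] [/= xP yQ] PQ]; exists (Q, P) => //= -[y' x'] [/= Qy' Px'].
  by apply: (PQ (x', y')).
have K := Cc _ (nbhs x) (fun x' y' => ~ A (x', y')) _ H; apply: filterS (K _) => x' Cx' [y Cy].
exact: Cx'.
Qed.

Lemma fst_cvg (U V : topologicalType) (z : U * V) : fst @ z --> z.1.
Proof. exact: cvg_fst. Qed.

Lemma snd_cvg (U V : topologicalType) (z : U * V) : snd @ z --> z.2.
Proof. exact: cvg_snd. Qed.

Lemma pair_cvg (S U V : topologicalType) (f : S -> U) (g : S -> V)
    (x : S) (a : U) (b : V) :
  f @ x --> a -> g @ x --> b -> (f w, g w) @[w --> x] --> (a, b).
Proof.
move=> fa gb A [[P Q] [/= aP bQ] PQ].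
have fP : nbhs x (f @^-1` P) := fa P aP.
have gQ : nbhs x (g @^-1` Q) := gb Q bQ.
have H : nbhs x (f @^-1` P `&` g @^-1` Q) by exact: filterI.
suff : nbhs x [set w | A (f w, g w)] by [].
by apply: filterS H => w Pw; exact: (PQ (f w, g w)).
Qed.

(** Closures are required to fit inside neighbourhoods because the measurable conditions on balls
    available later concern closed sets. *)
Definition regular_base (M : topologicalType) (b : nat -> set M) :=
  (forall k, open (b k)) /\
  forall x A, nbhs x A -> exists2 k, b k x & closure (b k) `<=` A.

Lemma regular_base_exists (M : ptopologicalType) : hausdorff_space M ->
  compact [set: M] -> @second_countable M -> exists b : nat -> set M, regular_base b.
Proof.
move=> hM cM [B /countable_injP[f finj] [Bo Bb]].
(* An index that codes no member of the base receives [setT], which is still open. *)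
pose b k := xget setT [set U | B U /\ f U = k].
have bE U : B U -> b (f U) = U.
  move=> BU; rewrite /b; case: xgetP => [V _ [BV fV]|/(_ U)]; last by case.
  by apply: finj; rewrite ?inE.
exists b; split=> [k|x A nA].
  by rewrite /b; case: xgetP => [V _ [BV _]|_]; [exact: Bo|exact: openT].
have xT : nbhs x [set: M] by exact: filterT.
have [V nV VA] := compact_regular hM cM xT nA; have [U [BU Ux] UV] := Bb x V nV.
exists (f U); rewrite bE//.
exact: subset_trans (closureS UV) VA.
Qed.

Lemma eq_on_rat (R : realType) (T : topologicalType) (f g : R -> T) (t : R) :
  hausdorff_space T -> {within `[0, 1], continuous f} -> {within `[0, 1], continuous g} ->
  (forall q : rat, 0 <= (ratr q : R) <= 1 -> f (ratr q) = g (ratr q)) ->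
  0 <= t <= 1 -> f t = g t.
Proof.
move=> hT fc gc fg t01; apply: contrapT => fgt.
rewrite open_hausdorff in hT; have := hT _ _ (introN eqP fgt).
move=> [[A B] [/= /[!inE] At Bt] [oA oB AB0]].
have {AB0}AB : A `&` B `<=` set0 by rewrite AB0.
have [d d0 dA] := within01_nbhs fc t01 (open_nbhs_nbhs (conj oA At)).
have [e e0 eB] := within01_nbhs gc t01 (open_nbhs_nbhs (conj oB Bt)).
(* Cutting the interval at 0 and 1 keeps the rational inside the unit interval even when [t] is an
   end point. *)
have : Num.max 0 (t - Num.min d e) < Num.min 1 (t + Num.min d e).
  have de : 0 < Num.min d e by rewrite lt_min d0.
  case/andP: t01 => ? ?.
  rewrite gt_max !lt_min ltr01/=; apply/and3P; split; [lra| |]; lra.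
move=> /rat_in_itvoo[q]; rewrite in_itv/= => /andP[].
rewrite gt_max lt_min => /andP[q0 q1] /andP[q2 q3].
have q01 : 0 <= (ratr q : R) <= 1 by rewrite !ltW.
have : `|ratr q - t| < Num.min d e by rewrite ltr_distl q1 q3.
rewrite lt_min => /andP[qd qe].
apply: (AB (f (ratr q))); split; first exact: dA.
by rewrite (fg q q01); exact: eB.
Qed.

Section product_borel.
Context {M : ptopologicalType} (b : nat -> set M).
Hypothesis bb : regular_base b.

Lemma borel_measurable_open (A : set M) : open A -> measurable (A : set (borel M)).
Proof. by move=> oA; exact: sub_sigma_algebra. Qed.

(** Countability of the base makes an open set of the product a countable union of open rectangles,
    so the product of the Borel sigma-algebras contains it. *)
Lemma measurable_open_prod (A : set (M * M)) : open A ->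
  measurable (A : set (borel M * borel M)).
Proof.
move=> oA; have -> : A = \bigcup_k \bigcup_l
    [set z : M * M | [/\ b k `*` b l `<=` A, b k z.1 & b l z.2]].
  apply/seteqP; split=> [[x y] Axy|z [k _ [l _ [klA kz lz]]]]; last exact: klA.
  have := oA; rewrite openE => /(_ _ Axy)[[P Q] [/= xP yQ] PQ].
  have [k bkx kP] := bb.2 _ _ xP; have [l bly lQ] := bb.2 _ _ yQ.
  exists k => //; exists l => //; split=> // -[x' y'] [/= kx' ly'].
  by apply: PQ; split; [apply: kP|apply: lQ]; exact: subset_closure.
apply: bigcupT_measurable => k; apply: bigcupT_measurable => l.
have [klA|nklA] := pselect (b k `*` b l `<=` A); last first.
  rewrite (_ : [set _ | _] = set0); first exact: measurable0.
  by apply/seteqP; split=> // z [].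
rewrite (_ : [set _ | _] = b k `*` b l).
  by apply: measurableX; apply: borel_measurable_open; exact: bb.1.
by apply/seteqP; split=> z [].
Qed.

Lemma measurable_closed_prod (A : set (M * M)) : closed A ->
  measurable (A : set (borel M * borel M)).
Proof.
move=> cA; rewrite -[A]setCK; apply: measurableC.
by apply: measurable_open_prod; exact: closed_openC.
Qed.

End product_borel.

Section unique_geodesics.
Context {R : realType} {n : nat} {M : ptopologicalType}.
Variable G : oriented_riemannian R n M.
Hypothesis M_compact : compact [set: M].
Hypothesis M_connected : connected [set: M].

Definition geodesic_points (t : R) : set (M * M * M) :=
  [set z | exists2 c, minimizing_geodesic G z.1.1 z.1.2 c & c t = z.2].

(** A point of the closure yields a filter of minimizing geodesics whose positions at times 0, 1 and
    [t] tend to that point. Along a finer ultrafilter compactness makes the position converge at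
    every time, and the pointwise limit is again a minimizing geodesic. *)
Lemma geodesic_points_closed t : 0 <= t <= 1 -> closed (geodesic_points t).
Proof.
move=> t01 z0 z0cl.
pose S (V : set (M * M * M)) : set (R -> M) :=
  [set c | minimizing_geodesic G (c 0) (c 1) c /\ V (c 0, c 1, c t)].
have PF : ProperFilter (filter_from (nbhs z0) S).
  apply: filter_from_proper.
    apply: filter_from_filter; first by exists setT; exact: filterT.
    move=> V W nV nW; exists (V `&` W); first exact: filterI.
    by move=> c [cm [Vc Wc]].
  move=> V nV; have [[[x y] m] [[c cm cmt] Vz]] := z0cl V nV.
  exists c; rewrite /S/=; have [_ c0 c1 _] := cm; rewrite /= in c0 c1 cmt cm.
  by rewrite c0 c1 cmt.
have [F [FU sF]] := ultraFilterLemma PF.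
have FF : ProperFilter F := ultra_proper.
have /choice[c cP] : forall s : R, exists p : M, (fun g : R -> M => g s) @ F --> p.
  move=> s; have [|p _ gp] := @ultra_cvg_compact _ _ F (fun g => g s) setT FU M_compact.
    exact: filterT.
  by exists p.
have Fm : \forall g \near F, minimizing_geodesic G (g 0) (g 1) g.
  by apply: sF; exists setT; [exact: filterT|move=> g []].
have cm := limit_minimizing M_connected FU Fm (fun s _ => cP s).
have gz : (g 0, g 1, g t) @[g --> F] --> z0.
  by move=> V nV; apply: sF; exists V => // g [].
have hM := manifold_hausdorff G.
have gz1 := cvg_comp _ _ gz (@fst_cvg _ _ z0).
have e1 : c 0 = z0.1.1.
  by apply: cvg_unique (cP 0) _ => //; exact: (cvg_comp _ _ gz1 (@fst_cvg _ _ z0.1)).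
have e2 : c 1 = z0.1.2.
  by apply: cvg_unique (cP 1) _ => //; exact: (cvg_comp _ _ gz1 (@snd_cvg _ _ z0.1)).
have e3 : c t = z0.2.
  by apply: cvg_unique (cP t) _ => //; exact: (cvg_comp _ _ gz (@snd_cvg _ _ z0)).
by exists c => //; rewrite -e1 -e2.
Qed.

Definition through (t : R) (C : set M) : set (M * M) :=
  [set z | exists2 m, C m & geodesic_points t (z, m)].

Lemma through_closed t C : 0 <= t <= 1 -> closed C -> closed (through t C).
Proof.
move=> t01 cC; apply: closed_proj; last exact: geodesic_points_closed.
exact: subclosed_compact cC M_compact _.
Qed.

(* Geodesics are continuous, so comparing them at rational times is enough. *)
Lemma uniquely_joinedP z : uniquely_joined G z.1 z.2 <->
  through 0 setT z /\ forall (q : rat), 0 <= (ratr q : R) <= 1 ->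
  forall m m', geodesic_points (ratr q) (z, m) -> geodesic_points (ratr q) (z, m') -> m = m'.
Proof.
split=> [[c [cm cu]]|[[m0 _ [c cm _]] H]].
  split; first by exists (c 0) => //; exists c.
  move=> q q01 m m' [c1 c1m e1] [c2 c2m e2].
  have qI : (ratr q : R) \in `[0, 1] by rewrite in_itv.
  exact: etrans (etrans (esym e1) (etrans (cu c1 c1m _ qI) (esym (cu c2 c2m _ qI)))) e2.
rewrite /= in cm; exists c; split=> // c' c'm t; rewrite in_itv/= => t01.
have [[cc _] _ _ _] := cm; have [[c'c _] _ _ _] := c'm.
apply: (eq_on_rat (manifold_hausdorff G) c'c cc _ t01) => q q01.
have c'q : geodesic_points (ratr q) (z, c' (ratr q)) := ex_intro2 _ _ c' c'm erefl.
have cq : geodesic_points (ratr q) (z, c (ratr q)) := ex_intro2 _ _ c cm erefl.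
exact: (H q q01 _ _ c'q cq).
Qed.

Variable b : nat -> set M.
Hypothesis bb : regular_base b.

(** Two distinct positions at a rational time have disjoint closed neighbourhoods taken from the
    base. Failure of uniqueness is thus a countable union of intersections of two closed
    conditions. *)
Lemma measurable_uniquely_joined :
  measurable ([set z | uniquely_joined G z.1 z.2] : set (borel M * borel M)).
Proof.
have hM := manifold_hausdorff G; rewrite open_hausdorff in hM.
pose T (q : rat) := \bigcup_k \bigcup_l [set z : M * M |
  [/\ 0 <= (ratr q : R) <= 1, closure (b k) `&` closure (b l) = set0,
   through (ratr q) (closure (b k)) z & through (ratr q) (closure (b l)) z]].
have -> : [set z | uniquely_joined G z.1 z.2] = through 0 setT `&` \bigcap_q ~` T q.
  apply/seteqP; split=> z; rewrite /= uniquely_joinedP => -[z0 H]; split=> //.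
    move=> q _ [k _ [l _ [q01 kl [m km mz] [m' lm' m'z]]]].
    have : (closure (b k) `&` closure (b l)) m.
      by split=> //; rewrite (H q q01 m m').
    by rewrite kl.
  move=> q q01 m m' mz m'z; apply: contrapT => mm'.
  have := hM _ _ (introN eqP mm').
  move=> [[A B] [/= /[!inE] Am Bm'] [oA oB AB0]].
  have {AB0}AB : A `&` B `<=` set0 by rewrite AB0.
  have [k km kA] := bb.2 _ _ (open_nbhs_nbhs (conj oA Am)).
  have [l lm' lB] := bb.2 _ _ (open_nbhs_nbhs (conj oB Bm')).
  apply: (H q I); exists k => //; exists l => //; split=> //.
  - by rewrite -subset0 => x [/kA ? /lB ?]; apply: (AB x).
  - by exists m => //; exact: subset_closure.
  - by exists m' => //; exact: subset_closure.
apply: measurableI.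
  apply: (measurable_closed_prod bb); apply: through_closed; first by rewrite lexx ler01.
  exact: closedT.
rewrite -setC_bigcup; apply: measurableC; apply: bigcupT_measurable_rat => q.
apply: bigcupT_measurable => k.
apply: bigcupT_measurable => l.
have [[q01 kl]|nkl] := pselect (0 <= (ratr q : R) <= 1 /\
    closure (b k) `&` closure (b l) = set0); last first.
  rewrite (_ : [set _ | _] = set0); first exact: measurable0.
  by apply/seteqP; split=> // z [? ? _ _]; apply: nkl.
rewrite (_ : [set _ | _] = through (ratr q) (closure (b k)) `&` through (ratr q) (closure (b l))).
  by apply: measurableI; apply: (measurable_closed_prod bb);
    apply: through_closed => //; exact: closed_closure.
by apply/seteqP; split=> [z []//|z []].
Qed.

Let D (z : M * M) (p : M) := geodesic_ball G z.1 z.2 p.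

(* [geodesic_ball] without the uniqueness requirement, which makes it closed. *)
Definition ball_relation : set (M * M * M) :=
  [set w | exists2 m, [set: M] m & geodesic_points 2^-1 (w.1, m) /\
     dist G w.2 m <= dist G w.1.1 w.1.2 / 2].

Lemma geodesic_ballE z p :
  D z p <-> uniquely_joined G z.1 z.2 /\ ball_relation (z, p).
Proof.
have h01 : (2^-1 : R) \in `[0, 1] by rewrite in_itv/=; apply/andP; split; lra.
split=> [[m [c [cm cu] mE] pm]|[[c [cm cu]] [m _ [[c' c'm c'E] pm]]]].
  by split; [exists c|exists m => //; split=> //; exists c].
exists m => //; exists c => //.
by move: c'E => /= <-; exact: cu.
Qed.

(** The conditions on the four points, the midpoint included, are closed; the midpoint is then
    projected out over the compact [M]. *)
Lemma ball_relation_closed : closed ball_relation.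
Proof.
have dc := @dist_continuous _ _ _ G M_connected.
have h01 : 0 <= (2^-1 : R) <= 1 by apply/andP; split; lra.
have cl1 : closed [set v : M * M * M * M | geodesic_points 2^-1 (v.1.1, v.2)].
  apply: (@preimage_closed _ _ (fun v : M * M * M * M => (v.1.1, v.2)) (geodesic_points 2^-1)).
    move=> v _; suff : (w.1.1, w.2) @[w --> v] --> (v.1.1, v.2) by [].
    apply: pair_cvg; last exact: (@snd_cvg _ _ v).
    exact: (cvg_comp _ _ (@fst_cvg _ _ v) (@fst_cvg _ _ v.1)).
  exact: geodesic_points_closed.
have cl2 : closed [set v : M * M * M * M |
    dist G v.1.2 v.2 - dist G v.1.1.1 v.1.1.2 / 2 <= 0].
  apply: (@preimage_closed _ _ (fun v : M * M * M * M =>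
    dist G v.1.2 v.2 - dist G v.1.1.1 v.1.1.2 / 2) [set x : R | x <= 0]); last exact: closed_le.
  move=> v _; apply: (@cvgB _ _ _ (nbhs v)).
    have : (w.1.2, w.2) @[w --> v] --> (v.1.2, v.2).
      by apply: pair_cvg; [exact: (cvg_comp _ _ (@fst_cvg _ _ v) (@snd_cvg _ _ v.1))|exact: (@snd_cvg _ _ v)].
    by move=> H; exact: (cvg_comp _ _ H (dc _)).
  apply: (@cvgMl _ _ (nbhs v)).
  have : w.1.1 @[w --> v] --> v.1.1.
    exact: (cvg_comp _ _ (@fst_cvg _ _ v) (@fst_cvg _ _ v.1)).
  by move=> H; exact: (cvg_comp _ _ H (dc _)).
have := closed_proj M_compact (closedI cl1 cl2); congr closed.
apply/seteqP; split=> w [m _].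
  by move=> [/= wm]; rewrite subr_le0 => wd; exists m.
by move=> [wm wd]; exists m => //; split=> //=; rewrite subr_le0.
Qed.

Lemma measurable_ball_meets (C : set M) : closed C ->
  measurable ([set z | exists2 q, C q & D z q] : set (borel M * borel M)).
Proof.
move=> cC.
rewrite (_ : [set _ | _] = [set z | uniquely_joined G z.1 z.2] `&`
    [set z | exists2 q, C q & ball_relation (z, q)]).
  apply: measurableI; first exact: measurable_uniquely_joined.
  apply: (measurable_closed_prod bb); apply: closed_proj; last exact: ball_relation_closed.
  exact: subclosed_compact cC M_compact _.
apply/seteqP; split=> z.
  by move=> [q Cq /geodesic_ballE[zu zq]]; split=> //; exists q.
by move=> [zu [q Cq zq]]; exists q => //; apply/geodesic_ballE.
Qed.

Lemma closed_geodesic_ball z : closed [set p | D z p].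
Proof.
have [zu|nzu] := pselect (uniquely_joined G z.1 z.2); last first.
  rewrite (_ : [set _ | _] = set0); first exact: closed0.
  by apply/seteqP; split=> // p /geodesic_ballE[].
rewrite (_ : [set _ | _] = (fun p => (z, p)) @^-1` ball_relation).
  apply: preimage_closed; last exact: ball_relation_closed.
  move=> p _; suff : (z, w) @[w --> p] --> (z, p) by [].
  by apply: pair_cvg; [exact: cvg_cst|exact: cvg_id].
apply/seteqP; split=> p; first by move=> /geodesic_ballE[].
by move=> zp; apply/geodesic_ballE.
Qed.

(** Symmetry of the distance identifies the class in the VC hypothesis with the slices at fixed [p]
    of the ball relation. *)
Lemma depth_setE p : depth_set G p = [set z | D z p].
Proof.
apply/seteqP; split=> z [m zm]; rewrite /closed_ball_dist/= => pm; exists m => //.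
  by rewrite /closed_ball_dist/= distC.
by rewrite /closed_ball_dist/= distC.
Qed.

End unique_geodesics.

(** * Traces of VC classes and random signs *)

Section pajor.
Import mathcomp.boot.fintype mathcomp.boot.finset.
Local Close Scope classical_set_scope.
Local Open Scope set_scope.
Context {I : finType}.
Implicit Types (F : {set {set I}}) (S B : {set I}).

Definition shattered F S :=
  [forall B : {set I}, (B \subset S) ==> [exists A in F, A :&: S == B]].

Lemma shatteredP F S : reflect
  (forall B, B \subset S -> exists2 A, A \in F & A :&: S = B) (shattered F S).
Proof.
apply: (iffP forallP) => H B.
  move=> BS; have /implyP/(_ BS)/existsP[A /andP[FA /eqP AS]] := H B.
  by exists A.
apply/implyP => /H[A FA AS]; apply/existsP; exists A.
by rewrite FA AS eqxx.
Qed.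

(* Pajor's form of the Sauer-Shelah lemma. *)
Lemma card_shattered F : (#|F| <= #|[set S | shattered F S]|)%N.
Proof.
have [m] := ubnP #|F|; elim: m F => // m IH F; rewrite ltnS => Fm.
have [F1|F1] := leqP #|F| 1.
  have [->|/set0Pn[A FA]] := eqVneq F set0; first by rewrite cards0.
  rewrite (leq_trans F1)// card_gt0; apply/set0Pn; exists set0; rewrite inE.
  apply/shatteredP => B; rewrite subset0 => /eqP->.
  by exists A => //; rewrite setI0.
have [A [B [FA FB AB]]] := card_gt1P F1.
wlog [x xA xB] : A B FA FB AB / exists2 x, x \in A & x \notin B.
  move=> H; have : ~~ ((A \subset B) && (B \subset A)) by rewrite -eqEsubset.
  rewrite negb_and => /orP[] /subsetPn[x x1 x2]; first by apply: (H A B) => //; exists x.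
  by apply: (H B A) => //; [rewrite eq_sym|exists x].
(* Two members differ at [x], so both parts are nonempty and hence strictly smaller than [F]: the
   induction hypothesis applies to each. *)
set F1' := [set S in F | x \in S]; set F0 := [set S in F | x \notin S].
have FE : F = F0 :|: F1'.
  by apply/setP => S; rewrite !inE; case: (S \in F); case: (x \in S).
have F01 : F0 :&: F1' = set0.
  apply/setP => S; rewrite !inE.
  by case: (S \in F); case: (x \in S).
have cF : #|F| = (#|F0| + #|F1'|)%N by rewrite {1}FE cardsU F01 cards0 subn0.
have F0m : (#|F0| < m)%N.
  rewrite (leq_trans _ Fm)// cF -addn1 leq_add2l card_gt0.
  by apply/set0Pn; exists A; rewrite !inE FA.
have F1m : (#|F1'| < m)%N.
  rewrite (leq_trans _ Fm)// cF -add1n leq_add2r card_gt0.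
  by apply/set0Pn; exists B; rewrite !inE FB.
have sub0 S : shattered F0 S -> shattered F S /\ x \notin S.
  move=> /shatteredP H; split.
    apply/shatteredP => C /H[D]; rewrite inE => /andP[FD _] <-.
    by exists D.
  apply/negP => xS; have [D] := H S (subxx _); rewrite inE => /andP[_ xD] /setP/(_ x).
  by rewrite !inE (negbTE xD) xS.
have sub1 S : shattered F1' S -> shattered F S /\ x \notin S.
  move=> /shatteredP H; split.
    apply/shatteredP => C /H[D]; rewrite inE => /andP[FD _] <-.
    by exists D.
  apply/negP => xS; have [D] := H set0 (sub0set _); rewrite inE => /andP[_ xD] /setP/(_ x).
  by rewrite !inE xD xS.
set S0 := [set S | shattered F0 S]; set S1 := [set S | shattered F1' S].
(* A set shattered by both parts would be counted only once in the union; adding [x] to it gives a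
   second set shattered by [F], and a new one, since neither part shatters a set containing [x]. *)
set S2 := [set x |: S | S in S0 :&: S1].
have inj : {in S0 :&: S1 &, injective (fun S => x |: S)}.
  move=> S S'; rewrite !inE => /andP[/sub0[_ xS] _] /andP[/sub0[_ xS'] _] /setP E.
  apply/setP => y; have := E y; rewrite !inE; have [->|//] := eqVneq y x.
  by rewrite (negbTE xS) (negbTE xS').
have sub2 : (S0 :|: S1) :|: S2 \subset [set S | shattered F S].
  apply/subsetP => S; rewrite !inE => /orP[/orP[/sub0[]//|/sub1[]//]|].
  move=> /imsetP[S' ]; rewrite !inE => /andP[S'0 S'1] ->{S}.
  have [_ xS'] := sub0 _ S'0.
  apply/shatteredP => C Cx; have CS : C :\ x \subset S'.
    by rewrite subDset.
  have [xC|xC] := boolP (x \in C).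
    have /shatteredP/(_ _ CS)[D] := S'1; rewrite inE => /andP[FD xD] DS.
    exists D => //; rewrite setIUr DS; apply/setP => y; rewrite !inE.
    by have [->|_] := eqVneq y x; rewrite ?xD ?xC ?andbF//= andbF.
  have /shatteredP/(_ _ CS)[D] := S'0; rewrite inE => /andP[FD xD] DS.
  exists D => //; rewrite setIUr DS; apply/setP => y; rewrite !inE.
  by have [->|_] := eqVneq y x; rewrite ?(negbTE xD) ?(negbTE xC) ?andbF//= andbF.
rewrite cF (leq_trans _ (subset_leq_card sub2))// cardsU.
have -> : (S0 :|: S1) :&: S2 = set0.
  apply/setP => S; rewrite !inE; apply/negP => /andP[S01 /imsetP[S' _ SE]].
  have : x \in S by rewrite SE !inE eqxx.
  by case/orP: S01 => [/sub0[_ /negbTE->]|/sub1[_ /negbTE->]].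
rewrite cards0 subn0 card_in_imset// cardsU subnK.
  by rewrite leq_add// IH.
by rewrite (leq_trans (subset_leq_card (subsetIl _ _)))// leq_addr.
Qed.

(** A set with at most [d] elements is listed by a function from ['I_d] to [option I], with [None]
    as padding; this is the origin of the successor in the bound. *)
Lemma card_small_sets d : (#|[set S : {set I} | (#|S| <= d)%N]| <= #|I|.+1 ^ d)%N.
Proof.
pose g (f : {ffun 'I_d -> option I}) : {set I} := [set x | Some x \in codom f].
have sub : [set S : {set I} | (#|S| <= d)%N] \subset [set g f | f : {ffun 'I_d -> option I}].
  apply/subsetP => S; rewrite inE => Sd; apply/imsetP.
  exists [ffun i : 'I_d => nth None [seq Some x | x <- enum S] i] => //.
  apply/setP => x; rewrite inE; apply/idP/codomP => [xS|[i]].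
    have xs : (index x (enum S) < d)%N.
      by rewrite (leq_trans _ Sd)// cardE index_mem mem_enum.
    exists (Ordinal xs); rewrite ffunE /= (nth_map x) ?nth_index ?mem_enum//.
    by rewrite index_mem mem_enum.
  rewrite ffunE; have [iS|iS] := ltnP i #|S|; last first.
    by rewrite nth_default// size_map -cardE.
  rewrite cardE in iS; rewrite (nth_map x)// => -[->].
  by rewrite -mem_enum mem_nth.
rewrite (leq_trans (subset_leq_card sub))// (leq_trans (leq_imset_card _ _))//.
by rewrite card_ffun card_option card_ord.
Qed.

End pajor.

Section traces.
Context {Z M : Type} (D : Z -> M -> Prop).

Definition trace (I : finType) (z : I -> Z) (p : M) : {set I} := [set i | `[< D (z i) p >]]%SET.

Definition traces (I : finType) (z : I -> Z) : {set {set I}} :=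
  [set A | `[< exists p, trace z p = A >]]%SET.

(** By the preceding bound there are at most as many traces as shattered index sets. An index set
    shattered by the traces maps injectively to a set of points shattered by the class, so it has at
    most [d] elements. *)
Lemma card_traces d (I : finType) (z : I -> Z) :
  (forall C : set Z, finite_set C ->
    shatters (range (fun p => [set z | D z p])) C -> (C #<= `I_d)%card) ->
  (#|traces z| <= #|I|.+1 ^ d)%N.
Proof.
move=> VC; rewrite (leq_trans (card_shattered _))// (leq_trans _ (card_small_sets d))//.
apply: subset_leq_card; apply/fintype.subsetP => S; rewrite !inE => /shatteredP SS.
have {}SS (B : {set I}) : B \subset S -> exists p, forall i, i \in S -> `[< D (z i) p >] = (i \in B).
  move=> /SS[A]; rewrite inE => /asboolP[p <-] AB; exists p => i iS.
  by have /finset.setP/(_ i) := AB; rewrite !inE iS andbT.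
(* The family [z] may repeat values, but two indices of a shattered set carrying the same value
   could not be separated by the trace [{i}]. *)
have zinj i j : i \in S -> j \in S -> z i = z j -> i = j.
  move=> iS jS zij; have [|p pE] := SS [set i]%SET; first by rewrite finset.sub1set.
  have := pE _ jS; rewrite -zij (pE _ iS) !inE eqxx => /esym/eqP.
  by move=> ->.
pose C : set Z := z @` [set i | i \in S].
have : (C #<= `I_d)%card.
  apply: VC; first by apply: finite_image; exact: finite_finset.
  move=> B BC; have [|p pE] := SS [set i in S | `[< B (z i) >]]%SET.
    by apply/fintype.subsetP => i; rewrite inE => /andP[].
  exists [set z | D z p]; first by exists p.
  apply/seteqP; split=> x.
    move=> [Dx [i iS zx]]; subst x; have := pE i iS; rewrite inE iS/=.
    by move=> E; apply/asboolP; rewrite -E; apply/asboolP.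
  move=> Bx; split; last exact: BC.
  have [i iS zx] := BC _ Bx; subst x; have := pE i iS; rewrite inE iS/=.
  by move=> E; apply/asboolP; rewrite E; apply/asboolP.
move=> Cd; have [->|/set0Pn[i0 _]] := eqVneq S finset.set0; first by rewrite cards0.
pose g k := z (nth i0 (enum S) k).
have gC : g @` `I_#|S| `<=` C.
  move=> _ [k /= kS <-]; rewrite cardE in kS.
  by exists (nth i0 (enum S) k) => //=; rewrite -mem_enum mem_nth.
have ginj : {in `I_#|S| &, injective g}.
  move=> k l; rewrite !inE/= cardE => kS lS /zinj E.
  apply/eqP; rewrite -(nth_uniq i0 kS lS (enum_uniq _)); apply/eqP; apply: E;
    by rewrite -mem_enum mem_nth.
rewrite -card_le_II; apply: card_le_trans Cd.
apply: card_le_trans (subset_card_le gC).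
by have := inj_card_eq ginj; rewrite card_eq_sym => /card_eqPle[].
Qed.

End traces.

(** * Exponential tails for sums with random signs *)

Section rademacher.
Context {R : realType}.

(** From [expR y <= 1 / (1 - y)] the sum is at most [2 / (1 - x ^+ 2)], which is at most
    [2 * (1 + 2 * x ^+ 2)] for small [x]. The optimal constant 1/2 in the exponent is traded for
    this elementary proof. *)
Lemma cosh_le (x : R) : `|x| <= 2^-1 -> expR x + expR (- x) <= 2 * expR (2 * x ^+ 2).
Proof.
rewrite ler_norml => /andP[x1 x2].
have le_inv (y : R) : y < 1 -> expR y <= (1 - y)^-1.
  move=> y1; rewrite -[leRHS]mul1r ler_pdivlMr ?subr_gt0//.
  rewrite [leRHS](_ : 1 = expR y * expR (- y)); last by rewrite -expRD subrr expR0.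
  rewrite ler_wpM2l ?expR_ge0//.
  by have := expR_ge1Dx (- y).
have ex : expR x <= (1 - x)^-1 by apply: le_inv; lra.
have enx : expR (- x) <= (1 + x)^-1.
  by have := le_inv (- x); rewrite opprK; apply; lra.
apply: le_trans (lerD ex enx) _.
have x2' : x ^+ 2 <= 4^-1.
  have -> : (4^-1 : R) = (2^-1) ^+ 2 by field.
  by rewrite -real_normK ?num_real// lerXn2r ?nnegrE// ler_norml x1 x2.
have -> : (1 - x)^-1 + (1 + x)^-1 = 2 / (1 - x ^+ 2).
  by field; apply/and3P; split; apply/eqP; nra.
rewrite ler_wpM2l//; apply: (@le_trans _ _ (1 + 2 * x ^+ 2)); last exact: expR_ge1Dx.
rewrite -[leLHS]mul1r ler_pdivrMr; last by lra.
have := sqr_ge0 x; nra.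
Qed.

(** Chernoff's bound, with sign vectors counted instead of drawn: each counted vector contributes at
    least [expR (l * s)] to the sum of exponentials, and that sum factors over the coordinates. *)
Lemma rademacher_tail k (a : 'I_k -> R) (l s : R) : 0 <= l <= 2^-1 ->
  (forall i, `|a i| <= 1) ->
  (#|[set b : {ffun 'I_k -> bool} | s < \sum_i (-1) ^+ b i * a i]%SET|%:R : R) <=
  2 ^+ k * expR (2 * l ^+ 2 * k%:R - l * s).
Proof.
move=> /andP[l0 l1] a1.
rewrite expRD mulrA expRN -[leRHS]mulrC ler_pdivlMl ?expR_gt0//.
apply: (@le_trans _ _ (\sum_(b : {ffun 'I_k -> bool})
    \prod_i expR (l * ((-1) ^+ b i * a i)))).
  rewrite mulrC mulr_natl -sumr_const big_mkcond/=; apply: ler_sum => b _.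
  rewrite -expR_sum -mulr_sumr; case: ifP => [|_]; last exact: expR_ge0.
  by rewrite inE => bs; rewrite ler_expR ler_wpM2l// ltW.
rewrite -(bigA_distr_bigA (fun i (c : bool) => expR (l * ((-1) ^+ c * a i))))/=.
have -> : 2 ^+ k * expR (2 * l ^+ 2 * k%:R) = \prod_(i < k) (2 * expR (2 * l ^+ 2)).
  by rewrite prodr_const card_ord exprMn -expRM_natr.
apply: ler_prod => i _; rewrite big_bool/= expr1 expr0 mul1r mulN1r mulrN addrC.
rewrite addr_ge0 ?expR_ge0//=.
have la : `|l * a i| <= l by rewrite normrM (ger0_norm l0) ler_piMr.
apply: le_trans (cosh_le (le_trans la l1)) _.
rewrite ler_wpM2l// ler_expR ler_wpM2l//.
by rewrite -real_normK ?num_real// lerXn2r ?nnegrE.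
Qed.

Lemma rademacher_tail_abs k (a : 'I_k -> R) (l s : R) : 0 <= l <= 2^-1 ->
  (forall i, `|a i| <= 1) ->
  (#|[set b : {ffun 'I_k -> bool} | s < `|\sum_i (-1) ^+ b i * a i|]%SET|%:R : R) <=
  2 * (2 ^+ k * expR (2 * l ^+ 2 * k%:R - l * s)).
Proof.
move=> l01 a1.
have a1' i : `|- a i| <= 1 by rewrite normrN.
have H := lerD (rademacher_tail s l01 a1) (rademacher_tail s l01 a1').
rewrite [leRHS]mulr_natl mulr2n; apply: le_trans H.
rewrite -natrD ler_nat; apply: leq_trans (leq_card_setU _ _).1; apply: subset_leq_card.
apply/fintype.subsetP => b; rewrite !inE.
have -> : \sum_i (-1) ^+ b i * - a i = - \sum_i (-1) ^+ b i * a i.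
  by rewrite -sumrN; apply: eq_bigr => i _; rewrite mulrN.
by rewrite ltr_normr.
Qed.

End rademacher.

(** * Independent identically distributed families *)

Section sequence_space.
Context (I : eqType) d (M : measurableType d).

(* [I -> M] carries the product sigma-algebra: [seq_space] is generated by the
   finite-dimensional rectangles. *)
Definition cylinders : set (set (I -> M)) :=
  [set E | exists (s : seq I) (A : I -> set M), (forall i, measurable (A i)) /\
     E = [set y | forall i, i \in s -> A i (y i)]].

Definition seq_space := g_sigma_algebraType cylinders.

Lemma setI_closed_cylinders : setI_closed cylinders.
Proof.
move=> _ _ [s [A [mA ->]]] [s' [A' [mA' ->]]]; exists (s ++ s').
exists (fun i => (if i \in s then A i else setT) `&` (if i \in s' then A' i else setT)).
split=> [i|]; first by apply: measurableI; case: ifP.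
apply/seteqP; split=> y.
  by move=> [/= ys ys'] i _; split; case: ifP => // ?; [exact: ys|exact: ys'].
move=> /= ys; split=> i is_; have := ys i; rewrite mem_cat is_ ?orbT => -[]//.
Qed.

Lemma measurable_coord i (A : set M) : measurable A ->
  measurable ([set y | A (y i)] : set seq_space).
Proof.
move=> mA; apply: sub_sigma_algebra; exists [:: i], (fun _ => A); split=> //.
apply/seteqP; split=> y /=; first by move=> Ay j; rewrite inE => /eqP->.
by apply; rewrite inE.
Qed.

Lemma measurable_coord2 (i j : I) (A : set (M * M)) : measurable A ->
  measurable ([set y | A (y i, y j)] : set seq_space).
Proof.
move=> mA.
have mi k : measurable_fun [set: seq_space] (fun y : seq_space => y k).
  by move=> _ B mB; rewrite setTI; exact: measurable_coord.
have : measurable_fun [set: seq_space] (fun y : seq_space => (y i, y j)).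
  by apply: measurable_fun_pair; exact: mi.
by move=> /(_ measurableT A mA); rewrite setTI.
Qed.

End sequence_space.

Section laws.
Context {R : realType} d (M : measurableType d) (mu : probability M R).
Local Open Scope ereal_scope.

(** Independence and the common law in one formula. The index type is arbitrary so that reindexed
    and doubled samples are covered too. *)
Definition iid_law dT (T : measurableType dT) (P : probability T R) (I : eqType)
    (Y : T -> I -> M) :=
  (forall i, measurable_fun setT (Y ^~ i)) /\
  forall (s : seq I) (A : I -> set M), uniq s -> (forall i, measurable (A i)) ->
    P [set w | forall i, i \in s -> A i (Y w i)] = \prod_(i <- s) mu (A i).

Lemma measurable_seq dT (T : measurableType dT) (I : eqType) (Y : T -> I -> M) :
  (forall i, measurable_fun setT (Y ^~ i)) ->
  measurable_fun setT (Y : T -> seq_space I M).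
Proof.
move=> mY; apply: (@measurability _ _ T (seq_space I M) setT Y (@cylinders I d M) erefl).
move=> _ [_ [s [A [mA ->]] <-]]; rewrite setTI.
elim: s => [|i s IH].
  by rewrite (_ : _ @^-1` _ = setT)//; apply/seteqP; split.
rewrite (_ : _ @^-1` _ = (Y ^~ i) @^-1` A i `&`
    (Y @^-1` [set y | forall i0, i0 \in s -> A i0 (y i0)])).
  by apply: measurableI => //; have := mY i measurableT _ (mA i); rewrite setTI.
apply/seteqP; split=> w /=.
  move=> H; split; first by apply: H; rewrite mem_head.
  by move=> j js; apply: H; rewrite inE js orbT.
by move=> [Ai H] j; rewrite inE => /predU1P[->//|]; exact: H.
Qed.

(** Cylinders form a generating class closed under intersection, and [iid_law] prescribes their
    probabilities once repeated indices are removed. *)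
Lemma iid_law_unique dT (T : measurableType dT) (P : probability T R)
    dT' (T' : measurableType dT') (P' : probability T' R) (I : eqType)
    (Y : T -> I -> M) (Y' : T' -> I -> M) (E : set (seq_space I M)) :
  iid_law P Y -> iid_law P' Y' -> measurable E -> P (Y @^-1` E) = P' (Y' @^-1` E).
Proof.
move=> [mY YP] [mY' YP'] mE.
pose X : {mfun T >-> seq_space I M} := mfun_Sub (mem_set (measurable_seq mY)).
pose X' : {mfun T' >-> seq_space I M} := mfun_Sub (mem_set (measurable_seq mY')).
have := @g_sigma_algebra_measure_unique _ R (seq_space I M) (@cylinders I d M) _
  (fun=> setT) _ _ (distribution P X) (distribution P' X') _ _ _ E mE.
apply.
- exact: sub_sigma_algebra.
- by move=> _; exists [::], (fun=> setT); split=> //; apply/seteqP; split.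
- by rewrite bigcup_const.
- exact: setI_closed_cylinders.
- move=> _ [s [A [mA ->]]].
  have sE : [set y : I -> M | forall i, i \in s -> A i (y i)] =
      [set y | forall i, i \in undup s -> A i (y i)].
    by apply/seteqP; split=> y ys i; have := ys i; rewrite mem_undup.
  rewrite sE /distribution /pushforward.
  by have [e1 e2] := (YP _ _ (undup_uniq s) mA, YP' _ _ (undup_uniq s) mA);
    rewrite -e1 in e2; exact: esym e2.
- by move=> _; apply: le_lt_trans (probability_le1 _ _) _; rewrite ?ltry.
Qed.

Lemma iid_law_reindex dT (T : measurableType dT) (P : probability T R) (I J : eqType)
    (Y : T -> I -> M) (f : J -> I) : injective f -> iid_law P Y ->
  iid_law P (fun w j => Y w (f j)).
Proof.
move=> finj [mY YP]; split=> [j|s A us mA]; first exact: mY.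
(* The constraint transported along [f]; at an index that [f] does not reach from [s] it is vacuous,
   so [A' i] is the full set there. *)
pose A' i := [set x | forall j, j \in s -> f j = i -> A j x].
have A'E j : j \in s -> A' (f j) = A j.
  move=> js; apply/seteqP; split=> x; first exact.
  by move=> Ax k _ /finj->.
have mA' i : measurable (A' i).
  have [[j js <-]|nj] := pselect (exists2 j, j \in s & f j = i); first by rewrite A'E.
  rewrite (_ : A' i = setT)//; apply/seteqP; split=> // x _ j js fj.
  by exfalso; apply: nj; exists j.
have := YP (map f s) A' _ mA'; rewrite map_inj_uniq// big_map => /(_ us) H.
rewrite [RHS]big_seq; under eq_bigr => j js do rewrite -(A'E j js).
rewrite -big_seq -H; congr (P _); apply/seteqP; split=> w /= ws.
  by move=> i _ j js <-; exact: ws.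
by move=> j js; rewrite -A'E//; apply: ws; exact: map_f.
Qed.

Lemma iid_law_pair dT (T : measurableType dT) (P : probability T R)
    dT' (T' : measurableType dT') (P' : probability T' R) (I I' : eqType)
    (Y : T -> I -> M) (Y' : T' -> I' -> M) :
  iid_law P Y -> iid_law P' Y' ->
  iid_law (P \x P') (fun w (i : I + I') =>
    match i with inl i => Y w.1 i | inr i' => Y' w.2 i' end).
Proof.
move=> [mY YP] [mY' YP']; split=> [[i|i]|s A us mA].
- exact: measurableT_comp (mY i) measurable_fst.
- exact: measurableT_comp (mY' i) measurable_snd.
pose l (x : I + I') := if x is inl i then Some i else None.
pose r (x : I + I') := if x is inr i then Some i else None.
have us1 : uniq (pmap l s) by apply: (@pmap_uniq _ _ l inl) => // -[].
have us2 : uniq (pmap r s) by apply: (@pmap_uniq _ _ r inr) => // -[].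
have pE : \prod_(i <- s) mu (A i) =
    (\prod_(i <- pmap l s) mu (A (inl i))) * (\prod_(i <- pmap r s) mu (A (inr i))).
  elim: s {us us1 us2} => [|[i|i] s IH]; rewrite /= ?big_nil ?mule1// !big_cons IH.
    by rewrite muleA.
  by rewrite muleCA.
have m1 : measurable [set w | forall i, i \in pmap l s -> A (inl i) (Y w i)].
  have cyl : measurable ([set y | forall i, i \in pmap l s -> A (inl i) (y i)] :
      set (seq_space I M)).
    by apply: sub_sigma_algebra; exists (pmap l s), (A \o inl); split=> [i|]; [exact: mA|].
  by have := measurable_seq mY measurableT cyl; rewrite setTI.
have m2 : measurable [set w | forall i, i \in pmap r s -> A (inr i) (Y' w i)].
  have cyl : measurable ([set y | forall i, i \in pmap r s -> A (inr i) (y i)] :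
      set (seq_space I' M)).
    by apply: sub_sigma_algebra; exists (pmap r s), (A \o inr); split=> [i|]; [exact: mA|].
  by have := measurable_seq mY' measurableT cyl; rewrite setTI.
have e1 := YP _ (fun i => A (inl i)) us1 (fun i => mA _).
have e2 := YP' _ (fun i => A (inr i)) us2 (fun i => mA _).
rewrite pE -e1 -e2 -product_measure1E//.
congr ((P \x P') _); apply/seteqP; split=> -[w w'] /=.
  move=> ws; split=> i; rewrite mem_pmap => /mapP[[j|j] js] //= [->];
    exact: (ws _ js).
move=> [ws ws'] [i|i] is_.
  by apply: (ws i); rewrite mem_pmap; apply/mapP; exists (inl i).
by apply: (ws' i); rewrite mem_pmap; apply/mapP; exists (inr i).
Qed.

Lemma iid_law_id : iid_law mu (fun (x : M) (_ : unit) => x).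
Proof.
split=> [_|s A us mA]; first exact: measurable_id.
case: s us => [|[] [|[] s]] //= _.
  by rewrite big_nil (_ : [set _ | _] = setT) ?probability_setT//; apply/seteqP; split.
rewrite big_seq1; congr (mu _); apply/seteqP; split=> x /=; first by apply; rewrite inE.
by move=> Ax [] _.
Qed.

(** Combined with uniqueness of the law, this turns the probability that a pair of sample points
    lies in a set into its measure under [mu \x mu]. *)
Lemma iid_law_prod : iid_law (mu \x mu) (fun (z : M * M) (b : bool) => if b then z.2 else z.1).
Proof.
pose f (b : bool) : unit + unit := if b then inr tt else inl tt.
have finj : injective f by move=> [] [].
have := iid_law_reindex finj (iid_law_pair iid_law_id iid_law_id).
by congr iid_law; apply/funext => z; apply/funext => -[].
Qed.

End laws.

Section finite_quantifiers.
Context d (T : measurableType d).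

Lemma measurable_forall (I : choiceType) (s : set I) (A : I -> set T) : finite_set s ->
  (forall i, measurable (A i)) -> measurable [set y | forall i, s i -> A i y].
Proof.
move=> fs mA; rewrite (_ : [set _ | _] = \bigcap_(i in s) A i).
  exact: fin_bigcap_measurable.
by apply/seteqP; split=> y.
Qed.

Lemma measurable_exists (I : choiceType) (s : set I) (A : I -> set T) : finite_set s ->
  (forall i, measurable (A i)) -> measurable [set y | exists2 i, s i & A i y].
Proof.
move=> fs mA; rewrite (_ : [set _ | _] = \bigcup_(i in s) A i).
  exact: fin_bigcup_measurable.
by apply/seteqP; split=> y.
Qed.

End finite_quantifiers.

(** * Measurability of the traces *)

Section patterns.
Context {M : ptopologicalType} (b : nat -> set M).
Hypothesis bb : regular_base b.
Hypothesis M_compact : compact [set: M].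
Variable D : M * M -> M -> Prop.
Hypothesis D_meets : forall C, closed C ->
  measurable ([set z | exists2 q, C q & D z q] : set (borel M * borel M)).
Hypothesis D_closed : forall z, closed [set p | D z p].
Context (I : eqType) (J : finType) (e : J -> I * I).

Definition pairs_of (y : I -> M) (j : J) : M * M := (y (e j).1, y (e j).2).

Let meets k := [set z : M * M | exists2 q, closure (b k) q & D z q].

Let measurable_meets j k :
  measurable ([set y | meets k (pairs_of y j)] : set (seq_space I (borel M))).
Proof.
apply: (@measurable_coord2 _ _ (borel M) (e j).1 (e j).2 (meets k)).
by apply: D_meets; exact: closed_closure.
Qed.

Let avoids z p : ~ D z p -> exists2 k, b k p & ~ meets k z.
Proof.
move=> nD; have : nbhs p (~` [set q | D z q]).
  by apply: open_nbhs_nbhs; split; [exact: closed_openC|].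
move=> /bb.2[k kp kD]; exists k => // -[q kq Dq].
exact: kD kq Dq.
Qed.

(** By compactness, the balls indexed by [S] have no common point in [C] exactly when finitely many
    basic sets cover [C] and the closure of each misses one of these balls. There are countably many
    candidates for such a finite cover. *)
Let measurable_common (S : {set J}) (C : set M) : closed C ->
  measurable ([set y | exists p, C p /\ forall j, j \in S -> D (pairs_of y j) p] :
    set (seq_space I (borel M))).
Proof.
move=> cC; have Cc : compact C by exact: subclosed_compact cC M_compact _.
rewrite compact_cover in Cc.
rewrite -[X in measurable X]setCK; apply: measurableC.
rewrite (_ : ~` _ = \bigcup_(W : seq nat) [set y | C `<=` \bigcup_(k in [set` W]) b k /\
    forall k, [set` W] k -> exists2 j, [set` S] j & ~ meets k (pairs_of y j)]).
  apply: countable_bigcupT_measurable; first exact: countableP.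
  move=> W; have [CW|nCW] := pselect (C `<=` \bigcup_(k in [set` W]) b k); last first.
    rewrite (_ : [set _ | _] = set0); first exact: measurable0.
    by apply/seteqP; split=> // y [].
  rewrite (_ : [set _ | _] = [set y | forall k, [set` W] k ->
      exists2 j, [set` S] j & ~ meets k (pairs_of y j)]); last first.
    by apply/seteqP; split=> [y []//|y Wy]; split.
  apply: measurable_forall; first exact: finite_seq.
  move=> k; apply: measurable_exists; first exact: finite_finset.
  by move=> j; apply: measurableC; exact: measurable_meets.
apply/seteqP; split=> y /=.
  move=> nC.
  have Cavoid p : C p -> exists2 k, b k p & exists2 j, [set` S] j & ~ meets k (pairs_of y j).
    move=> Cp; apply: contrapT => H; apply: nC; exists p; split=> // j jS.
    apply: contrapT => /avoids[k kp km]; apply: H; exists k => //.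
    by exists j.
  pose K := [set k | exists2 j, [set` S] j & ~ meets k (pairs_of y j)].
  have [W WK CW] := Cc _ K b (fun k _ => bb.1 k) (fun p Cp => let: ex_intro2 k kp km := Cavoid p Cp in ex_intro2 _ _ k km kp).
  exists (finmap.enum_fset W) => //; split=> [p /CW[k kW kp]|k kW]; first by exists k.
  by have := WK k kW; rewrite inE.
move=> [W _ [CW WS]] [p [Cp pS]].
have [k kW kp] := CW p Cp; have [j jS] := WS k kW; apply.
by exists p; [exact: subset_closure|exact: pS].
Qed.

(* A pattern is realised iff basic open neighbourhoods can be chosen that witness its
   negative part: outside of [S], [p] then ranges over a closed set, which is what
   compactness requires for the positive part. *)
Lemma measurable_pattern (S : {set J}) :
  measurable ([set y | exists p, trace D (pairs_of y) p = S] : set (seq_space I (borel M))).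
Proof.
rewrite (_ : [set _ | _] = \bigcup_(h : {ffun J -> nat})
    ([set y | forall j, [set` ~: S] j -> ~ meets (h j) (pairs_of y j)] `&`
     [set y | exists p, (\bigcap_(j in [set` ~: S]) closure (b (h j))) p /\
        forall j, j \in S -> D (pairs_of y j) p])).
  apply: countable_bigcupT_measurable; first exact: countableP.
  move=> h; apply: measurableI.
    apply: measurable_forall; first exact: finite_finset.
    by move=> j; apply: measurableC; exact: measurable_meets.
  by apply: measurable_common; apply: closed_bigI => j _; exact: closed_closure.
apply/seteqP; split=> y /=.
  move=> [p pS].
  have /choice[h hP] : forall j : J, exists k : nat, j \notin S ->
      b k p /\ ~ meets k (pairs_of y j).
    move=> j; have [jS|jS] := boolP (j \in S); first by exists 0.
    have /avoids[k kp km] : ~ D (pairs_of y j) p.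
      by move=> Dp; move/negP: jS; apply; rewrite -pS inE; apply/asboolP.
    by exists k.
  exists [ffun j => h j] => //; split=> [j|]; rewrite /= ?inE.
    by move=> jS; rewrite ffunE; have [] := hP j jS.
  exists p; split=> [j /=|j]; rewrite ?inE.
    by move=> jS; rewrite ffunE; apply: subset_closure; have [] := hP j jS.
  by rewrite -pS inE => /asboolP.
move=> [h _ [hS [p [pS Dp]]]]; exists p; apply/finset.setP => j; rewrite inE.
apply/asboolP/idP => [Djp|/Dp//].
apply: contraT => jS; exfalso; apply: (hS j); first by rewrite /= inE.
by exists p => //; apply: pS; rewrite /= inE.
Qed.

Lemma measurable_traces (Q : {set J} -> Prop) :
  measurable ([set y | exists p, Q (trace D (pairs_of y) p)] : set (seq_space I (borel M))).
Proof.
rewrite (_ : [set _ | _] = [set y | exists2 S : {set J}, Q S &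
    exists p, trace D (pairs_of y) p = S]).
  by apply: measurable_exists; [exact: finite_finset|exact: measurable_pattern].
apply/seteqP; split=> y /=.
  by move=> [p Qp]; exists (trace D (pairs_of y) p) => //; exists p.
by move=> [S QS [p pS]]; exists p; rewrite pS.
Qed.

End patterns.

(** * Symmetrization *)

Section linear_combinations.
Context {R : realType} d (T : measurableType d) (P : probability T R).

Lemma fine_probabilityK (A : set T) : measurable A -> (fine (P A))%:E = P A.
Proof. by move=> mA; rewrite fineK// fin_num_measure. Qed.

(** A pointwise inequality between indicators is integrated. It yields both the averaging over
    exchanges and the second moment estimate. *)
Lemma lincomb_probability_le (I : finType) (a : I -> R) (A : I -> set T) (c : R) :
  (forall i, measurable (A i)) -> (forall w, \sum_i a i * \1_(A i) w <= c) ->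
  \sum_i a i * fine (P (A i)) <= c.
Proof.
move=> mA a_le; rewrite -lee_fin -sumEFin.
have iA i : P.-integrable setT (fun w => (a i)%:E * (\1_(A i) w)%:E)%E.
  by apply: integrableZl => //; exact: integrable_indic.
rewrite [leLHS](_ : _ = \int[P]_w (\sum_i (a i)%:E * (\1_(A i) w)%:E))%E; last first.
  rewrite integral_sum//; apply: eq_bigr => i _.
  rewrite integralZl//; last exact: integrable_indic.
  by rewrite integral_indic// setIT EFinM fine_probabilityK.
apply: (@le_trans _ _ (\int[P]_w c%:E)%E); last first.
  have -> : (\int[P]_w c%:E = c%:E)%E by rewrite integral_cst// [X in (_ * X)%E](probability_setT P) mule1.
  by [].
apply: le_integral => //.
- exact: integrable_sum.
- by apply: finite_measure_integrable_cst.
- move=> w _; under eq_bigr do rewrite -EFinM.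
  by rewrite sumEFin lee_fin.
Qed.

End linear_combinations.

Section rademacher_traces.
Context {R : realType} {Z M : Type} {D : Z -> M -> Prop} {d : nat}.
Hypothesis VC : forall C : set Z, finite_set C ->
  shatters (range (fun p => [set z | D z p])) C -> (C #<= `I_d)%card.
Variable k : nat.

(** The summand whose sign changes when the [i]-th pair and its copy are exchanged. *)
Definition imbalance (A : {set 'I_k * bool}) i : R :=
  ((i, false) \in A)%:R - ((i, true) \in A)%:R.

(** The imbalances depend on [p] only through its trace on the [2 k] pairs, so a union bound over
    the traces handles all [p] at once. *)
Lemma card_swaps (z : 'I_k * bool -> Z) (l s : R) : 0 <= l <= 2^-1 ->
  #|[set b : {ffun 'I_k -> bool} |
      `[< exists p, s < `|\sum_i (-1) ^+ b i * imbalance (trace D z p) i| >]]%SET|%:R <=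
  ((k * 2).+1 ^ d)%:R * (2 * (2 ^+ k * expR (2 * l ^+ 2 * k%:R - l * s))).
Proof.
move=> l01.
pose F (A : {set 'I_k * bool}) := [set b : {ffun 'I_k -> bool} |
  s < `|\sum_i (-1) ^+ b i * imbalance A i|]%SET.
set B := (X in #|X|%:R).
have BF : (#|B| <= \sum_(A in traces D z) #|F A|)%N.
  rewrite [leqLHS]cardE -sum1_size big_enum/=.
  under [leqRHS]eq_bigr do rewrite -sum1_card.
  rewrite (exchange_big_dep predT)//= [leqLHS]big_mkcond/=.
  apply: leq_sum => b _; case: ifPn => //; rewrite inE => /asboolP[p bp].
  rewrite (bigD1 (trace D z p))/= ?leq_addr// !inE bp andbT.
  by apply/asboolP; exists p.
have : (#|B|%:R : R) <= (\sum_(A in traces D z) #|F A|)%:R by rewrite ler_nat.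
move=> /le_trans; apply; rewrite natr_sum.
have := card_traces z VC; rewrite card_prod card_ord card_bool => tr.
apply: (@le_trans _ _ (#|traces D z|%:R * (2 * (2 ^+ k * expR (2 * l ^+ 2 * k%:R - l * s))))).
  rewrite mulr_natl -sumr_const; apply: ler_sum => A _.
  apply: rademacher_tail_abs => // i; rewrite /imbalance.
  by case: (_ \in A); case: (_ \in A); rewrite ?subrr ?subr0 ?sub0r ?normrN ?normr0 ?normr1.
by rewrite ler_wpM2r ?ler_nat// !mulr_ge0// ?exprn_ge0// expR_ge0.
Qed.

End rademacher_traces.

Section symmetrization.
Context {R : realType} {M : ptopologicalType} (b : nat -> set M).
Hypothesis bb : regular_base b.
Hypothesis M_compact : compact [set: M].
Variable D : M * M -> M -> Prop.
Hypothesis D_meets : forall C, closed C ->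
  measurable ([set z | exists2 q, C q & D z q] : set (borel M * borel M)).
Hypothesis D_closed : forall z, closed [set p | D z p].
Variable VCdim : nat.
Hypothesis VC : forall C : set (M * M), finite_set C ->
  shatters (range (fun p => [set z | D z p])) C -> (C #<= `I_VCdim)%card.
Variable mu : probability (borel M) R.
Context d (T : measurableType d) (P : probability T R).
Variable Y : T -> nat -> M.
Hypothesis Y_iid : iid_law mu P (Y : T -> nat -> borel M).
Variables (k : nat) (e : 'I_k * bool -> nat).
Hypothesis e_inj : injective e.

(* An index [((i, h), c)] stands for the endpoint [c] of the [i]-th pair, in the sample
   if [h] is false and in its independent copy if [h] is true. *)
Definition halves (j : 'I_k * bool) : ('I_k * bool * bool) * ('I_k * bool * bool) :=
  ((j, false), (j, true)).

Definition ghost (w : T * T) (j : 'I_k * bool * bool) : M :=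
  Y (if j.1.2 then w.2 else w.1) (e (j.1.1, j.2)).

Definition swap (f : {ffun 'I_k -> bool}) (j : 'I_k * bool * bool) :=
  ((j.1.1, j.1.2 (+) f j.1.1), j.2).

Definition unbalanced (s : R) : set (seq_space ('I_k * bool * bool)%type (borel M)) :=
  [set y | exists p, s < `|\sum_i imbalance (trace D (pairs_of halves y) p) i|].

Lemma swap_inj f : injective (swap f).
Proof.
move=> [[i h] c] [[i' h'] c'] [-> /= hE ->]; congr ((_, _), _).
by apply: addIb hE.
Qed.

Lemma ghost_iid : iid_law mu (P \x P)%E (ghost : T * T -> _ -> borel M).
Proof.
pose f (j : 'I_k * bool * bool) : nat + nat :=
  if j.1.2 then inr (e (j.1.1, j.2)) else inl (e (j.1.1, j.2)).
have finj : injective f.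
  by move=> [[i [] ] c] [[i' []] c'] //= [] /e_inj [-> ->].
have := iid_law_reindex finj (iid_law_pair Y_iid Y_iid).
by congr iid_law; apply/funext => -[w w']; apply/funext => -[[i []] c].
Qed.

Lemma measurable_unbalanced s : measurable (unbalanced s).
Proof.
exact: (measurable_traces bb M_compact D_meets D_closed halves
  (fun A => s < `|\sum_i imbalance A i|)).
Qed.

Lemma imbalance_swap f (y : 'I_k * bool * bool -> M) p i :
  imbalance (trace D (pairs_of halves (y \o swap f)) p) i =
  (-1) ^+ f i * imbalance (trace D (pairs_of halves y) p) i :> R.
Proof.
rewrite /imbalance !inE /swap /pairs_of /=.
by case: (f i); rewrite /= ?mul1r// expr1 mulN1r opprB.
Qed.

(** Each of the [2 ^ k] exchanges preserves the law of the doubled sample, so [2 ^ k] times the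
    probability is the sum over exchanges. For a fixed doubled sample, [card_swaps] bounds how many
    exchanges are bad. *)
Lemma unbalanced_tail (l s : R) : 0 <= l <= 2^-1 ->
  fine ((P \x P)%E (ghost @^-1` unbalanced s)) <=
  ((k * 2).+1 ^ VCdim)%:R * (2 * expR (2 * l ^+ 2 * k%:R - l * s)).
Proof.
move=> l01.
have swap_law (f : {ffun 'I_k -> bool}) : (P \x P)%E (ghost @^-1` unbalanced s) =
    (P \x P)%E ((fun w => ghost w \o swap f) @^-1` unbalanced s).
  apply: (iid_law_unique ghost_iid); last exact: measurable_unbalanced.
  exact: (iid_law_reindex (@swap_inj f) ghost_iid).
have H : \sum_(f : {ffun 'I_k -> bool})
    1 * fine ((P \x P)%E ((fun w => ghost w \o swap f) @^-1` unbalanced s)) <=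
  ((k * 2).+1 ^ VCdim)%:R * (2 * (2 ^+ k * expR (2 * l ^+ 2 * k%:R - l * s))).
  apply: lincomb_probability_le => [f|w].
    have [mg _] := iid_law_reindex (@swap_inj f) ghost_iid.
    by have := measurable_seq mg measurableT (measurable_unbalanced s); rewrite setTI.
  apply: le_trans (card_swaps VC (pairs_of halves (ghost w)) s l01).
  rewrite -sum1_card natr_sum [leRHS]big_mkcond/=; apply: ler_sum => f _.
  rewrite mul1r indicE inE; case: ifPn => [|/asboolPn nf]; first by rewrite lern1 leq_b1.
  rewrite memNset//; move=> [p ps]; apply: nf; exists p.
  by under eq_bigr do rewrite -imbalance_swap.
have {H} : 2 ^+ k * fine ((P \x P)%E (ghost @^-1` unbalanced s)) <=
    2 ^+ k * (((k * 2).+1 ^ VCdim)%:R * (2 * expR (2 * l ^+ 2 * k%:R - l * s))).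
  apply: le_trans (le_trans H _); last by rewrite le_eqVlt; apply/orP; left; apply/eqP; ring.
  under eq_bigr do rewrite mul1r -swap_law.
  by rewrite sumr_const card_ffun card_bool card_ord -[X in _ <= X]mulr_natl natrX.
by rewrite ler_pM2l// exprn_gt0.
Qed.

End symmetrization.

(** * Second moment estimate for disjoint pairs *)

Section chebyshev.
Context {R : realType} d0 (M : measurableType d0) (mu : probability M R).
Context d (T : measurableType d) (P : probability T R).
Variable Y : T -> nat -> M.
Hypothesis Y_iid : iid_law mu P Y.
Variables (k : nat) (e : 'I_k * bool -> nat).
Hypothesis e_inj : injective e.
Variable C : set (M * M).
Hypothesis mC : measurable C.

Definition hits (i : 'I_k) : set T := [set w | C (Y w (e (i, false)), Y w (e (i, true)))].

Definition pair_prob : R := fine ((mu \x mu)%E C).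

Lemma measurable_hits i : measurable (hits i).
Proof.
have := measurable_seq Y_iid.1 measurableT (measurable_coord2 (e (i, false)) (e (i, true)) mC).
by rewrite setTI.
Qed.

Lemma hits_law i : P (hits i) = (mu \x mu)%E C.
Proof.
have finj : injective (fun c : bool => e (i, c)) by move=> c c' /e_inj[].
exact: (iid_law_unique (iid_law_reindex finj Y_iid) (iid_law_prod mu)
  (measurable_coord2 false true mC)).
Qed.

(** The four coordinates involved are distinct, so they have the same law as two taken from each of
    two independent copies of the sample; there the event is a rectangle. *)
Lemma hits_independent i j : i != j ->
  P (hits i `&` hits j) = ((mu \x mu) C * (mu \x mu) C)%E.
Proof.
move=> ij.
pose f (c : bool * bool) := e (if c.1 then j else i, c.2).
pose g (c : bool * bool) : nat + nat := if c.1 then inr (e (j, c.2)) else inl (e (i, c.2)).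
have finj : injective f.
  move=> [[] c] [[] c'] /e_inj [] //=; try by move=> ->.
    by move=> ji; rewrite ji eqxx in ij.
  by move=> ji; rewrite ji eqxx in ij.
have ginj : injective g by move=> [[] c] [[] c'] //= [] /e_inj[->].
pose E : set (seq_space (bool * bool)%type M) :=
  [set y | C (y (false, false), y (false, true))] `&` [set y | C (y (true, false), y (true, true))].
have mE : measurable E by apply: measurableI; exact: measurable_coord2.
have := iid_law_unique (iid_law_reindex finj Y_iid)
  (iid_law_reindex ginj (iid_law_pair Y_iid Y_iid)) mE.
have -> : (fun w j => Y w (f j)) @^-1` E = hits i `&` hits j by [].
move=> ->; rewrite -{1}(hits_law i) -(hits_law j) -product_measure1E//; exact: measurable_hits.
Qed.

Lemma pair_prob_ge0 : 0 <= pair_prob. Proof. by rewrite fine_ge0. Qed.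

Lemma pair_prob_le1 : pair_prob <= 1.
Proof. by rewrite -lee_fin fine_probabilityK// probability_le1. Qed.

Lemma measurable_deviation t :
  measurable [set w | t <= `|\sum_i \1_(hits i) w - k%:R * pair_prob|].
Proof.
have mf : measurable_fun setT (fun w => `|\sum_i \1_(hits i) w - k%:R * pair_prob|).
  apply: measurableT_comp => //; apply: measurable_realfun.measurable_funB => //.
  by apply: measurable_sum => i; apply: measurable_realfun.measurable_indic; exact: measurable_hits.
have := mf measurableT `[t, +oo[%classic; rewrite setTI => /(_ (measurable_itv _)).
by congr measurable; apply/seteqP; split=> w /=; rewrite in_itv/= andbT.
Qed.

(** With [S] the number of hits, the pointwise inequality [t ^+ 2 * \1_B <= (S - k * pair_prob) ^+
    2] is expanded into indicators of [B], of hits and of intersections of two hits, and then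
    integrated term by term. *)
Lemma deviation_chebyshev (t : R) : 0 <= t ->
  t ^+ 2 * fine (P [set w | t <= `|\sum_i \1_(hits i) w - k%:R * pair_prob|]) <= k%:R.
Proof.
move=> t0; set B := [set w | _].
pose I := (unit + ('I_k + 'I_k * 'I_k))%type.
pose a (i : I) : R := match i with inl _ => t ^+ 2 | inr (inl _) => 2 * k%:R * pair_prob | _ => -1 end.
pose A (i : I) := match i with inl _ => B | inr (inl i) => hits i
  | inr (inr ij) => hits ij.1 `&` hits ij.2 end.
have := @lincomb_probability_le _ _ _ P _ a A (k%:R ^+ 2 * pair_prob ^+ 2).
have sumE (F : I -> R) : \sum_i F i = F (inl tt) + (\sum_i F (inr (inl i)) +
    \sum_i \sum_j F (inr (inr (i, j)))).
  rewrite big_sumType/= big_sumType/= pair_bigA/= (big_pred1 tt) //.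
    by congr (_ + (_ + _)); apply: eq_bigr => -[].
rewrite sumE /=.
have -> : \sum_(i < k) 2 * k%:R * pair_prob * fine (P (hits i)) = 2 * k%:R ^+ 2 * pair_prob ^+ 2.
  under eq_bigr do rewrite hits_law -/pair_prob.
  by rewrite sumr_const card_ord -mulr_natl; ring.
have -> : \sum_(i < k) \sum_(j < k) -1 * fine (P (hits i `&` hits j)) =
    - (k%:R * (pair_prob + (k%:R - 1) * pair_prob ^+ 2)).
  have [k0|k0] := posnP k.
    rewrite big1 => [|i _]; last by have := ltn_ord i; rewrite [X in (_ < X)%N]k0.
    by rewrite [X in X%:R]k0 mul0r oppr0.
  rewrite (eq_bigr (fun=> - (pair_prob + (k%:R - 1) * pair_prob ^+ 2))).
    by rewrite sumr_const card_ord -mulr_natl; ring.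
  move=> i _; rewrite (bigD1 i)//= setIid hits_law -/pair_prob.
  rewrite (eq_bigr (fun=> - pair_prob ^+ 2)) => [|j ji].
    rewrite sumr_const cardC1 card_ord -mulr_natl.
    have -> : k%:R = k.-1%:R + 1 :> R by rewrite natr1 prednK.
    by ring.
  have finC : (mu \x mu)%E C \is a fin_num by rewrite -fine_probabilityK.
  rewrite hits_independent 1?eq_sym// fineM// -/pair_prob; ring.
move=> H; have {H} : t ^+ 2 * fine (P B) + (2 * k%:R ^+ 2 * pair_prob ^+ 2 -
    k%:R * (pair_prob + (k%:R - 1) * pair_prob ^+ 2)) <= k%:R ^+ 2 * pair_prob ^+ 2.
  apply: H => [[_|[i|[i j]]]|w] /=.
  - exact: measurable_deviation.
  - exact: measurable_hits.
  - by apply: measurableI; exact: measurable_hits.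
  rewrite sumE /=.
  pose S : R := \sum_(i < k) \1_(hits i) w.
  have -> : \sum_(i < k) 2 * k%:R * pair_prob * \1_(hits i) w = 2 * k%:R * pair_prob * S.
    by rewrite mulr_sumr.
  have -> : \sum_(i < k) \sum_(j < k) -1 * \1_(hits i `&` hits j) w = - S ^+ 2.
    rewrite expr2 mulr_suml -sumrN; apply: eq_bigr => i _.
    rewrite mulr_sumr -sumrN; apply: eq_bigr => j _.
    by rewrite mulN1r indicI.
  suff : t ^+ 2 * \1_B w <= (S - k%:R * pair_prob) ^+ 2 by move=> H; nra.
  rewrite indicE; case: (boolP (w \in B)) => [|_]; last by rewrite mulr0 sqr_ge0.
  rewrite inE /B /= -/S => tS; rewrite mulr1 -[leRHS]real_normK ?num_real//.
  by rewrite ler_sqr// nnegrE.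
have := pair_prob_ge0; have := pair_prob_le1 => th1 th0 H.
have k0 : (0 : R) <= k%:R by [].
have : k%:R * (pair_prob - pair_prob ^+ 2) <= k%:R * 1 :> R by apply: ler_wpM2l => //; nra.
nra.
Qed.

End chebyshev.

Section deviation.
Context {R : realType} {M : ptopologicalType} (b : nat -> set M).
Hypothesis bb : regular_base b.
Hypothesis M_compact : compact [set: M].
Variable D : M * M -> M -> Prop.
Hypothesis D_meets : forall C, closed C ->
  measurable ([set z | exists2 q, C q & D z q] : set (borel M * borel M)).
Hypothesis D_closed : forall z, closed [set p | D z p].
Hypothesis D_measurable : forall p, measurable ([set z | D z p] : set (borel M * borel M)).
Variable VCdim : nat.
Hypothesis VC : forall C : set (M * M), finite_set C ->
  shatters (range (fun p => [set z | D z p])) C -> (C #<= `I_VCdim)%card.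
Variable mu : probability (borel M) R.
Context d (T : measurableType d) (P : probability T R).
Variable Y : T -> nat -> borel M.
Hypothesis Y_iid : iid_law mu P Y.
Variables (k : nat) (e : 'I_k * bool -> nat).
Hypothesis e_inj : injective e.

Let count w p : R := \sum_i \1_(hits Y e [set z | D z p] i) w.
Let th p : R := pair_prob mu ([set z | D z p] : set (borel M * borel M)).

(** If the sample [w] deviates by more than [2 * s], Chebyshev with [2 * k <= s ^+ 2] gives
    probability at least 1/2 that a copy deviates by less than [s], and then the two counts differ
    by more than [s]. So [w] belongs to the set [B] of samples whose section of the symmetrized
    event has probability at least 1/2; Fubini bounds its probability by twice that of the event. *)
Lemma deviation_tail (l s : R) : 0 <= l <= 2^-1 -> 0 < s -> 2 * k%:R <= s ^+ 2 ->
  exists2 B : set T, measurable B /\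
    (P B <= (2 * (((k * 2).+1 ^ VCdim)%:R * (2 * expR (2 * l ^+ 2 * k%:R - l * s))))%:E)%E &
    forall w p, 2 * s < `|count w p - k%:R * th p| -> B w.
Proof.
move=> l01 s0 ks.
pose E := ghost Y e @^-1` unbalanced D s.
have mE : measurable E.
  have [mg _] := ghost_iid Y_iid e_inj.
  by have := measurable_seq mg measurableT (measurable_unbalanced bb M_compact D_meets D_closed (k:=k) s); rewrite setTI.
pose B := [set w | (2^-1%:E <= P (xsection E w))%E].
have mP := measurable_fun_xsection P mE.
have mB : measurable B.
  by have := measurable_realfun.emeasurable_fun_c_infty measurableT mP (2^-1)%:E; rewrite setTI.
exists B; first split=> //.
  have tail := unbalanced_tail bb M_compact D_meets D_closed VC Y_iid e_inj s l01.
  have : (2^-1%:E * P B <= (P \x P) E)%E.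
    rewrite -(setIT B) -integral_indic// -integralZl//; last exact: integrable_indic.
    rewrite /product_measure1; apply: ge0_le_integral => //.
    - apply: measurable_funeM; apply/measurable_realfun.measurable_EFinP.
      exact: measurable_realfun.measurable_indic.
    - move=> w _ /=; rewrite indicE; case: (boolP (w \in B)) => [|_].
        by rewrite inE mule1.
      by rewrite mule0.
  move: tail; rewrite -/E -(fine_probabilityK P mB) -(fine_probabilityK (P \x P)%E mE).
  by rewrite -EFinM !lee_fin => tail BE; lra.
move=> w p far; rewrite /B /=.
have Cheb := deviation_chebyshev Y_iid e_inj (D_measurable p) (ltW s0).
have mdev := measurable_deviation Y_iid e (D_measurable p) s.
set dev := [set w | _] in Cheb mdev.
apply: (@le_trans _ _ (P (~` dev))).
  rewrite probability_setC// -(fine_probabilityK P mdev) -EFinB lee_fin.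
  have : s ^+ 2 * fine (P dev) <= s ^+ 2 * 2^-1 by apply: le_trans Cheb _; lra.
  by rewrite ler_pM2l ?exprn_gt0// => H; lra.
apply: le_measure; rewrite ?inE.
- exact: measurableC.
- exact: measurable_xsection.
move=> w' /negP; rewrite -ltNge => near_; rewrite /xsection /= inE /E /=.
exists p.
rewrite (_ : \sum_i _ = count w p - count w' p).
  have := ler_normD (count w p - count w' p) (count w' p - k%:R * th p).
  by rewrite addrA subrK; move: far near_; rewrite /th /count; lra.
rewrite /count -sumrB; apply: eq_bigr => i _.
rewrite /imbalance !inE /pairs_of /ghost /hits /= !indicE.
by congr (_ - _); congr (_%:R); congr nat_of_bool; apply/idP/idP; rewrite inE => ?; apply/asboolP.
Qed.

End deviation.

(** * From disjoint pairs to all pairs *)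

Section matchings.
Variable N : nat.

(* [a + b] modulo [N] and one of [a], [b] determine the other, so a matching consists
   of disjoint pairs. *)
Definition matching r : {set 'I_N * 'I_N} :=
  [set z : 'I_N * 'I_N | (z.1 < z.2)%N && ((z.1 + z.2) %% N == r)%N]%SET.

Definition endpoint r (j : 'I_#|matching r| * bool) : nat :=
  if j.2 then (enum_val j.1).2 else (enum_val j.1).1.

Lemma matchingP r i : let z := enum_val (A := matching r) i in
  (z.1 < z.2)%N /\ ((z.1 + z.2) %% N = r)%N.
Proof. by have := enum_valP i; rewrite inE => /andP[? /eqP]. Qed.

Lemma mod_cancel (a b c : 'I_N) : ((a + b) %% N = (a + c) %% N)%N -> b = c.
Proof.
move/eqP; rewrite eqn_modDl !modn_small ?ltn_ord// => /eqP bc.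
exact: val_inj.
Qed.

Lemma endpoint_inj r : injective (@endpoint r).
Proof.
move=> [i c] [j c']; rewrite /endpoint /=.
have := matchingP i; have := matchingP j => /=.
set z := enum_val i; set z' := enum_val j => -[lt' e'] [lt e].
have fst_inj : z.1 = z'.1 -> z = z'.
  move=> zz; move: e; rewrite -e' zz => /mod_cancel.
  by move: zz; rewrite [z]surjective_pairing [z']surjective_pairing /= => -> ->.
have snd_inj : z.2 = z'.2 -> z = z'.
  move=> zz; move: e; rewrite -e' zz ![(_ + z'.2)%N]addnC => /mod_cancel.
  by move: zz; rewrite [z]surjective_pairing [z']surjective_pairing /= => -> ->.
(* If the first point of one pair were the second of the other, the equal residues would make the
   pairs mirror images, against [z.1 < z.2] for both. *)
have crossed (x y : 'I_N * 'I_N) : ((x.1 + x.2) %% N = (y.1 + y.2) %% N)%N -> x.1 = y.2 -> x.2 = y.1.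
  by move=> xy x1; move: xy; rewrite x1 [(y.1 + _)%N]addnC => /mod_cancel.
case: c; case: c' => /val_inj zz.
- by congr pair; apply: enum_val_inj; exact: snd_inj.
- by have := crossed z' z; rewrite e e' -zz => /(_ erefl erefl) z21;
    move: lt; rewrite zz -z21 ltnNge ltnW.
- by have := crossed z z'; rewrite e e' zz => /(_ erefl erefl) z21;
    move: lt'; rewrite -zz -z21 ltnNge ltnW.
- by congr pair; apply: enum_val_inj; exact: fst_inj.
Qed.

Lemma card_matching r : (#|matching r| <= N)%N.
Proof.
have f_inj : injective (fun i => (enum_val (A := matching r) i).1).
  move=> i j ij; have : endpoint (i, false) = endpoint (j, false) by rewrite /endpoint /= ij.
  by move/endpoint_inj => -[].
by have := leq_card _ f_inj; rewrite !card_ord.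
Qed.

Lemma sum_matchings (R : realType) (F : 'I_N -> 'I_N -> R) :
  \sum_(i < N) \sum_(j < N | (i < j)%N) F i j =
  \sum_(r < N) \sum_(i < #|matching r|) F (enum_val i).1 (enum_val i).2.
Proof.
have [N0|N0] := posnP N.
  by rewrite !big1// => i _; have := ltn_ord i; rewrite [X in (_ < X)%N]N0.
rewrite (@pair_big_dep _ _ _ _ _ predT (fun i j : 'I_N => (i < j)%N))/=.
rewrite (partition_big (fun z : 'I_N * 'I_N => Ordinal (ltn_pmod (z.1 + z.2)%N N0)) predT)//=.
apply: eq_bigr => r _.
rewrite -(big_enum_val (fun z => F z.1 z.2)).
by apply: eq_bigl => z; rewrite inE -val_eqE.
Qed.

Lemma sum_pairs (R : realType) :
  \sum_(i < N) \sum_(j < N | (i < j)%N) 1 = ('C(N, 2))%:R :> R.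
Proof.
rewrite (exchange_big_dep predT)//= -bin2_sum big_mkord natr_sum; apply: eq_bigr => j _.
rewrite sumr_const; congr (_%:R).
rewrite (eq_card (B := [pred i : 'I_N | (i < j)%N]))// -sum1_card.
rewrite -(big_ord_widen N (fun=> 1)) ?sum1_card ?card_ord//.
exact: ltnW.
Qed.

End matchings.

Section u_statistic.
Context {R : realType} {M : ptopologicalType} (b : nat -> set M).
Hypothesis bb : regular_base b.
Hypothesis M_compact : compact [set: M].
Variable D : M * M -> set M.
Hypothesis D_meets : forall C, closed C ->
  measurable ([set z | exists2 q, C q & D z q] : set (borel M * borel M)).
Hypothesis D_closed : forall z, closed (D z).
Hypothesis D_measurable : forall p, measurable ([set z | D z p] : set (borel M * borel M)).
Variable VCdim : nat.
Hypothesis VC : forall C : set (M * M), finite_set C ->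
  shatters (range (fun p => [set z | D z p])) C -> (C #<= `I_VCdim)%card.
Variable mu : probability (borel M) R.
Context d (T : measurableType d) (P : probability T R).
Variable Y : T -> nat -> borel M.
Hypothesis Y_iid : iid_law mu P Y.

Let th p : R := pair_prob mu ([set z | D z p] : set (borel M * borel M)).

Definition u_statistic N w p : R := ('C(N, 2)%:R)^-1 *
  \sum_(i < N) \sum_(j < N | (i < j)%N) \1_(D (Y w i, Y w j)) p.

(** The factor [N] comes from the union over matchings. The exponent is [2 * l ^+ 2 * N - l * s] for
    the threshold [s = eps * N / 2] and its optimal parameter [l = eps / 8]; the condition
    [eps <= 4] below keeps [l] at most 1/2. *)
Definition tail_bound (eps : R) N : R :=
  N%:R * (4 * ((N * 2).+1 ^ VCdim)%:R * expR (- (eps ^+ 2 / 32) * N%:R)).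

(** A total above [eps * N ^ 2] forces one of the [N] matchings above [eps * N]. The hypothesis
    [8 <= eps ^+ 2 * N] is Chebyshev's requirement [2 * k <= s ^+ 2] for matchings of at most [N]
    pairs. *)
Lemma pair_sum_tail N (eps : R) : 0 < eps <= 4 -> 8 <= eps ^+ 2 * N%:R ->
  exists2 B : set T, measurable B /\ (P B <= (tail_bound eps N)%:E)%E &
    forall w p, eps * N%:R ^+ 2 < `|\sum_(i < N) \sum_(j < N | (i < j)%N)
      (\1_(D (Y w i, Y w j)) p - th p)| -> B w.
Proof.
move=> /andP[e0 e4] eN.
have N0 : (0 : R) < N%:R by rewrite lt_neqAle ler0n andbT eq_sym; apply/eqP => N0; move: eN; rewrite N0; lra.
pose c : R := 4 * ((N * 2).+1 ^ VCdim)%:R * expR (- (eps ^+ 2 / 32) * N%:R).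
have /choice[B HB] : forall r : nat, exists B : set T, [/\ measurable B, (P B <= c%:E)%E &
    forall w p, eps * N%:R < `|\sum_(i < #|matching N r|)
      (\1_(D (Y w (enum_val i).1, Y w (enum_val i).2)) p - th p)| -> B w].
  move=> r; have kN : #|matching N r|%:R <= N%:R :> R by rewrite ler_nat card_matching.
  have l01 : 0 <= eps / 8 <= 2^-1 by lra.
  have s0 : 0 < eps * N%:R / 2 by rewrite divr_gt0// mulr_gt0.
  have ks : 2 * #|matching N r|%:R <= (eps * N%:R / 2) ^+ 2.
    apply: (@le_trans _ _ (2 * N%:R)); first by rewrite ler_pM2l.
    have : 8 * N%:R <= eps ^+ 2 * N%:R * N%:R by rewrite ler_pM2r.
    have -> : (eps * N%:R / 2) ^+ 2 = eps ^+ 2 * N%:R * N%:R / 4 by field.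
    lra.
  have [B [mB PB] BP] := deviation_tail bb M_compact D_meets D_closed D_measurable VC
    Y_iid (@endpoint_inj N r) l01 s0 ks.
  exists B; split=> //.
    apply: le_trans PB _; rewrite lee_fin /c.
    set k := #|_| in kN *; have aux (x y : R) : 2 * (x * (2 * y)) = 4 * (x * y) by ring.
    rewrite aux.
    rewrite -[leRHS]mulrA ler_pM2l//; apply: ler_pM => //; rewrite ?expR_ge0//.
      by rewrite !natrX lerXn2r ?nnegrE// ler_nat ltnS leq_mul2r /k card_matching.
    rewrite ler_expR.
    have : 2 * (eps / 8) ^+ 2 * k%:R <= 2 * (eps / 8) ^+ 2 * N%:R.
      by rewrite ler_wpM2l// mulr_ge0// sqr_ge0.
    have -> : - (eps ^+ 2 / 32) * N%:R = 2 * (eps / 8) ^+ 2 * N%:R - eps / 8 * (eps * N%:R / 2) by field.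
    lra.
  move=> w p H; apply: (BP w p).
  rewrite [X in X < _](_ : _ = eps * N%:R); last by field.
  apply: lt_le_trans H _; rewrite le_eqVlt; apply/orP; left; apply/eqP; congr `|_|.
  by rewrite sumrB sumr_const card_ord mulr_natl.
have mB r : measurable (B r) by have [] := HB r.
exists (\big[setU/set0]_(r < N) B r); first split.
- by apply: bigsetU_measurable => r _.
- apply: le_trans (Boole_inequality P (fun i _ => mB i)) _.
  apply: (@le_trans _ _ (\sum_(r < N) c%:E)%E).
    by apply: lee_sum => r _; have [] := HB r.
  by rewrite sumEFin sumr_const card_ord lee_fin /tail_bound -/c mulr_natl.
move=> w p; rewrite (sum_matchings (fun i j => \1_(D (Y w i, Y w j)) p - th p)) => H.
apply: contrapT => nB; move: H; apply/negP; rewrite -leNgt.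
apply: le_trans (ler_norm_sum _ _ _) _.
apply: (@le_trans _ _ (\sum_(r < N) eps * N%:R)); last first.
  by rewrite sumr_const card_ord -mulr_natl; lra.
apply: ler_sum => r _; rewrite leNgt; apply/negP => H; apply: nB.
have [_ _ /(_ w p H) Br] := HB r.
by rewrite -bigcup_mkord; exists (r : nat) => //=.
Qed.

Lemma u_statistic_tail N (eps : R) : (1 < N)%N -> 0 < eps <= 4 -> 8 <= eps ^+ 2 * N%:R ->
  exists2 B : set T, measurable B /\ (P B <= (tail_bound eps N)%:E)%E &
    forall w p, 4 * eps < `|u_statistic N w p - th p| -> B w.
Proof.
move=> N1 e04 eN; have [B BB BP] := pair_sum_tail e04 eN.
exists B => // w p H; apply: (BP w p).
have C0 : 0 < 'C(N, 2)%:R :> R by rewrite ltr0n bin_gt0.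
have : 'C(N, 2)%:R * (4 * eps) < 'C(N, 2)%:R * `|u_statistic N w p - th p| by rewrite ltr_pM2l.
rewrite -{2}(ger0_norm (ltW C0)) -normrM mulrBr /u_statistic mulVKf ?gt_eqF//.
have -> : 'C(N, 2)%:R * th p = \sum_(i < N) \sum_(j < N | (i < j)%N) th p.
  rewrite -sum_pairs mulr_suml; apply: eq_bigr => i _.
  by rewrite mulr_suml; apply: eq_bigr => j _; rewrite mul1r.
rewrite -sumrB; under eq_bigr do rewrite -sumrB.
apply: le_lt_trans.
(* This holds for [2 <= N] and explains the factor 4 in front of [eps]: the sum is normalized by the
   number of pairs instead of [N ^ 2]. *)
have NC : (N ^ 2 <= 4 * 'C(N, 2))%N.
  have /(congr1 (muln 2)) := bin_ffact N 2; rewrite mulnCA [(2 * 2`!)%N]/= mulnC => ->.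
  by rewrite !ffactnS ffactn0; nia.
have : (N ^ 2)%:R <= (4 * 'C(N, 2))%:R :> R by rewrite ler_nat.
rewrite natrX natrM => H'; case/andP: e04 => e0 _.
by rewrite mulrA ['C(N, 2)%:R * 4]mulrC [leRHS]mulrC ler_pM2l.
Qed.

End u_statistic.

(** * Summable tails, Borel-Cantelli and the uniform law *)

Lemma ae_eventually_outside (R : realType) d (T : measurableType d) (P : probability T R)
    (F : nat -> set T) (K q : R) :
  (forall k, measurable (F k)) -> 0 <= K -> 0 <= q < 1 ->
  (forall k, (P (F k) <= (K * q ^+ k)%:E)%E) ->
  {ae P, forall w, exists k, forall j, (k <= j)%N -> ~ F j w}.
Proof.
move=> mF K0 /andP[q0 q1] PF.
have S : (\sum_(k <oo) P (F k) < +oo)%E.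
  apply: (@le_lt_trans _ _ (K / (1 - q))%:E); last by rewrite ltry.
  apply: lime_le; first exact: is_cvg_nneseries.
  apply: nearW => n.
  apply: (@le_trans _ _ (\sum_(0 <= k < n) (K * q ^+ k)%:E)%E).
    by apply: lee_sum => k _; exact: PF.
  rewrite sumEFin lee_fin -mulr_sumr ler_wpM2l// big_mkord.
  rewrite -[leRHS]mul1r ler_pdivlMr ?subr_gt0//.
  have := subrX1 q n; have : 0 <= q ^+ n by rewrite exprn_ge0.
  by move=> qn E; rewrite mulrC -opprB mulNr -E; lra.
have null := lim_sup_set_cvg0 mF S.
exists (lim_sup_set F); split.
- apply: bigcap_measurable => // k _; exact: bigcup_measurable.
- exact: null.
- move=> w /= nw k _; apply: contrapT => H; apply: nw; exists k => j kj Fj.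
  by apply: H; exists j.
Qed.

(** Apply [y <= expR y] to [y = x * c / j.+1] and raise to the power [j.+1]. *)
Lemma poly_le_expR (R : realType) j (c x : R) : 0 < c -> 0 <= x ->
  x ^+ j.+1 <= (j.+1%:R / c) ^+ j.+1 * expR (x * c).
Proof.
move=> c0 x0; have j0 : j.+1%:R != 0 :> R by rewrite pnatr_eq0.
have jp : (0 : R) < j.+1%:R by rewrite ltr0n.
move: (j.+1%:R) j0 jp (expRM_natr j.+1 (x * c / j.+1%:R)) => J J0 Jp E.
have {1}-> : x = (J / c) * (x * c / J) by field; rewrite J0 gt_eqF.
rewrite exprMn ler_wpM2l ?exprn_ge0 ?divr_ge0 ?(ltW Jp) ?(ltW c0)//.
have {2}-> : x * c = x * c / J * J by field.
rewrite E lerXn2r ?nnegrE ?expR_ge0//.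
  by rewrite divr_ge0// ?mulr_ge0// ltW.
by have := expR_ge1Dx (x * c / J); lra.
Qed.

Lemma tail_bound_geometric (R : realType) v (eps : R) : 0 < eps ->
  exists2 Kq : R * R, 0 <= Kq.1 /\ 0 <= Kq.2 < 1 &
  forall N, tail_bound v eps N <= Kq.1 * Kq.2 ^+ N.
Proof.
move=> e0; rewrite /tail_bound; have : 0 < eps ^+ 2 / 32 by rewrite divr_gt0// exprn_gt0.
move: (eps ^+ 2 / 32) => c c0; have c4 : 0 < c / 4 by rewrite divr_gt0.
(* The polynomial in [(N * 2).+1] is absorbed at rate [c / 4], which costs [c / 2] per unit of [N]
   and leaves half of the decay; the offset 1 accounts for the factor [expR (c / 4)]. *)
exists (4 * (v.+1%:R / (c / 4)) ^+ v.+1 * expR (c / 4), expR (- (c / 2))) => /=.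
  split; first by rewrite !mulr_ge0 ?expR_ge0// exprn_ge0// divr_ge0// ltW.
  by rewrite expR_ge0 expR_lt1 oppr_lt0 divr_gt0.
move=> N; have := poly_le_expR v c4 (ler0n R (N * 2).+1).
move: ((v.+1%:R / (c / 4)) ^+ v.+1) => K H.
rewrite -expRM_natr.
have -> : - (c / 2) * N%:R = (N * 2).+1%:R * (c / 4) - c / 4 - c * N%:R.
  by rewrite -[(N * 2).+1]addn1 natrD natrM; field.
apply: (@le_trans _ _ (4 * (N * 2).+1%:R ^+ v.+1 * expR (- c * N%:R))).
  rewrite mulrA ler_wpM2r ?expR_ge0// mulrCA ler_pM2l// exprS natrX.
  by rewrite ler_wpM2r// ler_nat; lia.
have AA : expR (c / 4) * expR (- (c / 4)) = 1 by rewrite -expRD subrr expR0.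
have E0 : 0 <= expR (- (c * N%:R)) by exact: expR_ge0.
rewrite mulNr 2!expRD; move: AA E0 H.
move: (expR (c / 4)) (expR (- (c / 4))) (expR (- (c * N%:R))) (expR ((N * 2).+1%:R * (c / 4))) => A A' E3 E1 AA E0 H.
rewrite [leRHS](_ : _ = 4 * (K * E1) * E3 * (A * A')); last by ring.
by rewrite AA mulr1 ler_wpM2r// ler_pM2l.
Qed.

Section uniform_law.
Context {R : realType} {M : ptopologicalType} (b : nat -> set M).
Hypothesis bb : regular_base b.
Hypothesis M_compact : compact [set: M].
Variable D : M * M -> set M.
Hypothesis D_meets : forall C, closed C ->
  measurable ([set z | exists2 q, C q & D z q] : set (borel M * borel M)).
Hypothesis D_closed : forall z, closed (D z).
Hypothesis D_measurable : forall p, measurable ([set z | D z p] : set (borel M * borel M)).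
Variable VCdim : nat.
Hypothesis VC : forall C : set (M * M), finite_set C ->
  shatters (range (fun p => [set z | D z p])) C -> (C #<= `I_VCdim)%card.
Variable mu : probability (borel M) R.
Context d (T : measurableType d) (P : probability T R).
Variable Y : T -> nat -> borel M.
Hypothesis Y_iid : iid_law mu P Y.

Let th p : R := pair_prob mu ([set z | D z p] : set (borel M * borel M)).

Lemma u_statistic_eventually (eps : R) : 0 < eps <= 4 ->
  {ae P, forall w, exists k, forall N, (k <= N)%N -> forall p,
    `|u_statistic D Y N w p - th p| <= 4 * eps}.
Proof.
move=> e04; have e0 : 0 < eps by case/andP: e04.
have [[K q] /= [K0 q01] tailK] := @tail_bound_geometric R VCdim eps e0.
(* The two conditions of the tail estimate, [1 < N] and [8 <= eps ^+ 2 * N]. *)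
pose N0 := maxn 2 (Num.Def.archi_bound (8 / eps ^+ 2)).
have HN0 N : (N0 <= N)%N -> (1 < N)%N /\ 8 <= eps ^+ 2 * N%:R.
  rewrite geq_max => /andP[N1 N2]; split=> //.
  rewrite mulrC -ler_pdivrMr ?exprn_gt0//.
  have : 8 / eps ^+ 2 < (Num.Def.archi_bound (8 / eps ^+ 2))%:R.
    by rewrite archi_boundP// divr_ge0// sqr_ge0.
  by move/ltW/le_trans; apply; rewrite ler_nat.
have /choice[B HB] : forall N, exists B : set T, [/\ measurable B,
    (P B <= (K * q ^+ N)%:E)%E &
    (N0 <= N)%N -> forall w p, 4 * eps < `|u_statistic D Y N w p - th p| -> B w].
  (* Below [N0] the empty set serves, so that the geometric bound holds at every index. *)
  move=> N; have [/HN0[N1 N2]|_] := leqP N0 N; last first.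
    by exists set0; split=> //; rewrite measure0 lee_fin mulr_ge0// exprn_ge0//; case/andP: q01.
  have [B [mB PB] BP] := u_statistic_tail bb M_compact D_meets D_closed D_measurable VC Y_iid N1 e04 N2.
  by exists B; split=> //; apply: le_trans PB _; rewrite lee_fin.
have mB k : measurable (B k) by have [] := HB k.
have PB k : (P (B k) <= (K * q ^+ k)%:E)%E by have [] := HB k.
apply: filterS (ae_eventually_outside mB K0 q01 PB) => w [k kP].
exists (maxn k N0) => N; rewrite geq_max => /andP[kN NN] p.
rewrite leNgt; apply/negP => H; apply: (kP N kN).
by have [_ _ /(_ NN w p H)] := HB N.
Qed.

Lemma u_statistic_uniform_cvg : {ae P, forall w,
  (fun m => sup (range (fun p : M => `|u_statistic D Y m w p - th p|))) @ \oo --> (0 : R)}.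
Proof.
have e04 (l : nat) : 0 < (l.+1%:R : R)^-1 <= 4.
  by rewrite invr_gt0 ltr0n/= (@le_trans _ _ 1)// ?invf_le1 ?ltr0n ?ler1n//; lra.
(* Only countably many tolerances are used, so their exceptional sets have a negligible union. *)
apply: filterS (ae_foralln (fun l => u_statistic_eventually (e04 l))) => w H.
apply/cvgr0Pnorm_le => e e0.
have /ltr_add_invr [l le] : 0 < e / 4 by rewrite divr_gt0.
have [k kP] := H l.
exists k => // N /= kN.
set S := (X in sup X).
have ubS : ubound S e.
  move=> _ [p _ <-]; apply: le_trans (kP N kN p) _.
  by move: le; rewrite add0r; move: (_^-1) => x xe; lra.
(* The distinguished point of [M] makes the set nonempty; together with [ubS] this ensures that
   [sup] is a genuine supremum. *)
have S0 : S (`|u_statistic D Y N w point - th point|) by exists point.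
rewrite ger0_norm.
  by apply: sup_le_ub => //; exists (`|u_statistic D Y N w point - th point|).
apply: le_trans (ub_le_sup _ S0) => //; exists e; exact: ubS.
Qed.

End uniform_law.

Theorem theorem3p3 (R : realType) (n : nat) (M : ptopologicalType)
  (G : oriented_riemannian R n M)
  (M_compact : compact [set: M]) (M_connected : connected [set: M])
  (nu : {measure set (borel M) -> \bar R}) (nu_volume : is_volume G nu)
  (d0 : measure_display) (T0 : measurableType d0) (P0 : probability T0 R)
  (X : {mfun T0 >-> borel M})
  (f : borel M -> R) (f_measurable : measurable_fun [set: borel M] f)
  (f_ge0 : forall x, 0 <= f x)
  (X_density : forall A : set (borel M), measurable A ->
     distribution P0 X A = (\int[nu]_(x in A) (f x)%:E)%E)
  (X_joined : {ae (distribution P0 X \x distribution P0 X)%E,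
     forall z : borel M * borel M, uniquely_joined G z.1 z.2})
  (A_VC : finite_VC_dimension (range (depth_set G)))
  (d : measure_display) (T : measurableType d) (P : probability T R)
  (Xs : nat -> {mfun T >-> borel M})
  (Xs_independent : mutually_independent P Xs)
  (Xs_distributed : forall i (A : set (borel M)), measurable A ->
     distribution P (Xs i) A = distribution P0 X A) :
  {ae P, forall w : T,
    (fun m => sup (range (fun p : M =>
       `|empirical_depth G (fun i => Xs i w) m p
         - depth G (distribution P0 X) p|))) @ \oo --> (0 : R)}.
Proof.
have hM := manifold_hausdorff G.
have [b bb] := regular_base_exists hM M_compact (manifold_second_countable G).
pose D (z : M * M) : set M := geodesic_ball G z.1 z.2.
have D_meets C (cC : closed C) := measurable_ball_meets G M_compact M_connected bb cC.
have D_closed z : closed (D z) by exact: closed_geodesic_ball.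
have D_measurable p : measurable ([set z | D z p] : set (borel M * borel M)).
  (* Containing [p] is the same as meeting the closed set [{p}]. *)
  have cp : closed [set p].
    by apply: (accessible_finite_set_closed.1 (hausdorff_accessible hM)); exact: finite_set1.
  rewrite (_ : [set z | D z p] = [set z | exists2 q, [set p] q & D z q]); first exact: D_meets.
  by apply/seteqP; split=> z /= => [Dp|[_ ->]//]; exists p.
have [v VC] := A_VC.
have VC' (C : set (M * M)) : finite_set C ->
    shatters (range (fun p => [set z | D z p])) C -> (C #<= `I_v)%card.
  move=> fC; rewrite (_ : (fun p => [set z | D z p]) = depth_set G); first exact: VC.
  by apply/funext => p; rewrite depth_setE.
have iid : iid_law (distribution P0 X) P (fun w i => Xs i w : borel M).
  split=> [i|s A us mA]; first exact: measurable_funP.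
  rewrite (_ : [set w | _] = \bigcap_(i in [set` s]) (Xs i @^-1` A i)); last first.
    by apply/seteqP; split.
  rewrite Xs_independent//; apply: eq_bigr => i _.
  exact: Xs_distributed.
exact: (u_statistic_uniform_cvg bb M_compact D_meets D_closed D_measurable VC' iid).
Qed.
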